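(* Let $n,d\in\mathbb N$, $d\ge2$, $u\in\mathcal U^n(\mathbb R)$, $f:=-\mathrm{abs}*u$, $F:=\mathcal I_d[f]$ and $\Phi(x):=F(\|x\|)$ for $x\in\mathbb R^d$. Then: (i) $\Phi\in\mathrm{CP}_1(\mathbb R^d)$; (ii) $\Phi(x)<0$ for all $x\in\mathbb R^d$; (iii) $\Phi(x)=-C_d\|x\|+\varphi(\|x\|)$ for some $\varphi\in\mathcal C_0(\mathbb R)$ with $\varphi(s)=\mathcal O(1/s)$ as $s\to\infty$, where $C_d=\frac{\Gamma(d/2)}{\sqrt\pi\Gamma(\frac{d+1}{2})}$; (iv) $\Phi\in\mathcal C^{n+2}(\mathbb R^d)$; (v) $\nabla\Phi$ is Lipschitz continuous with constant $L:=2\sqrt d\,\|u\|_\infty$; (vi) $\Phi$ is concave, and for all $\lambda\in[0,1]$, $x,y\in\mathbb R^d$, $$\Phi(\lambda x+(1-\lambda)y)\le\lambda\Phi(x)+(1-\lambda)\Phi(y)+\tfrac L2\lambda(1-\lambda)\|x-y\|^2.$$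
   Context: $\mathrm{abs}(x)=|x|$. $\mathcal U^n(\mathbb R):=\{u\in\mathcal C^n_c(\mathbb R):u\ge0,\ \hat u\ge0,\ u\text{ even},\ \int u=1\}$ with $\hat u(\omega)=\int e^{-2\pi ix\omega}u(x)\mathrm dx$. $\mathcal I_d[f](s):=c_d\int_0^1f(ts)(1-t^2)^{\frac{d-3}{2}}\mathrm dt$, $c_d:=2w_{d-2}/w_{d-1}$, $w_{d-1}:=2\pi^{d/2}/\Gamma(d/2)$. $\mathrm{CP}_1(\mathbb R^d)$: continuous even $g$ with $\sum_{j,k}a_j\bar a_kg(x_j-x_k)\ge0$ for all points $x_1,\dots,x_N\in\mathbb R^d$ and all $a\in\mathbb C^N\setminus\{0\}$ with $\sum_ja_j=0$. *)

(* Defs.v *)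
From HB Require Import structures.
From mathcomp Require Import all_boot all_order all_algebra.
From mathcomp Require Import all_classical all_reals all_analysis.
From mathcomp Require Import complex.
Set Implicit Arguments. Unset Strict Implicit. Unset Printing Implicit Defensive.
Import Order.TTheory GRing.Theory Num.Theory.
Import numFieldNormedType.Exports.
Local Open Scope classical_set_scope.
Local Open Scope ring_scope.

Fixpoint Cn_real {R : realType} (k : nat) (f : R -> R) : Prop :=
  match k with
  | 0 => continuous f
  | k.+1 => (forall x : R, derivable f x 1) /\ Cn_real k (derive1 f)
  end.

Definition compact_support {R : realType} (f : R -> R) : Prop :=
  compact (closure [set x | f x != 0]).

(* Fourier transform  \hat u(w) = \int e^{-2 pi i x w} u(x) dx,
   written out in real and imaginary parts (values in R[i]) *)
Definition fourier {R : realType} (u : R -> R) (w : R) : R[i] :=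
  Complex (Rintegral lebesgue_measure setT (fun x => cos (2 * pi * x * w) * u x))
          (- Rintegral lebesgue_measure setT (fun x => sin (2 * pi * x * w) * u x)).

Definition Uspace {R : realType} (n : nat) (u : R -> R) : Prop :=
  [/\ Cn_real n u, compact_support u,
      (forall x, 0 <= u x) /\ (forall w, 0 <= fourier u w),
      (forall x, u (- x) = u x)
    & (\int[lebesgue_measure]_x (u x)%:E = 1)%E].

Definition neg_abs_conv {R : realType} (u : R -> R) (x : R) : R :=
  - Rintegral lebesgue_measure setT (fun y => `|x - y| * u y).

Definition Gamma {R : realType} (x : R) : R :=
  Rintegral lebesgue_measure `]0, +oo[%classic (fun t => powR t (x - 1) * expR (- t)).

(* sphere_meas d = w_{d-1} = 2 pi^{d/2} / Gamma(d/2) (surface of S^{d-1}) *)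
Definition sphere_meas {R : realType} (d : nat) : R :=
  2 * powR pi (d%:R / 2) / Gamma (d%:R / 2).

Definition c_const {R : realType} (d : nat) : R :=
  2 * sphere_meas d.-1 / sphere_meas d.

Definition I_op {R : realType} (d : nat) (f : R -> R) (s : R) : R :=
  c_const d * Rintegral lebesgue_measure `[0, 1]%classic
    (fun t => f (t * s) * powR (1 - t ^+ 2) ((d%:R - 3) / 2)).

Definition C_const {R : realType} (d : nat) : R :=
  Gamma (d%:R / 2) / (Num.sqrt pi * Gamma ((d%:R + 1) / 2)).

Definition supnorm {R : realType} (u : R -> R) : R :=
  sup [set `|u x| | x in setT].

Definition C0_real {R : realType} (phi : R -> R) : Prop :=
  continuous phi /\ phi x @[x --> +oo] --> 0 /\ phi x @[x --> -oo] --> 0.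

Definition bigO_inv_at_infty {R : realType} (phi : R -> R) : Prop :=
  exists K M : R, forall s : R, M < s -> `|phi s| <= K / s.

Definition enorm {R : realType} {d : nat} (x : 'rV[R]_d) : R :=
  Num.sqrt (\sum_i x 0 i ^+ 2).

Definition basis_vec {R : realType} {d : nat} (i : 'I_d) : 'rV[R]_d :=
  delta_mx 0 i.

Definition partial {R : realType} {d : nat} (i : 'I_d) (f : 'rV[R]_d -> R)
  (x : 'rV[R]_d) : R := 'D_(basis_vec i) f x.

Definition grad {R : realType} {d : nat} (f : 'rV[R]_d -> R) (x : 'rV[R]_d)
  : 'rV[R]_d := \row_i partial i f x.

Fixpoint Ck_vec {R : realType} {d : nat} (k : nat) (f : 'rV[R]_d -> R) : Prop :=
  match k with
  | 0 => continuous f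
  | k.+1 => (forall (i : 'I_d) x, derivable f x (basis_vec i)) /\
            (forall i : 'I_d, Ck_vec k (partial i f))
  end.

Definition CP1 {R : realType} {d : nat} (g : 'rV[R]_d -> R) : Prop :=
  [/\ continuous g, (forall x, g (- x) = g x) &
   forall (N : nat) (x : 'I_N -> 'rV[R]_d) (a : 'I_N -> R[i]),
     (exists j, a j != 0) -> \sum_j a j = 0 ->
     0 <= \sum_j \sum_k a j * (a k)^* * Complex (g (x j - x k)) 0].

Definition concave_fun {R : realType} {d : nat} (g : 'rV[R]_d -> R) : Prop :=
  forall (lam : R) (x y : 'rV[R]_d), 0 <= lam <= 1 ->
    lam * g x + (1 - lam) * g y <= g (lam *: x + (1 - lam) *: y).

(* Main.v *)
Require Import Defs.
From HB Require Import structures.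
From mathcomp Require Import all_boot all_order all_algebra.
From mathcomp Require Import all_classical all_reals all_analysis.
From mathcomp Require Import measurable_realfun complex ring lra.
Import Order.TTheory GRing.Theory Num.Theory.
Import numFieldNormedType.Exports.
Local Open Scope classical_set_scope.
Local Open Scope ring_scope.

(** The average of [f(<xi, x>)] over the unit sphere only depends on the norm of
[x] and equals [I_d f (|x|)]; all the claims therefore descend from the
one-dimensional function [f = - abs * u] through a positive linear functional.
The spherical average is built by iterating integrals over latitudes; its
moments [<xi, x>^n] are computed by a Wallis recursion, and uniform polynomial
approximation extends the resulting identity to [f].

In dimension one, [f'' = - 2 u] and [f = - abs] outside the support of [u], so
that [f] is concave, [f + |u|_oo z^2] is convex, and [f + abs] has compact
support. Fejer means express [u], locally uniformly, as a limit of combinations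
of cosines with coefficients [hat u (k / T) >= 0]; integrating twice, [f] is a
limit of positive combinations of [- x^2] and [cos (a x) - 1], which are
conditionally positive definite, and is also a limit of polynomials.

The Lipschitz constant uses [c_d int t^2 (1-t^2)^((d-3)/2) <= C_d <= sqrt d],
where the last step is the arithmetic-geometric mean inequality under the
Gamma integral. *)

(** Dependence on the norm alone is reached through moments: two positive functionals with the same
    moments agree on every function that polynomials approximate uniformly on segments, and the
    moments of the latitude integral only see the norm of [x]. This is why polynomial approximation
    of [f] enters; it follows from the cosine approximation by Taylor polynomials. Fejer means turn
    the sign of [hat u] directly into nonnegative coefficients of finite sums. The functionals act
    on continuous functions tested on a compact set, so limits and derivatives pass through them by
    uniform closeness. The weight [(1 - t^2)^((d-3)/2)] is singular at 1 when [d = 2]; the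
    substitution [t = sin theta] removes the singularity, and both integrals are compared on
    truncated intervals. The Gamma function enters through its recursion, its positivity and one
    midpoint inequality, which suffices because [C_d = c_d / (d - 1)]. *)

Section continuous_functions.
Context {R : realType} {T : topologicalType}.
Implicit Types f g : T -> R.

Lemma continuous_add f g : continuous f -> continuous g ->
  continuous (fun x => f x + g x).
Proof. by move=> cf cg x; apply: cvgD; [exact: cf|exact: cg]. Qed.

Lemma continuous_sub f g : continuous f -> continuous g ->
  continuous (fun x => f x - g x).
Proof. by move=> cf cg x; apply: cvgB; [exact: cf|exact: cg]. Qed.

Lemma continuous_opp f : continuous f -> continuous (fun x => - f x).
Proof. by move=> cf x; apply: cvgN; exact: cf. Qed.

Lemma continuous_mul f g : continuous f -> continuous g ->
  continuous (fun x => f x * g x).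
Proof. by move=> cf cg x; apply: cvgM; [exact: cf|exact: cg]. Qed.

Lemma continuous_scale (k : R) f : continuous f -> continuous (fun x => k * f x).
Proof. by move=> cf; apply: continuous_mul => //; exact: cst_continuous. Qed.

Lemma continuous_pow n f : continuous f -> continuous (fun x => f x ^+ n).
Proof.
move=> cf; elim: n => [|n IH].
  by under eq_fun do rewrite expr0; exact: cst_continuous.
by under eq_fun do rewrite exprS; exact: continuous_mul.
Qed.

Lemma continuous_norm f : continuous f -> continuous (fun x => `|f x|).
Proof. by move=> cf x; apply: cvg_norm; exact: cf. Qed.

End continuous_functions.

Lemma continuous_compE {U V W : topologicalType} (f : V -> W) (g : U -> V) :
  continuous f -> continuous g -> continuous (fun x => f (g x)).
Proof. by move=> cf cg x; apply: (@continuous_comp U V W g f); [exact: cg|exact: cf]. Qed.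

Lemma continuous_idE {R : realType} : continuous (fun x : R => x).
Proof. by move=> x; exact: cvg_id. Qed.

(** * Calculus on the line: derivatives, mean values, convexity, primitives *)

Section real_functions.
Context {R : realType}.
Implicit Types (f df ddf g F h : R -> R).

Notation mu := (@lebesgue_measure R).

Lemma is_derive_continuous f df : (forall x : R, is_derive x 1 f (df x)) ->
  continuous f.
Proof.
move=> fd x; apply: differentiable_continuous; apply/derivable1_diffP.
by have := fd x; case.
Qed.

Lemma is_derive_cstE (c x : R) : is_derive x (1 : R) (fun=> c) 0.
Proof. exact: is_derive_cst. Qed.

Lemma is_derive_idE (x : R) : is_derive x (1 : R) (fun t => t) 1.
Proof. exact: is_derive_id. Qed.

Lemma is_derive_add {f g} {x a b : R} : is_derive x 1 f a -> is_derive x 1 g b ->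
  is_derive x 1 (fun t => f t + g t) (a + b).
Proof. exact: is_deriveD. Qed.

Lemma is_derive_bigsum (I : Type) (s : seq I) (F : I -> R -> R) (d : I -> R) (x : R) :
  (forall i, is_derive x 1 (F i) (d i)) ->
  is_derive x 1 (fun t => \sum_(i <- s) F i t) (\sum_(i <- s) d i).
Proof.
move=> Fd; elim: s => [|i s IH].
  by rewrite big_nil; under eq_fun do rewrite big_nil; exact: is_derive_cstE.
by rewrite big_cons; under eq_fun do rewrite big_cons; exact: is_derive_add.
Qed.

Lemma is_derive_opp {f} {x a : R} : is_derive x 1 f a ->
  is_derive x 1 (fun t => - f t) (- a).
Proof. exact: is_deriveN. Qed.

Lemma is_derive_mul {f g} {x a b : R} : is_derive x 1 f a -> is_derive x 1 g b ->
  is_derive x 1 (fun t => f t * g t) (f x * b + g x * a).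
Proof. exact: is_deriveM. Qed.

Lemma is_derive_scale {f} (k : R) {x a : R} : is_derive x 1 f a ->
  is_derive x 1 (fun t => k * f t) (k * a).
Proof. exact: is_deriveZ. Qed.

Lemma is_derive_pow {f} (n : nat) {x a : R} : is_derive x 1 f a ->
  is_derive x 1 (fun t => f t ^+ n.+1) (n.+1%:R * f x ^+ n * a).
Proof.
by move=> fa; have := @is_deriveX R _ f n.+1 x 1 a fa; rewrite exprfctE.
Qed.

Lemma is_derive_compE {f g} {x a b : R} : is_derive (g x) 1 f a ->
  is_derive x 1 g b -> is_derive x 1 (fun t => f (g t)) (a * b).
Proof. exact: is_derive1_comp. Qed.

Lemma is_derive_shift_scale {f} (a k : R) {x d : R} :
  is_derive (a + k * x) 1 f d -> is_derive x 1 (fun t => f (a + k * t)) (k * d).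
Proof.
move=> fd; rewrite mulrC; apply: (@is_derive_compE f (fun t => a + k * t) x d k fd).
have := is_derive_add (is_derive_cstE a x) (is_derive_scale k (is_derive_idE x)).
by rewrite add0r mulr1.
Qed.

Lemma mvt_all f df (a b : R) : (forall x : R, is_derive x 1 f (df x)) -> a <= b ->
  exists2 c, a <= c <= b & f b - f a = df c * (b - a).
Proof.
move=> fd ab.
have cf : {within `[a, b], continuous f}.
  apply: continuous_subspaceT; exact: is_derive_continuous fd.
have [c] := @MVT_segment _ f df a b ab (fun x _ => fd x) cf.
by rewrite in_itv/= => cab e; exists c.
Qed.

Lemma nondecreasing_ge0_derive f df : (forall x : R, is_derive x 1 f (df x)) ->
  forall a b : R, (forall c, a <= c <= b -> 0 <= df c) -> a <= b -> f a <= f b.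
Proof.
move=> fd a b d0 ab; have [c cab e] := mvt_all _ _ _ _ fd ab.
by rewrite -subr_ge0 e mulr_ge0 ?d0// subr_ge0.
Qed.

(** The mean value theorem produces a slope [df y] with [y] between [c] and [x], and [df] is
    monotone; the two positions of [x] relative to [c] are treated separately. *)
Lemma second_order_ge f df ddf (c x : R) : (forall x : R, is_derive x 1 f (df x)) ->
  (forall x : R, is_derive x 1 df (ddf x)) -> (forall x : R, 0 <= ddf x) ->
  f c + df c * (x - c) <= f x.
Proof.
move=> fd dfd dd0.
have mono a b : a <= b -> df a <= df b.
  by apply: nondecreasing_ge0_derive dfd _ _ _ => *; exact: dd0.
have [cx|/ltW xc] := leP c x.
  have [y /andP[cy _] e] := mvt_all _ _ _ _ fd cx.
  by rewrite addrC -lerBrDr e ler_wpM2r ?subr_ge0// mono.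
have [y /andP[_ yc] e] := mvt_all _ _ _ _ fd xc.
rewrite -[leRHS]opprK lerNr.
have -> : - (f c + df c * (x - c)) = - f c + df c * (c - x) by ring.
have -> : - f x = - f c + df y * (c - x) by rewrite -e; ring.
by rewrite lerD2l ler_wpM2r ?subr_ge0// mono.
Qed.

(** Average the two tangent inequalities based at the convex combination [c] itself: the slope terms
    cancel. *)
Lemma convex_ge0_derive2 f df ddf (l a b : R) :
  (forall x : R, is_derive x 1 f (df x)) ->
  (forall x : R, is_derive x 1 df (ddf x)) -> (forall x : R, 0 <= ddf x) ->
  0 <= l <= 1 -> f (l * a + (1 - l) * b) <= l * f a + (1 - l) * f b.
Proof.
move=> fd dfd dd0 /andP[l0 l1]; set c := l * a + _.
have ha := second_order_ge _ _ _ c a fd dfd dd0.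
have hb := second_order_ge _ _ _ c b fd dfd dd0.
have l1' : 0 <= 1 - l by rewrite subr_ge0.
have := lerD (ler_wpM2l l0 ha) (ler_wpM2l l1' hb).
apply: le_trans; rewrite le_eqVlt; apply/orP; left; apply/eqP.
rewrite /c; ring.
Qed.

Lemma integrable_segment f (a b : R) : continuous f ->
  mu.-integrable `[a, b] (EFin \o f).
Proof.
move=> cf; apply: continuous_compact_integrable; first exact: segment_compact.
exact: continuous_subspaceT.
Qed.

Lemma ftc f F (a b : R) : a <= b -> continuous f ->
  (forall x : R, is_derive x 1 F (f x)) ->
  \int[mu]_(x in `[a, b]) f x = F b - F a.
Proof.
rewrite le_eqVlt => /predU1P[->|ab] cf Fd.
  by rewrite subrr set_itv1 Rintegral_set1.
have cF := is_derive_continuous _ _ Fd.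
rewrite /Rintegral (@continuous_FTC2 _ _ F _ _ ab)//.
- exact: continuous_subspaceT.
- split.
  + by move=> x _; have := Fd x; case.
  + apply: cvg_at_right_filter; exact: cF.
  + apply: cvg_at_left_filter; exact: cF.
- by move=> x _; rewrite derive1E; have := Fd x; case.
Qed.

End real_functions.

Lemma continuous_bigsum {R : realType} {T : topologicalType} (I : Type)
    (r : seq I) (F : I -> T -> R) : (forall i, continuous (F i)) ->
  continuous (fun x => \sum_(i <- r) F i x).
Proof.
move=> cF; elim: r => [|i r IH].
  by under eq_fun do rewrite big_nil; exact: cst_continuous.
under eq_fun do rewrite big_cons.
by move=> x; apply: cvgD; [exact: cF|exact: IH].
Qed.

Lemma continuous_slice {U T V : topologicalType} {H : U -> T -> V} (u : U) :
  continuous (fun p : U * T => H p.1 p.2) -> continuous (H u).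
Proof.
move=> cH x.
apply: (@continuous_comp T (U * T)%type V (fun x => (u, x)) (fun p => H p.1 p.2)).
  by apply: cvg_pair; [exact: cvg_cst|exact: cvg_id].
exact: cH.
Qed.

(** A tube lemma: joint continuity and compactness make pointwise closeness uniform on [K]. It
    drives both continuity and differentiation under a positive functional. *)
Lemma near_uniform_compact {R : realType} {U T : topologicalType} (K : set T)
    (H : U -> T -> R) (u : U) (d : R) : compact K ->
  continuous (fun p : U * T => H p.1 p.2) -> 0 < d ->
  \forall v \near u, K `<=` (fun x => `|H u x - H v x| <= d).
Proof.
move=> cK cH d0.
apply: ((@compact_near_coveringP T K).1 cK U (nbhs u)
(fun v x => `|H u x - H v x| <= d)) => x Kx.
have d20 : 0 < d / 2 by rewrite divr_gt0.
have /cvgrPdist_le/(_ _ d20)[[A B] [/= nA nB AB]] := cH (u, x).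
exists (B, A) => //= -[x' v] /= [Bx' Av].
have h1 := AB (v, x') (conj Av Bx').
have h2 := AB (u, x') (conj (nbhs_singleton nA) Bx').
rewrite /= in h1 h2.
have -> : H u x' - H v x' = (H u x - H v x') - (H u x - H u x') by ring.
by rewrite (le_trans (ler_normB _ _))// (splitr d) lerD.
Qed.

(** * Positive linear functionals on continuous functions *)

Section positive_functional.
Context {R : realType} {T : topologicalType}.
Implicit Types (f g : T -> R).

(** An abstract stand-in for integration against a positive measure carried by [K]: linearity and
    positivity are demanded on continuous functions only, and positivity is tested on [K] alone, so
    that bounds on [K] control [E]. *)
Definition pos_functional (K : set T) (E : (T -> R) -> R) : Prop :=
  (forall (a : R) f g, continuous f -> continuous g ->
     E (fun x => a * f x + g x) = a * E f + E g) /\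
  (forall f, continuous f -> (forall x, K x -> 0 <= f x) -> 0 <= E f).

Variables (K : set T) (E : (T -> R) -> R).
Hypothesis E_pos : pos_functional K E.

Let ccst (c : R) : continuous (fun _ : T => c).
Proof. exact: cst_continuous. Qed.

Lemma pos_functional0 : E (fun=> 0) = 0.
Proof.
have := E_pos.1 (- 1) _ _ (ccst 0) (ccst 0).
have -> : (fun x : T => -1 * 0 + 0 : R) = (fun=> 0).
  by apply/funext => x; rewrite mulr0 addr0.
by move=> ->; rewrite mulN1r addNr.
Qed.

Lemma pos_functionalZ (a : R) f : continuous f ->
  E (fun x => a * f x) = a * E f.
Proof.
move=> cf; have := E_pos.1 a _ _ cf (ccst 0); rewrite pos_functional0 addr0 => <-.
by congr E; apply/funext => x; rewrite addr0.
Qed.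

Lemma pos_functionalD f g : continuous f -> continuous g ->
  E (fun x => f x + g x) = E f + E g.
Proof.
move=> cf cg; have := E_pos.1 1 _ _ cf cg; rewrite mul1r => <-.
by congr E; apply/funext => x; rewrite mul1r.
Qed.

Lemma pos_functionalB f g : continuous f -> continuous g ->
  E (fun x => f x - g x) = E f - E g.
Proof.
move=> cf cg; have := E_pos.1 (- 1) _ _ cg cf; rewrite mulN1r addrC => <-.
by congr E; apply/funext => x; rewrite mulN1r addrC.
Qed.

Lemma pos_functional_cst (c : R) : E (fun=> c) = c * E (fun=> 1).
Proof.
by rewrite -pos_functionalZ//; congr E; apply/funext => x; rewrite mulr1.
Qed.

Lemma pos_functional_sum (I : Type) (r : seq I) (F : I -> T -> R) :
  (forall i, continuous (F i)) ->
  E (fun x => \sum_(i <- r) F i x) = \sum_(i <- r) E (F i).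
Proof.
move=> cF; elim: r => [|i r IH].
  under eq_fun do rewrite big_nil.
  by rewrite big_nil pos_functional0.
under eq_fun do rewrite big_cons.
rewrite big_cons pos_functionalD ?IH//.
exact: continuous_bigsum.
Qed.

Lemma le_pos_functional f g : continuous f -> continuous g ->
  (forall x, K x -> f x <= g x) -> E f <= E g.
Proof.
move=> cf cg fg; rewrite -subr_ge0 -pos_functionalB//; apply: E_pos.2.
  by move=> x; apply: continuousB; [exact: cg|exact: cf].
by move=> x Kx; rewrite subr_ge0 fg.
Qed.

Lemma pos_functional1_ge0 : 0 <= E (fun=> 1).
Proof. by apply: E_pos.2 => //; exact: ccst. Qed.

Lemma pos_functional_norm_le f g : continuous f -> continuous g ->
  (forall x, K x -> `|f x| <= g x) -> `|E f| <= E g.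
Proof.
move=> cf cg fM; rewrite ler_norml; apply/andP; split; last first.
  apply: le_pos_functional => // x Kx.
  exact: le_trans (ler_norm _) (fM _ Kx).
rewrite -mulN1r -pos_functionalZ //.
apply: le_pos_functional => // [|x Kx].
  by move=> x; apply: cvgM; [exact: cvg_cst|exact: cg].
by rewrite mulN1r lerNl (le_trans _ (fM _ Kx))// ler_normr lexx orbT.
Qed.

Lemma pos_functional_norm_le_cst f (M : R) : continuous f ->
  (forall x, K x -> `|f x| <= M) -> `|E f| <= M * E (fun=> 1).
Proof.
by move=> cf fM; rewrite -pos_functional_cst; exact: pos_functional_norm_le.
Qed.

Lemma pos_functional_continuous (U : topologicalType) (H : U -> T -> R) :
  compact K -> continuous (fun p : U * T => H p.1 p.2) ->
  continuous (fun u => E (H u)).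
Proof.
move=> cK cH u; apply/cvgrPdist_le => e e0.
have c1 v : continuous (H v) := continuous_slice v cH.
(* The added 1 keeps the quotient meaningful when the total mass [E 1] is 0. *)
pose d : R := e / (E (fun=> 1) + 1).
have E1 : 0 < E (fun=> 1) + 1.
  by rewrite ltr_wpDl// pos_functional1_ge0.
have d0 : 0 < d by rewrite divr_gt0.
have nK : \forall v \near u, K `<=` (fun x => `|H u x - H v x| <= d).
  exact: near_uniform_compact.
near=> v.
rewrite -pos_functionalB//.
apply: (@le_trans _ _ (d * E (fun=> 1))).
  apply: pos_functional_norm_le_cst.
    by move=> x; apply: continuousB; exact: c1.
  by move=> x Kx; exact: (near nK v).
by rewrite /d -mulrA ler_piMr ?(ltW e0)// mulrC ler_pdivrMr// mul1r lerDl.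
Unshelve. all: by end_near. Qed.

(** By the mean value theorem the difference quotient at each [x] is a value [H' c x] with [c] close
    to [t], and [H' c] is uniformly close to [H' t] on [K]. *)
Lemma pos_functional_derive (H H' : R -> T -> R) (t : R) :
  compact K -> (forall t, continuous (H t)) ->
  continuous (fun p : R * T => H' p.1 p.2) ->
  (forall (t : R) x, is_derive t 1 (H ^~ x) (H' t x)) ->
  is_derive t 1 (fun t => E (H t)) (E (H' t)).
Proof.
move=> cK cH cH' dH.
have c1 v : continuous (H' v) := continuous_slice v cH'.
suff cv : (fun h => h^-1 *: (E (H (h *: 1 + t)) - E (H t))) @ 0^' --> E (H' t).
  apply: DeriveDef; first by apply/cvg_ex; exists (E (H' t)); exact: cv.
  exact: cvg_lim cv.
apply/cvgrPdist_le => e e0.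
pose d : R := e / (E (fun=> 1) + 1).
have E1 : 0 < E (fun=> 1) + 1.
  by rewrite ltr_wpDl// pos_functional1_ge0.
have d0 : 0 < d by rewrite divr_gt0.
have nK : \forall v \near t, K `<=` (fun x => `|H' t x - H' v x| <= d).
  exact: near_uniform_compact.
have [r /= r0 nr] := (nbhs_ballP _ _).1 nK.
near=> h.
have hr : `|h| < r by near: h; exact: dnbhs0_lt.
have h0 : h != 0 by near: h; exact: nbhs_dnbhs_neq.
have cHh : continuous (fun x => h^-1 * (H (h *: 1 + t) x - H t x)).
  move=> x; apply: cvgM; first exact: cvg_cst.
  by apply: cvgB; exact: cH.
have -> : h^-1 *: (E (H (h *: 1 + t)) - E (H t)) =
    E (fun x => h^-1 * (H (h *: 1 + t) x - H t x)).
  rewrite pos_functionalZ ?pos_functionalB//.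
  by move=> x; apply: cvgB; exact: cH.
rewrite -pos_functionalB//.
apply: (@le_trans _ _ (d * E (fun=> 1))).
  apply: pos_functional_norm_le_cst.
    by move=> x; apply: cvgB; [exact: c1|exact: cHh].
  move=> x Kx.
  (* The point [c] varies with [x]; only its distance to [t] matters, since the closeness in [nr]
     holds on all of [K] at once. *)
  have [c [ct ce]] : exists c, `|t - c| < r /\ h^-1 * (H (h *: 1 + t) x - H t x) = H' c x.
    rewrite /GRing.scale /= mulr1.
    have [hp|] := ltP 0 h.
      have [|c /andP[c1' c2] ce] := mvt_all (H ^~ x) (H' ^~ x) t (h + t) (fun s => dH s x).
        by rewrite lerDr ltW.
      exists c; split; last by rewrite ce addrK mulrC -mulrA divff// mulr1.
      rewrite distrC ger0_norm ?subr_ge0//.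
      by rewrite (le_lt_trans _ hr)// (gtr0_norm hp) lerBlDr.
    rewrite le_eqVlt (negbTE h0)/= => hn.
    have [|c /andP[c1' c2] ce] := mvt_all (H ^~ x) (H' ^~ x) (h + t) t (fun s => dH s x).
      by rewrite gerDr ltW.
    exists c; split.
      rewrite ger0_norm ?subr_ge0//.
      by rewrite (le_lt_trans _ hr)// (ltr0_norm hn); lra.
    apply: (mulfI h0); rewrite mulrA divff// mul1r -[LHS]opprB ce; ring.
  by rewrite ce; apply: (nr c).
by rewrite /d -mulrA ler_piMr ?(ltW e0)// mulrC ler_pdivrMr// mul1r lerDl.
Unshelve. all: by end_near. Qed.

End positive_functional.

Lemma pos_functional_segment {R : realType} (a b : R) (w : R -> R) :
  continuous w -> (forall x, a <= x <= b -> 0 <= w x) ->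
  pos_functional `[a, b]
    (fun f => \int[lebesgue_measure]_(x in `[a, b]) (f x * w x)).
Proof.
move=> cw w0; split=> [k f g cf cg|f cf f0].
  have cfw : continuous (fun x => f x * w x).
    by move=> x; apply: cvgM; [exact: cf|exact: cw].
  rewrite -RintegralZl//; last exact: integrable_segment.
  rewrite -RintegralD//; last 2 first.
  - apply: integrable_segment => x; apply: cvgM; first exact: cvg_cst.
    exact: cfw.
  - apply: integrable_segment => x; apply: cvgM; first exact: cg.
    exact: cw.
  by apply: eq_Rintegral => x _; rewrite mulrDl mulrA.
apply: Rintegral_ge0 => x abx; rewrite mulr_ge0 ?f0//.
by apply: w0; move: abx; rewrite /= in_itv.
Qed.

(** * The one-dimensional function [f = - abs * u] and its derivatives *)

Section compactly_supported.
Context {R : realType}.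
Notation mu := (@lebesgue_measure R).
Variables (u : R -> R) (r : R).
Hypotheses (r_gt0 : 0 < r) (u_cont : continuous u)
  (u_supp : forall x, r <= `|x| -> u x = 0).

Lemma supp_restrict (g : R -> R) (D : set R) : `[- r, r]%classic `<=` D ->
  (fun y => g y * u y) \_ D = (fun y => g y * u y) \_ `[- r, r]%classic.
Proof.
move=> rD; apply/funext => y; rewrite !patchE.
case: ifPn => [/set_mem yD|yD]; case: ifPn => // yr.
  rewrite u_supp ?mulr0// leNgt; apply: contra yr => yr.
  by apply/mem_set; rewrite /= in_itv/= -ler_norml ltW.
by move/negP: yD => []; apply/mem_set/rD/set_mem.
Qed.

Lemma Rintegral_supp (g : R -> R) (D : set R) : `[- r, r]%classic `<=` D ->
  \int[mu]_(y in D) (g y * u y) = \int[mu]_(y in `[- r, r]) (g y * u y).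
Proof.
by move=> rD; rewrite [LHS]Rintegral_mkcond [RHS]Rintegral_mkcond supp_restrict.
Qed.

Lemma integrable_supp (g : R -> R) (D : set R) : continuous g -> measurable D ->
  mu.-integrable D (EFin \o (fun y => g y * u y)).
Proof.
move=> cg mD; apply: (@integrableS _ _ _ _ setT) => //.
have h : mu.-integrable `[- r, r] (EFin \o (fun y => g y * u y)).
  by apply: integrable_segment; exact: continuous_mul.
rewrite -(setTI `[- r, r]%classic) in h.
have /integrable_restrict := h => /(_ (measurable_itv _) measurableT).
rewrite restrict_EFin -(supp_restrict g setT)// patch_setT => H.
exact: H.
Qed.

(** For [g = 1] this is the mass of [u] to the left of [x], for [g y = y] its partial first moment;
    these two functions determine [f]. *)
Definition antideriv (g : R -> R) (x : R) : R :=
  \int[mu]_(y in `]-oo, x]) (g y * u y).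

Lemma antideriv_derive (g : R -> R) : continuous g ->
  forall x : R, is_derive x 1 (antideriv g) (g x * u x).
Proof.
move=> cg x.
have xx1 : x < x + 1 by rewrite ltrDl.
have ig := integrable_supp g `]-oo, (x + 1)]%classic cg (measurable_itv _).
have [|d e] := continuous_FTC1 xx1 ig _ (continuous_mul _ _ cg u_cont x).
  by rewrite ltNyr.
exact: (DeriveDef d (eq_trans (esym (derive1E _ _)) e)).
Qed.

Lemma antideriv_le (g : R -> R) x : x <= - r -> antideriv g x = 0.
Proof.
move=> xr; rewrite /antideriv.
transitivity (\int[mu]_(y in `]-oo, x]) (0 : R)).
  apply: eq_Rintegral => y /set_mem /=; rewrite in_itv/= => yx.
  have yr := le_trans yx xr; rewrite u_supp ?mulr0//.
  have y0 : y <= 0 by rewrite (le_trans yr)// oppr_le0 ltW.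
  by rewrite (ler0_norm y0) lerNr.
by rewrite Rintegral_cst// mul0r.
Qed.

Lemma antideriv_ge (g : R -> R) x : r <= x ->
  antideriv g x = \int[mu]_(y in `[- r, r]) (g y * u y).
Proof.
move=> rx; apply: Rintegral_supp => y /=; rewrite !in_itv/= => /andP[_ yr].
exact: le_trans rx.
Qed.

Hypotheses (u_ge0 : forall x, 0 <= u x) (u_even : forall x, u (- x) = u x)
  (u_int1 : (\int[mu]_x (u x)%:E = 1)%E).

Let mass x := antideriv (fun=> 1) x.
Let moment x := antideriv (fun y => y) x.

Let c1 : continuous (fun _ : R => 1 : R). Proof. exact: cst_continuous. Qed.

Let mass_derive (x : R) : is_derive x 1 mass (u x).
Proof. by have := antideriv_derive _ c1 x; rewrite mul1r. Qed.

Let moment_derive (x : R) : is_derive x 1 moment (x * u x).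
Proof. exact: antideriv_derive _ continuous_idE x. Qed.

Lemma Rintegral_supp1 : \int[mu]_(y in `[- r, r]) u y = 1.
Proof.
have := @Rintegral_supp (fun=> 1) setT (fun _ _ => I).
have e1 (D : set R) : \int[mu]_(y in D) (1 * u y) = \int[mu]_(y in D) u y.
  by apply: eq_Rintegral => y _; rewrite mul1r.
by rewrite !e1 => <-; rewrite /Rintegral u_int1.
Qed.

Let mass_ge x : r <= x -> mass x = 1.
Proof.
move=> rx; rewrite /mass antideriv_ge// -[RHS]Rintegral_supp1.
by apply: eq_Rintegral => y _; rewrite mul1r.
Qed.

Let mass_le x : x <= - r -> mass x = 0. Proof. exact: antideriv_le. Qed.

Let reflect_derive (f df : R -> R) (x : R) : (forall x : R, is_derive x 1 f (df x)) ->
  is_derive x 1 (fun t => f (- t)) (- df (- x)).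
Proof.
move=> fd; have /= := @is_derive_shift_scale R f 0 (-1) x (df (- x)).
rewrite mulN1r add0r => /(_ (fd _)).
by rewrite mulN1r; under eq_fun do rewrite add0r mulN1r.
Qed.

(** Evenness of [u] makes the derivative of the sum vanish, so its value can be read off at [r],
    where the two masses are 1 and 0. *)
Let mass_reflect x : mass x + mass (- x) = 1.
Proof.
have d (y : R) : is_derive y 1 (fun t => mass t + mass (- t)) 0.
  have := is_derive_add (mass_derive y) (reflect_derive mass u y mass_derive).
  by rewrite u_even subrr.
have := is_derive_0_is_cst x r d.
by rewrite /= (mass_ge r)// (mass_le (- r))// addr0.
Qed.

Let moment_reflect x : moment (- x) = moment x.
Proof.
have d (y : R) : is_derive y 1 (fun t => moment t - moment (- t)) 0.
  have := is_derive_add (moment_derive y)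
    (is_derive_opp (reflect_derive moment (fun t => t * u t) y moment_derive)).
  by rewrite u_even; congr is_derive; ring.
have := is_derive_0_is_cst x 0 d.
by rewrite /= oppr0 subrr => /eqP; rewrite subr_eq0 => /eqP.
Qed.

Let moment_ge x : r <= x -> moment x = 0.
Proof.
by move=> rx; rewrite -moment_reflect /moment antideriv_le// lerNl opprK.
Qed.

(** Write [|x - y| = (y - x) + 2 (x - y)^+]. The first part only involves the total mass 1 and the
    total moment 0; the second is an integral over []-oo, x]], so each remaining term can be
    differentiated. *)
Lemma neg_abs_convE x :
  neg_abs_conv u x = x - 2 * (x * mass x) + 2 * moment x.
Proof.
have cg : continuous (fun y => y - x).
  by apply: continuous_sub; [exact: continuous_idE|exact: cst_continuous].
have cg' : continuous (fun y => x - y).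
  by apply: continuous_sub; [exact: cst_continuous|exact: continuous_idE].
have int1 := integrable_supp _ setT cg measurableT.
have int2 := integrable_supp _ `]-oo, x]%classic cg' (measurable_itv _).
have int2' : mu.-integrable setT (EFin \o ((fun y => (x - y) * u y) \_ `]-oo, x])).
  rewrite -restrict_EFin; apply/integrable_restrict => //.
  by rewrite setTI.
have e : \int[mu]_y (`|x - y| * u y) =
   \int[mu]_y ((y - x) * u y) + 2 * \int[mu]_(y in `]-oo, x]) ((x - y) * u y).
  rewrite [X in _ + 2 * X]Rintegral_mkcond -RintegralZl// -RintegralD//; last first.
    by rewrite (_ : _ \o _ = fun y => (2%:E * (((fun y => (x - y) * u y) \_ `]-oo, x]) y)%:E)%E)//; exact: integrableZl.
  apply: eq_Rintegral => y _; rewrite patchE.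
  case: ifPn => [/set_mem|/negP yx].
    by rewrite /= in_itv/= => yx; rewrite ger0_norm ?subr_ge0//; ring.
  have {}yx : x < y.
    by rewrite ltNge; apply/negP => yx'; apply: yx; apply/mem_set; rewrite /= in_itv.
  by rewrite ltr0_norm ?subr_lt0// mulr0 addr0 opprB.
rewrite /neg_abs_conv e.
have e1 (D : set R) : measurable D -> \int[mu]_(y in D) ((x - y) * u y) =
    x * \int[mu]_(y in D) (1 * u y) - \int[mu]_(y in D) (y * u y).
  move=> mD; rewrite -RintegralZl//; last exact: integrable_supp.
  rewrite -RintegralB//; last 2 first.
  - have := integrable_supp (fun=> x) D (@cst_continuous _ _ x) mD.
    by congr (integrable _ _ _); apply/funext => y /=; rewrite mul1r.
  - exact: integrable_supp _ _ continuous_idE mD.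
  by apply: eq_Rintegral => y _; ring.
have -> : \int[mu]_y ((y - x) * u y) = - \int[mu]_y ((x - y) * u y).
  rewrite -[RHS]mulN1r -RintegralZl//; last exact: integrable_supp _ setT cg' measurableT.
  by apply: eq_Rintegral => y _; ring.
rewrite !e1// (@Rintegral_supp (fun=> 1) setT (fun _ _ => I)).
rewrite (@Rintegral_supp (fun y => y) setT (fun _ _ => I)).
rewrite -(antideriv_ge (fun=> 1) r)// -(antideriv_ge (fun y => y) r)//.
rewrite -/(moment r) -/(mass r) moment_ge// mass_ge//.
rewrite /mass /moment /antideriv; ring.
Qed.

Let f := neg_abs_conv u.
Definition neg_abs_conv_deriv (x : R) := 1 - 2 * antideriv (fun=> 1) x.
Let df := neg_abs_conv_deriv.

Lemma neg_abs_conv_derive (x : R) : is_derive x 1 f (df x).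
Proof.
have -> : f = fun x => x - 2 * (x * mass x) + 2 * moment x.
  by apply/funext => y; exact: neg_abs_convE.
have := is_derive_add (is_derive_add (is_derive_idE x) (is_derive_opp
  (is_derive_scale 2 (is_derive_mul (is_derive_idE x) (mass_derive x)))))
  (is_derive_scale 2 (moment_derive x)).
by congr is_derive; rewrite /df /neg_abs_conv_deriv /mass; ring.
Qed.

Lemma neg_abs_conv_derive2 (x : R) : is_derive x 1 df (- 2 * u x).
Proof.
have := is_derive_add (is_derive_cstE 1 x) (is_derive_opp (is_derive_scale 2 (mass_derive x))).
by congr is_derive; ring.
Qed.

Lemma neg_abs_conv_even x : f (- x) = f x.
Proof.
rewrite /f !neg_abs_convE moment_reflect.
have := mass_reflect x => /(canRL (addKr _)) ->; ring.
Qed.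

Lemma neg_abs_conv_ge x : r <= x -> f x = - x.
Proof. by move=> rx; rewrite /f neg_abs_convE mass_ge// moment_ge//; ring. Qed.

Lemma neg_abs_conv_deriv_norm x : `|df x| <= 1.
Proof.
have mono a b : a <= b -> mass a <= mass b.
  by apply: nondecreasing_ge0_derive mass_derive _ _ _ => *; exact: u_ge0.
have m0 : 0 <= mass x.
  have [xr|xr] := leP x (- r); first by rewrite mass_le.
  by rewrite -(mass_le (- r))// mono// ltW.
have m1 : mass x <= 1.
  have [xr|xr] := leP r x; first by rewrite mass_ge.
  by rewrite -(mass_ge r)// mono// ltW.
rewrite /df /neg_abs_conv_deriv -/(mass x) ler_norml; lra.
Qed.

Lemma neg_abs_conv_deriv0 : df 0 = 0.
Proof.
have := mass_reflect 0; rewrite oppr0 /df /neg_abs_conv_deriv -/(mass 0) => h; lra.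
Qed.

Lemma neg_abs_conv_le0 x : f x <= f 0.
Proof.
have df2 (y : R) : is_derive y 1 (fun t => - f t) (- df y).
  exact: is_derive_opp (neg_abs_conv_derive y).
have df3 (y : R) : is_derive y 1 (fun t => - df t) (2 * u y).
  by have := is_derive_opp (neg_abs_conv_derive2 y); rewrite mulNr opprK.
have := second_order_ge _ _ _ 0 x df2 df3 (fun y => mulr_ge0 (ler0n _ 2) (u_ge0 y)).
by rewrite neg_abs_conv_deriv0; lra.
Qed.

(** Since [f' >= -1], the function [f + id] increases to the value 0 it takes beyond [r], hence
    [f x <= - x] for [x > 0]. For small [x] continuity of [f'] at 0, where it vanishes, gives
    [f' >= -1/2] on [[0, x]], so that [f 0 <= - x / 2]. *)
Lemma neg_abs_conv_lt0 : f 0 < 0.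
Proof.
have cdf := is_derive_continuous _ _ neg_abs_conv_derive2.
have /cvgrPdist_le/(_ (1/2)) := cdf 0.
rewrite neg_abs_conv_deriv0 => /(_ ltac:(lra))/nbhs_ballP[e /= e0 he].
pose x := e / 2; have x0 : 0 < x by rewrite divr_gt0.
have [c /andP[c0 cx] ec] := mvt_all _ _ 0 x neg_abs_conv_derive (ltW x0).
have hc : `|df c| <= 1/2.
  rewrite -normrN -sub0r; apply: he; rewrite /ball /= sub0r normrN ger0_norm//.
  by rewrite (le_lt_trans cx)// /x; lra.
have fd (y : R) : is_derive y 1 (fun t => f t + t) (df y + 1).
  exact: is_derive_add (neg_abs_conv_derive y) (is_derive_idE y).
have := nondecreasing_ge0_derive _ _ fd x (x + r) _ _.
rewrite (neg_abs_conv_ge (x + r)) ?addNr ?lerDl ?lerDr; last exact: ltW.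
have d1 c' : x <= c' <= x + r -> 0 <= df c' + 1.
  by move=> _; have := neg_abs_conv_deriv_norm c'; rewrite ler_norml => /andP[]; lra.
move=> /(_ d1 (ltW r_gt0)) h.
have : - (1/2) * x <= df c * x by apply: ler_wpM2r (ltW x0) _ _ _; move: hc; rewrite ler_norml => /andP[].
move: ec; rewrite subr0 => <-; lra.
Qed.

Lemma supp_bounded : exists B, 0 < B /\ forall x, u x <= B.
Proof.
have rr : - r <= r by rewrite (@le_trans _ _ 0)// ?oppr_le0 ltW.
have [c _ hc] := @EVT_max R u (- r) r rr (continuous_subspaceT u_cont).
exists (u c + 1); split; first by have := u_ge0 c; lra.
move=> x; have [xr|xr] := leP r `|x|.
  by rewrite u_supp// ; have := u_ge0 c; lra.
have := hc x; rewrite in_itv/= -ler_norml (ltW xr) => /(_ isT) h.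
by rewrite (le_trans h)// lerDl.
Qed.

Lemma le_supnorm x : u x <= supnorm u.
Proof.
have [B [B0 hB]] := supp_bounded.
rewrite -(ger0_norm (u_ge0 x)); apply: ub_le_sup; last by exists x.
by exists B => _ [y _ <-]; rewrite ger0_norm.
Qed.

End compactly_supported.

(** * Wallis integrals of [sin^a cos^b] over a half circle *)

Section wallis.
Context {R : realType}.
Notation mu := (@lebesgue_measure R).

Local Notation half_circle := (`[- (pi / 2), pi / 2]%classic : set R).

Definition wallis (a b : nat) : R :=
  \int[mu]_(t in half_circle) (sin t ^+ a * cos t ^+ b).

Lemma half_pi_le : - (pi / 2) <= pi / 2 :> R.
Proof. have := @pi_ge0 R; lra. Qed.

Lemma continuous_sinX n : continuous (fun t : R => sin t ^+ n).
Proof. exact/continuous_pow/continuous_sin. Qed.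

Lemma continuous_cosX n : continuous (fun t : R => cos t ^+ n).
Proof. exact/continuous_pow/continuous_cos. Qed.

Lemma continuous_sincosX a b : continuous (fun t : R => sin t ^+ a * cos t ^+ b).
Proof. by move=> t; apply: cvgM; [exact: continuous_sinX|exact: continuous_cosX]. Qed.

(** Up to a constant, [cos t ^+ m] is the area of the parallel at latitude [t] on the unit sphere of
    [R^(m+2)]. *)
Definition cos_int (m : nat) (h : R -> R) : R :=
  \int[mu]_(t in half_circle) (h t * cos t ^+ m).

Lemma cos_int_pos m : pos_functional half_circle (cos_int m).
Proof.
apply: pos_functional_segment; first exact: continuous_cosX.
by move=> x xI; rewrite exprn_ge0// cos_ge0_pihalf.
Qed.

Lemma wallis_cos_int a b m : wallis a (b + m) =
  cos_int m (fun t => sin t ^+ a * cos t ^+ b).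
Proof.
by apply: eq_Rintegral => t _; rewrite exprD mulrA.
Qed.

Lemma wallis_add a b : wallis a b = wallis a.+2 b + wallis a b.+2.
Proof.
rewrite /wallis -RintegralD//; last 2 first.
- by apply: integrable_segment; exact: continuous_sincosX.
- by apply: integrable_segment; exact: continuous_sincosX.
apply: eq_Rintegral => t _.
rewrite -[LHS]mulr1 -(cos2Dsin2 t) !exprSr; ring.
Qed.

(** Integrate the derivative of [sin^(a+1) cos^(b+1)], which vanishes at both ends. Together with
    [wallis_add] this is a linear system whose solutions are [wallis_sin2] and [wallis_cos2]. *)
Lemma wallis_parts a b : a.+1%:R * wallis a b.+2 = b.+1%:R * wallis a.+2 b.
Proof.
apply/eqP; rewrite -subr_eq0; apply/eqP.
pose g (t : R) : R := a.+1%:R * (sin t ^+ a * cos t ^+ b.+2)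
  - b.+1%:R * (sin t ^+ a.+2 * cos t ^+ b).
have c1 (k : R) p q : continuous (fun t : R => k * (sin t ^+ p * cos t ^+ q)).
  by move=> t; apply: cvgM; [exact: cvg_cst|exact: continuous_sincosX].
have cg : continuous g by move=> t; apply: cvgB; exact: c1.
have d (t : R) : is_derive t 1 (fun t : R => sin t ^+ a.+1 * cos t ^+ b.+1) (g t).
  have := is_derive_mul (is_derive_pow a (is_derive_sin t)) (is_derive_pow b (is_derive_cos t)).
  by congr (is_derive _ _ _ _); rewrite /g !exprS; ring.
have := ftc g _ _ _ half_pi_le cg d.
rewrite sinN cosN cos_pihalf expr0n !mulr0 subrr => <-.
rewrite /g RintegralB//; last 2 first.
- by apply: integrable_segment; exact: c1.
- by apply: integrable_segment; exact: c1.
by rewrite !RintegralZl//; apply: integrable_segment; exact: continuous_sincosX.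
Qed.

(** The sine exponent descends by two through [wallis_parts]; at exponent 1 an explicit primitive is
    a power of the cosine, equal at both ends. *)
Lemma wallis_odd a b : odd a -> wallis a b = 0.
Proof.
have base c : wallis 1 c = 0.
  have d (t : R) : is_derive t 1 (fun t : R => - c.+1%:R^-1 * cos t ^+ c.+1)
      (sin t ^+ 1 * cos t ^+ c).
    have := is_derive_scale (- c.+1%:R^-1) (is_derive_pow c (is_derive_cos t)).
    congr (is_derive _ _ _ _); rewrite expr1.
    by field; rewrite nat1r pnatr_eq0.
  have := ftc _ _ _ _ half_pi_le (continuous_sincosX 1 c) d.
  by rewrite cosN subrr.
elim: a {-2}a (leqnn a) b => [[]//|n IH [//|[|a]] an b oa]; first exact: base.
have := wallis_parts a b; rewrite IH//; last by move: oa; rewrite /= negbK.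
  by rewrite mulr0 => /esym/eqP; rewrite mulf_eq0 pnatr_eq0 => /eqP.
by rewrite -ltnS; exact: leq_trans an.
Qed.

Lemma wallis_sin2 a b :
  wallis a.+2 b = a.+1%:R / (a + b).+2%:R * wallis a b.
Proof.
have h0 : (a + b).+2%:R != 0 :> R by rewrite pnatr_eq0.
apply: (mulfI h0); rewrite mulrA mulrCA divff// mulr1.
have e : (a + b).+2%:R = a.+1%:R + b.+1%:R :> R by rewrite -natrD addSn addnS.
rewrite e [wallis a b]wallis_add mulrDl mulrDr wallis_parts; ring.
Qed.

Lemma wallis_cos2 a b :
  wallis a b.+2 = b.+1%:R / (a + b).+2%:R * wallis a b.
Proof.
have h0 : (a + b).+2%:R != 0 :> R by rewrite pnatr_eq0.
apply: (mulfI h0); rewrite mulrA mulrCA divff// mulr1.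
have e : (a + b).+2%:R = a.+1%:R + b.+1%:R :> R by rewrite -natrD addSn addnS.
rewrite e [wallis a b]wallis_add mulrDl mulrDr wallis_parts; ring.
Qed.

(** The product [d (d + 2) ... (d + 2k - 2)]. The ratio [oddprod 1 k / oddprod d k] is the mean of
    the [2k]-th power of a coordinate on the unit sphere of [R^d]. *)
Definition oddprod (d k : nat) : R := \prod_(j < k) (2 * j + d)%:R.

Lemma oddprodS d k : oddprod d k.+1 = oddprod d k * (2 * k + d)%:R.
Proof. by rewrite /oddprod big_ord_recr. Qed.

Lemma oddprod_neq0 d k : oddprod d.+1 k != 0.
Proof. by apply/prodf_neq0 => j _; rewrite pnatr_eq0 addnS. Qed.

Lemma wallis_oddprod m j l : wallis (2 * j) (2 * l + m) =
  oddprod 1 j * oddprod m.+1 l / oddprod m.+2 (j + l) * wallis 0 m.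
Proof.
elim: j => [|j IH].
  rewrite muln0; elim: l => [|l IH]; first by rewrite /oddprod !big_ord0 divr1 !mul1r.
  have -> : (2 * l.+1 + m = (2 * l + m).+2)%N by rewrite mulnS.
  rewrite wallis_cos2 IH !add0n !oddprodS -!addnS.
  by rewrite invfM; ring.
have -> : (2 * j.+1 = (2 * j).+2)%N by rewrite mulnS.
rewrite wallis_sin2 IH !addSn !oddprodS -!addnS.
have -> : (2 * j + (2 * l + m.+2) = 2 * (j + l) + m.+2)%N.
  by rewrite mulnDr addnA.
by rewrite invfM; ring.
Qed.

Lemma oddprod_fact k : (2 ^ k * k`!)%:R * oddprod 1 k = (2 * k)`!%:R :> R.
Proof.
elim: k => [|k IH]; first by rewrite /oddprod big_ord0 mulr1.
have -> : (2 * k.+1 = (2 * k).+2)%N by rewrite mulnS.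
rewrite oddprodS !factS expnS addn1 !natrM -IH !natrM.
have -> : (2 * k).+2%:R = 2 * k.+1%:R :> R by rewrite -natrM mulnS.
ring.
Qed.

(** Both sides are turned into factorials by [oddprod_fact]. The identity makes the binomial
    expansion of a [2k]-th moment collapse into that of [sqnorm x ^+ k]. *)
Lemma bin_oddprod j l : 'C(2 * (j + l), 2 * j)%:R * (oddprod 1 j * oddprod 1 l) =
  'C(j + l, j)%:R * oddprod 1 (j + l) :> R.
Proof.
have f0 n : n`!%:R != 0 :> R by rewrite pnatr_eq0 -lt0n fact_gt0.
have p0 n : (2 ^ n)%:R != 0 :> R by rewrite pnatr_eq0 expn_eq0.
have := @bin_fact (2 * (j + l)) (2 * j).
rewrite leq_mul2l leq_addr orbT => /(_ isT); rewrite -mulnBr addKn => /(congr1 (fun n => n%:R : R)).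
have := @bin_fact (j + l) j; rewrite leq_addr => /(_ isT); rewrite addKn => /(congr1 (fun n => n%:R : R)).
rewrite !natrM -!oddprod_fact !natrM expnD natrM => <- e.
have h : (2 ^ j)%:R * j`!%:R * ((2 ^ l)%:R * l`!%:R) != 0 :> R.
  by rewrite !mulf_neq0.
apply: (mulfI h); rewrite [LHS](_ : _ = 'C(2 * (j + l), 2 * j)%:R *
  ((2 ^ j)%:R * j`!%:R * oddprod 1 j * ((2 ^ l)%:R * l`!%:R * oddprod 1 l))); last by ring.
rewrite e; ring.
Qed.

End wallis.

(** * The iterated latitude integral and its moments *)

Section sphere_functional.
Context {R : realType}.
Notation mu := (@lebesgue_measure R).
Local Notation half_circle := (`[- (pi / 2), pi / 2]%classic : set R).

Definition dotv {d} (x y : 'rV[R]_d) : R := \sum_i x 0 i * y 0 i.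

(** A compact cube containing the unit sphere and stable under [sphere_lift]: positivity on it gives
    the bounds that the functional needs. *)
Definition unit_box d : set 'rV[R]_d := [set v | forall i, `[-1, 1]%classic (v 0 i)].

Lemma unit_box_compact d : compact (@unit_box d).
Proof. exact: (@rV_compact R d (fun=> `[-1, 1]%classic) (fun=> @segment_compact R _ _)). Qed.

Lemma continuous_rV {T : topologicalType} {d} (f : T -> 'rV[R]_d) :
  (forall i, continuous (fun x => f x 0 i)) -> continuous f.
Proof.
move=> cf x; apply/cvg_ballP => e e0.
have h i : \forall y \near x, ball (f x 0 i) e (f y 0 i).
  by have /cvg_ballP/(_ e e0) := cf i x.
near=> y; split=> // i j.
have hy : forall j, ball (f x 0 j) e (f y 0 j) by near: y; exact: filter_forall.
by rewrite (ord1 i); exact: hy.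
Unshelve. all: by end_near. Qed.

Lemma continuous_coord {d} (i : 'I_d) : continuous (fun x : 'rV[R]_d => x 0 i).
Proof. exact: coord_continuous. Qed.

Lemma continuous_dotv {d} (x : 'rV[R]_d) : continuous (fun xi => dotv xi x).
Proof.
apply: continuous_bigsum => i; apply: continuous_mul.
  exact: continuous_coord.
exact: cst_continuous.
Qed.

(* The point of the sphere with latitude [t] over the point [xi] of the equator. *)
Definition sphere_lift {d} (t : R) (xi : 'rV[R]_d) : 'rV[R]_d.+1 :=
  \row_i (if unlift ord0 i is Some j then cos t * xi 0 j else sin t).

Lemma sphere_lift_box d t (xi : 'rV[R]_d) :
  unit_box d xi -> unit_box d.+1 (sphere_lift t xi).
Proof.
move=> h i; rewrite mxE; case: unliftP => [j _|_] /=; rewrite in_itv/= -ler_norml.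
  rewrite normrM -[leRHS]mulr1; apply: ler_pM => //; first exact: cos_max.
  by have := h j; rewrite /= in_itv/= -ler_norml.
exact: sin_max.
Qed.

Lemma continuous_sphere_lift d :
  continuous (fun p : R * 'rV[R]_d => sphere_lift p.1 p.2).
Proof.
apply: continuous_rV => i.
under eq_fun do rewrite mxE.
have c1 : continuous (fun p : R * 'rV[R]_d => p.1) by move=> p; exact: cvg_fst.
have c2 : continuous (fun p : R * 'rV[R]_d => p.2) by move=> p; exact: cvg_snd.
case: unliftP => [j _|_].
  apply: continuous_mul.
    exact: continuous_compE _ _ (@continuous_cos R) c1.
  exact: continuous_compE _ _ (continuous_coord j) c2.
exact: continuous_compE _ _ (@continuous_sin R) c1.
Qed.

(* [sphere_int m] is a multiple of integration over the unit sphere of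
   [R^(m+1)], in latitude coordinates. *)
Fixpoint sphere_int (m : nat) : ('rV[R]_m.+1 -> R) -> R :=
  match m with
  | 0 => fun h => (h (const_mx 1) + h (const_mx (-1))) / 2
  | m'.+1 => fun h => cos_int m' (fun t => sphere_int m' (fun xi => h (sphere_lift t xi)))
  end.

(** The outer functional is only controlled on continuous functions, so the inner integral is first
    shown continuous in the latitude, by [pos_functional_continuous] over the cube. *)
Lemma sphere_int_pos m : pos_functional (unit_box m.+1) (sphere_int m).
Proof.
elim: m => [|m IH] /=.
  split=> [a f g _ _|f _ f0]; first by field.
  by rewrite divr_ge0// addr_ge0// f0// => i; rewrite mxE /= in_itv/=; lra.
have cI (f : 'rV[R]_m.+2 -> R) : continuous f ->
    continuous (fun t => sphere_int m (fun xi => f (sphere_lift t xi))).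
  move=> cf.
  apply: (pos_functional_continuous (unit_box m.+1) _ IH R
    (fun t xi => f (sphere_lift t xi))).
    exact: unit_box_compact.
  exact: continuous_compE _ _ cf (@continuous_sphere_lift _).
have cs (f : 'rV[R]_m.+2 -> R) t : continuous f -> continuous (fun xi => f (@sphere_lift m.+1 t xi)).
  move=> cf; exact: (@continuous_slice R 'rV[R]_m.+1 R (fun t xi => f (sphere_lift t xi)) t
    (continuous_compE _ _ cf (@continuous_sphere_lift _))).
split=> [a f g cf cg|f cf f0].
  rewrite -(cos_int_pos m).1; [|exact: cI..].
  congr (cos_int m _); apply/funext => t.
  by rewrite -IH.1; [|exact: cs..].
apply: (cos_int_pos m).2; first exact: cI.
move=> t _; apply: IH.2; first exact: cs.
by move=> xi hxi; apply: f0; exact: sphere_lift_box.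
Qed.

Definition tailv {d} (x : 'rV[R]_d.+1) : 'rV[R]_d := \row_j x 0 (lift ord0 j).

Lemma dotv_lift d t (xi : 'rV[R]_d) x :
  dotv (sphere_lift t xi) x = cos t * dotv xi (tailv x) + sin t * x 0 0.
Proof.
rewrite /dotv big_ord_recl mxE unlift_none addrC; congr (_ + _).
rewrite mulr_sumr; apply: eq_bigr => i _.
by rewrite !mxE liftK mulrA.
Qed.

Definition sqnorm {d} (x : 'rV[R]_d) : R := \sum_i x 0 i ^+ 2.

Lemma sqnorm_ge0 d (x : 'rV[R]_d) : 0 <= sqnorm x.
Proof. by apply: sumr_ge0 => i _; exact: sqr_ge0. Qed.

Lemma sqnorm_tail d (x : 'rV[R]_d.+1) : sqnorm x = x 0 0 ^+ 2 + sqnorm (tailv x).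
Proof.
rewrite /sqnorm big_ord_recl; congr (_ + _).
by apply: eq_bigr => i _; rewrite mxE.
Qed.

Lemma sum_even (n : nat) (F : nat -> R) : (forall i, odd i -> F i = 0) ->
  \sum_(i < (2 * n).+1) F i = \sum_(j < n.+1) F (2 * j)%N.
Proof.
move=> F0; elim: n => [|n IH]; first by rewrite !big_ord_recr !big_ord0.
rewrite mulnS !big_ord_recr /= in IH *; rewrite IH.
rewrite mulnS [F (2 * n).+1]F0 ?addr0//.
by rewrite /= oddM.
Qed.

(** Induction on the dimension. Expanding the power of [cos t <xi, x'> + sin t x_0] separates the
    latitude from the equator; odd exponents of the sine integrate to 0, and Wallis values recombine
    the even ones into a power of [x_0^2 + |x'|^2]. *)
Lemma sphere_int_moment m n (x : 'rV[R]_m.+1) :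
  sphere_int m (fun xi => dotv xi x ^+ n) =
  if odd n then 0 else
  sphere_int m (fun=> 1) * (oddprod 1 n./2 / oddprod m.+1 n./2) * sqnorm x ^+ n./2.
Proof.
elim: m n x => [|m IH] n x.
  have d1 (c : R) : dotv (const_mx c) x = c * x 0 0.
    by rewrite /dotv big_ord_recl big_ord0 addr0 mxE.
  rewrite /= !d1 mul1r mulN1r exprNn.
  case: ifPn => on; first by rewrite -signr_odd on expr1; field.
  rewrite -signr_odd (negbTE on) expr0.
  rewrite sqnorm_tail /sqnorm big_ord0 addr0 -exprM mul2n.
  by rewrite even_halfK//; field; exact: oddprod_neq0.
have cd k : continuous (fun xi : 'rV[R]_m.+1 => dotv xi (tailv x) ^+ k).
  by apply: continuous_pow; exact: continuous_dotv.
pose s1 := sphere_int m (fun=> 1).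
pose mom k := sphere_int m (fun xi => dotv xi (tailv x) ^+ k).
have e1 : sphere_int m.+1 (fun xi => dotv xi x ^+ n) =
    \sum_(i < n.+1) 'C(n, i)%:R * x 0 0 ^+ i * mom (n - i)%N * wallis i (n - i + m).
  rewrite /=; transitivity (cos_int m (fun t => \sum_(i < n.+1)
      'C(n, i)%:R * x 0 0 ^+ i * mom (n - i)%N * (sin t ^+ i * cos t ^+ (n - i)))).
    congr (cos_int m _); apply/funext => t.
    transitivity (sphere_int m (fun xi => \sum_(i < n.+1)
      ('C(n, i)%:R * x 0 0 ^+ i * (sin t ^+ i * cos t ^+ (n - i))) *
      dotv xi (tailv x) ^+ (n - i)%N)).
      congr (sphere_int m _); apply/funext => xi.
      rewrite dotv_lift exprDn; apply: eq_bigr => i _.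
      by rewrite !exprMn -mulr_natl; ring.
    rewrite (pos_functional_sum _ _ (sphere_int_pos m)); last first.
      by move=> i; exact: continuous_scale.
    apply: eq_bigr => i _.
    by rewrite (pos_functionalZ _ _ (sphere_int_pos m))// /mom mulrAC.
  rewrite (pos_functional_sum _ _ (cos_int_pos m)); last first.
    by move=> i; apply: continuous_scale; exact: continuous_sincosX.
  apply: eq_bigr => i _.
  rewrite (pos_functionalZ _ _ (cos_int_pos m)) ?wallis_cos_int//.
  exact: continuous_sincosX.
rewrite e1; case: ifPn => on.
  apply: big1 => i _; case: (boolP (odd i)) => oi.
    by rewrite wallis_odd// mulr0.
  (* With [n] odd and [i] even it is the equatorial moment of exponent [n - i] that vanishes. *)
  have io : odd (n - i) by rewrite oddB ?on ?(negbTE oi)// -ltnS.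
  by rewrite /mom IH io mulr0 mul0r.
have [k nk] : exists k, n = (2 * k)%N by exists n./2; rewrite mul2n even_halfK.
rewrite nk in e1 on *; rewrite {e1}.
have -> : (2 * k)./2 = k by rewrite mul2n doubleK.
rewrite (sum_even k (fun i => 'C(2 * k, i)%:R * x 0 0 ^+ i * mom (2 * k - i)%N * wallis i (2 * k - i + m))); last first.
  by move=> i oi; rewrite wallis_odd// mulr0.
have e0 : sphere_int m.+1 (fun=> 1) = s1 * wallis 0 m.
  rewrite /= (pos_functional_cst _ _ (cos_int_pos m)); congr (_ * _).
rewrite e0 sqnorm_tail exprDn mulr_sumr [RHS](reindex_inj rev_ord_inj) /=.
apply: eq_bigr => i _.
have ik : (i <= k)%N by rewrite -ltnS.
rewrite subSS subKn// -mulnBr -mulr_natl.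
set l := (k - i)%N.
have kE : k = (i + l)%N by rewrite /l subnKC.
have ol : odd (2 * l) = false by rewrite oddM.
rewrite wallis_oddprod /mom IH ol.
have -> : (2 * l)./2 = l by rewrite mul2n doubleK.
have b := @bin_oddprod R i l.
rewrite -kE in b *.
have -> : 'C(k, l) = 'C(k, i) by rewrite bin_sub.
rewrite mulr1 -exprM -mulr_natl -/s1.
have pl : oddprod m.+1 l != 0 :> R := oddprod_neq0 m l.
(* The factor [oddprod m.+1 l] appears in the numerator of the Wallis value and in the denominator
   of the equatorial moment, and cancels. *)
transitivity ('C(2 * k, 2 * i)%:R * (oddprod 1 i * oddprod 1 l) *
  (x 0 0 ^+ (2 * i) * sqnorm (tailv x) ^+ l * s1 * wallis 0 m / oddprod m.+2 k) *
  (oddprod m.+1 l / oddprod m.+1 l)); first by ring.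
rewrite b (divff pl); ring.
Qed.

End sphere_functional.

(** * Uniform polynomial approximation, and functionals determined by their moments *)

Section polynomial_approximation.
Context {R : realType}.
Implicit Types (h g : R -> R) (A : R).

Definition poly_approx A h := forall e, 0 < e ->
  exists p : {poly R}, forall z, `|z| <= A -> `|h z - p.[z]| <= e.

Lemma poly_approx_poly A (p : {poly R}) : poly_approx A (horner p).
Proof. by move=> e e0; exists p => z _; rewrite subrr normr0 ltW. Qed.

Lemma poly_approxD A h g : poly_approx A h -> poly_approx A g ->
  poly_approx A (fun z => h z + g z).
Proof.
move=> ah ag e e0; have e2 : 0 < e / 2 by rewrite divr_gt0.
have [p hp] := ah _ e2; have [q gq] := ag _ e2.
exists (p + q) => z zA; rewrite hornerD opprD addrACA.
by rewrite (le_trans (ler_normD _ _))// (splitr e) lerD ?hp ?gq.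
Qed.

Lemma poly_approxZ A (k : R) h : poly_approx A h ->
  poly_approx A (fun z => k * h z).
Proof.
move=> ah e e0; have k0 : 0 < `|k| + 1 by rewrite ltr_wpDl.
have [p hp] := ah (e / (`|k| + 1)) (divr_gt0 e0 k0).
exists (k *: p) => z zA; rewrite hornerZ -mulrBr normrM.
apply: (le_trans (ler_wpM2l (normr_ge0 k) (hp z zA))).
by rewrite mulrCA ler_piMr ?(ltW e0)// ler_pdivrMr// mul1r lerDl.
Qed.

Lemma poly_approx_sum A (I : Type) (r : seq I) (F : I -> R -> R) :
  (forall i, poly_approx A (F i)) ->
  poly_approx A (fun z => \sum_(i <- r) F i z).
Proof.
move=> aF; elim: r => [|i r IH].
  have -> : (fun z => \sum_(i <- [::]) F i z) = horner (0 : {poly R}).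
    by apply/funext => z; rewrite big_nil horner0.
  exact: poly_approx_poly.
by under eq_fun do rewrite big_cons; exact: poly_approxD.
Qed.

Lemma poly_approx_uniform A h :
  (forall e, 0 < e -> exists2 g, poly_approx A g &
    forall z, `|z| <= A -> `|h z - g z| <= e) -> poly_approx A h.
Proof.
move=> H e e0; have e2 : 0 < e / 2 by rewrite divr_gt0.
have [g ag hg] := H _ e2; have [p gp] := ag _ e2.
exists p => z zA; rewrite -[_ - _](subrKA (g z)).
by rewrite (le_trans (ler_normD _ _))// (splitr e) lerD ?hg ?gp.
Qed.

(** Taylor polynomials: the tail of the cosine series at [k z] is dominated term by term by the tail
    of the exponential series at [B = |k| A], uniformly in [z]. *)
Lemma poly_approx_cos A (k : R) : poly_approx A (fun z => cos (k * z)).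
Proof.
move=> e e0; pose B := `|k| * A.
have [n hn] : exists n, expR B - series (exp_coeff B) n <= e.
  have /cvgrPdist_le/(_ e e0)[n _ hn] := is_cvg_series_exp_coeff B.
  exists n; have := hn n (leqnn n).
  by apply: le_trans; exact: ler_norm.
pose c i : R := (~~ odd i)%:R * (-1) ^+ i./2 / i`!%:R.
exists (\poly_(i < n) (c i * k ^+ i)) => z zA.
have -> : (\poly_(i < n) (c i * k ^+ i)).[z] = series (cos_coeff (k * z)) n.
  rewrite horner_poly /series /= big_mkord; apply: eq_bigr => i _.
  by rewrite /c /cos_coeff /= exprMn -exprnP; ring.
apply: le_trans hn.
have kzB : `|k * z| <= B by rewrite normrM ler_wpM2l.
have cv1 : (fun N => `|series (cos_coeff (k * z)) N - series (cos_coeff (k * z)) n|) @ \oo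
    --> `|cos (k * z) - series (cos_coeff (k * z)) n|.
  apply: cvg_norm; apply: cvgB; last exact: cvg_cst.
  by rewrite unlock; exact: is_cvg_series_cos_coeff.
have cv2 : (fun N => series (exp_coeff B) N - series (exp_coeff B) n) @ \oo
    --> expR B - series (exp_coeff B) n.
  apply: cvgB; last exact: cvg_cst.
  exact: is_cvg_series_exp_coeff.
apply: (ler_cvg_to cv1 cv2); near=> N.
have nN : (n <= N)%N by near: N; exact: nbhs_infty_ge.
rewrite !sub_series nN.
apply: (le_trans (ler_norm_sum _ _ _)); apply: ler_sum => i _.
rewrite /cos_coeff /exp_coeff /= !normrM normfV !normr_nat !normrX normrN normr1 expr1n mulr1.
rewrite -?normrX ler_wpM2r// normrX.
apply: (@le_trans _ _ (`|k * z| ^+ i)); last by apply: lerXn2r; rewrite ?nnegrE ?(le_trans _ kzB).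
by case: odd; rewrite ?mul0r ?mul1r ?exprn_ge0.
Unshelve. all: by end_near. Qed.

(** Equal moments give equality on polynomials, and the two total masses bound what the
    approximation error of [h] contributes. *)
Lemma eq_pos_functional_poly A (E1 E2 : (R -> R) -> R) h :
  pos_functional `[- A, A] E1 -> pos_functional `[- A, A] E2 ->
  (forall n, E1 (fun z => z ^+ n) = E2 (fun z => z ^+ n)) ->
  continuous h -> poly_approx A h -> E1 h = E2 h.
Proof.
move=> P1 P2 mom ch ah.
have cX n : continuous (fun z : R => z ^+ n) by apply: continuous_pow; exact: continuous_idE.
have cp (p : {poly R}) : continuous (fun z => p.[z]) by move=> z; exact: continuous_horner.
have Ep (p : {poly R}) : E1 (horner p) = E2 (horner p).
  have -> : horner p = fun z => \sum_(i < size p) p`_i * z ^+ i.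
    by apply/funext => z; rewrite horner_coef.
  have cpx (i : 'I_(size p)) : continuous (fun z : R => p`_i * z ^+ i) by exact: continuous_scale.
  rewrite (pos_functional_sum _ _ P1)// (pos_functional_sum _ _ P2)//.
  apply: eq_bigr => i _.
  by rewrite (pos_functionalZ _ _ P1)// (pos_functionalZ _ _ P2)// mom.
have M0 : 0 < E1 (fun=> 1) + E2 (fun=> 1) + 1.
  have := pos_functional1_ge0 _ _ P1; have := pos_functional1_ge0 _ _ P2; lra.
apply/eqP; rewrite -subr_eq0 -normr_le0; apply/ler_addgt0Pl => e e0; rewrite addr0.
set M := E1 _ + _ + 1 in M0.
have [p hp] := ah (e / M) (divr_gt0 e0 M0).
have cd : continuous (fun z => h z - p.[z]) by apply: continuous_sub.
have hp' z : `[- A, A]%classic z -> `|h z - p.[z]| <= e / M.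
  by rewrite /= in_itv/= -ler_norml; exact: hp.
have n1 := pos_functional_norm_le_cst _ _ P1 _ _ cd hp'.
have n2 := pos_functional_norm_le_cst _ _ P2 _ _ cd hp'.
rewrite (pos_functionalB _ _ P1)// in n1.
rewrite (pos_functionalB _ _ P2)// in n2.
have -> : E1 h - E2 h = (E1 h - E1 (horner p)) - (E2 h - E2 (horner p)).
  by rewrite Ep; ring.
apply: (le_trans (ler_normB _ _)); apply: (le_trans (lerD n1 n2)).
rewrite -mulrDr -mulrA ler_piMr ?(ltW e0)// mulrC ler_pdivrMr// mul1r /M; lra.
Qed.

End polynomial_approximation.

Lemma pos_functional_comp {R : realType} {T U : topologicalType} (K : set T)
    (L : set U) (E : (T -> R) -> R) (g : T -> U) (c : R) :
  pos_functional K E -> continuous g -> (forall x, K x -> L (g x)) -> 0 <= c ->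
  pos_functional L (fun h => c * E (fun x => h (g x))).
Proof.
move=> PE cg KL c0; split=> [a f k cf ck|f cf f0].
  by rewrite PE.1; [ring|exact: continuous_compE..].
apply: mulr_ge0 => //; apply: PE.2; first exact: continuous_compE.
by move=> x Kx; apply: f0; exact: KL.
Qed.

Section zonal.
Context {R : realType}.

Lemma enorm_sqr d (x : 'rV[R]_d) : enorm x ^+ 2 = sqnorm x.
Proof. by rewrite sqr_sqrtr// sqnorm_ge0. Qed.

Lemma enorm_ge0 d (x : 'rV[R]_d) : 0 <= enorm x.
Proof. exact: sqrtr_ge0. Qed.

(* Archimedes: integrating a zonal function over the sphere reduces to one
   latitude variable. *)
Lemma sphere_int_zonal m (x : 'rV[R]_m.+2) (h : R -> R) :
  continuous h -> (forall A, poly_approx A h) ->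
  sphere_int m.+1 (fun xi => h (dotv xi x)) =
  sphere_int m (fun=> 1) * cos_int m (fun t => h (enorm x * sin t)).
Proof.
move=> ch ah.
(* [A] has to bound [<xi, x>] on the whole cube, whence the sum of absolute values, as well as
   [enorm x * sin t]. *)
pose A := enorm x + \sum_i `|x 0 i|.
have SA : 0 <= \sum_i `|x 0 i| by apply: sumr_ge0.
have E1 := pos_functional_comp _ `[- A, A]%classic _ (fun xi => dotv xi x) 1
  (sphere_int_pos m.+1) (continuous_dotv x).
have E2 := pos_functional_comp _ `[- A, A]%classic _ (fun t => enorm x * sin t)
  (sphere_int m (fun=> 1)) (cos_int_pos m).
rewrite -[LHS]mul1r.
apply: (eq_pos_functional_poly A _ _ h (E1 _ _) (E2 _ _ _)) => //.
- move=> xi hxi; rewrite /= in_itv/= -ler_norml.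
  apply: (le_trans (ler_norm_sum _ _ _)); rewrite /A -[leLHS]add0r lerD ?enorm_ge0//.
  apply: ler_sum => i _; rewrite normrM ler_piMl//.
  by have := hxi i; rewrite /= in_itv/= -ler_norml.
- by apply: continuous_scale; exact: continuous_sin.
- move=> t _; rewrite /= in_itv/= -ler_norml normrM (ger0_norm (enorm_ge0 _ _)).
  rewrite /A -[leLHS]addr0 lerD// ler_piMr ?enorm_ge0//; exact: sin_max.
- exact: pos_functional1_ge0 (sphere_int_pos m).
move=> n; rewrite mul1r sphere_int_moment.
have -> : cos_int m (fun t => (enorm x * sin t) ^+ n) = enorm x ^+ n * wallis n m.
  have -> : wallis n m = cos_int m (fun t : R => sin t ^+ n * cos t ^+ 0).
    by rewrite -wallis_cos_int.
  rewrite -(pos_functionalZ _ _ (cos_int_pos m)).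
    by congr cos_int; apply/funext => t; rewrite exprMn expr0 mulr1.
  exact: continuous_sincosX.
case: ifPn => on; first by rewrite wallis_odd// !mulr0.
have nE : n = (2 * n./2)%N by rewrite mul2n even_halfK.
rewrite -enorm_sqr -exprM -nE.
have -> : wallis n m = oddprod 1 n./2 / oddprod m.+2 n./2 * wallis 0 m :> R.
  rewrite {1}nE; have := @wallis_oddprod R m n./2 0.
  by rewrite add0n addn0 /oddprod [X in _ * X / _]big_ord0 mulr1.
have -> : sphere_int m.+1 (fun=> 1) = sphere_int m (fun=> 1) * wallis 0 m :> R.
  rewrite /= (pos_functional_cst _ _ (cos_int_pos m)); congr (_ * _).
ring.
Qed.

End zonal.

(** * The elementary conditionally positive kernels *)

Section cosine_kernel.
Context {R : realType}.
Implicit Types (f df ddf : R -> R) (a x : R).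

(** Normalized so that for every [a] the value and the slope at 0 vanish and the second derivative
    is [- 2 cos (a x)]; [- x^2] is the limit as [a] tends to 0. *)
Definition cos_kernel a x : R :=
  if a == 0 then - x ^+ 2 else 2 * (cos (a * x) - 1) / a ^+ 2.

Definition cos_kernel_deriv a x : R :=
  if a == 0 then - 2 * x else - 2 * sin (a * x) / a.

Lemma cos_kernel_derive a x : is_derive x 1 (cos_kernel a) (cos_kernel_deriv a x).
Proof.
rewrite /cos_kernel /cos_kernel_deriv; case: eqP => [_|/eqP a0].
  have := is_derive_opp (is_derive_pow 1 (is_derive_idE x)).
  by congr is_derive; rewrite expr1; ring.
have d := is_derive_shift_scale 0 a (is_derive_cos (0 + a * x)).
have := is_derive_scale (2 / a ^+ 2) (is_derive_add d (is_derive_cstE (- 1) x)).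
congr is_derive; last by rewrite add0r; field.
by apply/funext => t; rewrite add0r; ring.
Qed.

Lemma cos_kernel_derive2 a x :
  is_derive x 1 (cos_kernel_deriv a) (- 2 * cos (a * x)).
Proof.
rewrite /cos_kernel_deriv; case: eqP => [->|/eqP a0].
  by rewrite mul0r cos0; exact: is_derive_scale _ (is_derive_idE x).
have d := is_derive_shift_scale 0 a (is_derive_sin (0 + a * x)).
have := is_derive_scale (- 2 / a) d.
congr is_derive; last by rewrite add0r; field.
by apply/funext => t; rewrite add0r; ring.
Qed.

Lemma cos_kernel0 a : cos_kernel a 0 = 0.
Proof. by rewrite /cos_kernel expr0n oppr0 mulr0 cos0 subrr mulr0 mul0r if_same. Qed.

Lemma cos_kernel_deriv0 a : cos_kernel_deriv a 0 = 0.
Proof. by rewrite /cos_kernel_deriv mulr0 mulr0 sin0 mulr0 mul0r if_same. Qed.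

Lemma poly_approx_cos_kernel A a : poly_approx A (cos_kernel a).
Proof.
rewrite /cos_kernel; case: eqP => _.
  have -> : (fun x : R => - x ^+ 2) = horner (- 'X^2).
    by apply/funext => x; rewrite hornerN hornerXn.
  exact: poly_approx_poly.
have -> : (fun x => 2 * (cos (a * x) - 1) / a ^+ 2) =
    (fun x => 2 / a ^+ 2 * (cos (a * x) + horner (- 1) x)).
  by apply/funext => x; rewrite hornerN hornerC; ring.
apply: poly_approxZ; apply: poly_approxD; first exact: poly_approx_cos.
exact: poly_approx_poly.
Qed.

(** Since the weights sum to 0, terms depending on only one of [z j], [z k] disappear. What remains
    is [2 (sum p_j z_j)^2] for the quadratic kernel, and by the addition formula two squares with a
    positive factor for the cosine. *)
Lemma sum_cos_kernel_ge0 (I : Type) (s : seq I) (p z : I -> R) a :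
  \sum_(j <- s) p j = 0 ->
  0 <= \sum_(j <- s) \sum_(k <- s) p j * p k * cos_kernel a (z j - z k).
Proof.
move=> p0.
have split2 (F G : I -> R) : \sum_(j <- s) \sum_(k <- s) F j * G k =
    (\sum_(j <- s) F j) * (\sum_(j <- s) G j).
  rewrite big_distrl /=; apply: eq_bigr => j _; rewrite big_distrr //.
rewrite /cos_kernel; case: eqP => _.
  have -> : \sum_(j <- s) \sum_(k <- s) p j * p k * - (z j - z k) ^+ 2 =
     \sum_(j <- s) \sum_(k <- s) (- p j * z j ^+ 2) * p k +
     \sum_(j <- s) \sum_(k <- s) (- p j) * (p k * z k ^+ 2) +
     \sum_(j <- s) \sum_(k <- s) (2 * p j * z j) * (p k * z k).
    rewrite -!big_split /=; apply: eq_bigr => j _.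
    by rewrite -!big_split /=; apply: eq_bigr => k _; ring.
  rewrite !split2 p0 mulr0 sumrN p0 oppr0 mul0r !add0r.
  have -> : \sum_(j <- s) 2 * p j * z j = 2 * \sum_(j <- s) p j * z j.
    by rewrite mulr_sumr; apply: eq_bigr => j _; rewrite !mulrA.
  by rewrite -mulrA mulr_ge0// -expr2 sqr_ge0.
have -> : \sum_(j <- s) \sum_(k <- s) p j * p k * (2 * (cos (a * (z j - z k)) - 1) / a ^+ 2) =
     \sum_(j <- s) \sum_(k <- s) (2 / a ^+ 2 * p j * cos (a * z j)) * (p k * cos (a * z k)) +
     \sum_(j <- s) \sum_(k <- s) (2 / a ^+ 2 * p j * sin (a * z j)) * (p k * sin (a * z k)) +
     \sum_(j <- s) \sum_(k <- s) (- (2 / a ^+ 2) * p j) * p k.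
  rewrite -!big_split /=; apply: eq_bigr => j _.
  rewrite -!big_split /=; apply: eq_bigr => k _.
  by rewrite (mulrBr a) cosB; ring.
rewrite !split2 p0 mulr0 addr0.
have e (g : R -> R) : (\sum_(j <- s) 2 / a ^+ 2 * p j * g (a * z j)) =
    2 / a ^+ 2 * \sum_(j <- s) p j * g (a * z j).
  by rewrite mulr_sumr; apply: eq_bigr => j _; rewrite !mulrA.
have k0 : 0 <= 2 / a ^+ 2 by rewrite divr_ge0// sqr_ge0.
by rewrite !e -!(mulrA (2 / a ^+ 2)) -!expr2 addr_ge0// mulr_ge0// sqr_ge0.
Qed.

Lemma mvt0 f df A x : (forall x : R, is_derive x 1 f (df x)) -> f 0 = 0 ->
  `|x| <= A -> exists2 c, `|c| <= A & f x = df c * x.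
Proof.
move=> fd f0 xA; have [x0|/ltW x0] := leP 0 x.
  have [c /andP[c0 cx]] := mvt_all _ _ _ _ fd x0; rewrite f0 !subr0 => ->.
  by exists c => //; rewrite ger0_norm// (le_trans cx)// -(ger0_norm x0).
have [c /andP[c0 cx]] := mvt_all _ _ _ _ fd x0; rewrite f0 !sub0r => e.
exists c; first by rewrite ler0_norm// (le_trans _ xA)// ler0_norm// lerN2.
by rewrite -[LHS]opprK e mulrN opprK.
Qed.

(** Two applications of the mean value theorem starting at 0; this explains the constant [M A^2]
    instead of the Taylor constant [M A^2 / 2]. *)
Lemma second_order_bound f df ddf A M x : (forall x : R, is_derive x 1 f (df x)) ->
  (forall x : R, is_derive x 1 df (ddf x)) -> f 0 = 0 -> df 0 = 0 ->
  (forall y, `|y| <= A -> `|ddf y| <= M) -> `|x| <= A -> `|f x| <= M * A ^+ 2.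
Proof.
move=> fd dfd f0 df0 hM xA.
have [c cA ->] := mvt0 _ _ _ _ fd f0 xA.
have [e eA ->] := mvt0 _ _ _ _ dfd df0 cA.
rewrite !normrM expr2 mulrA ler_pM ?mulr_ge0// ler_pM//; exact: hM.
Qed.

End cosine_kernel.

(** * The Fejer kernel: positivity, decay and total integral *)

Section fejer_kernel.
Context {R : realType}.
Notation mu := (@lebesgue_measure R).

(** The squared modulus of [sum_(j < N) exp (i j z)], not divided by [N]. As a double sum of cosines
    it has a convolution with [u] that can be read off term by term. *)
Definition fejer (N : nat) (z : R) : R :=
  \sum_(j < N) \sum_(k < N) cos ((j%:R - k%:R) * z).

Lemma fejer_sqr N (z : R) : fejer N z =
  (\sum_(j < N) cos (j%:R * z)) ^+ 2 + (\sum_(j < N) sin (j%:R * z)) ^+ 2.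
Proof.
rewrite !expr2 !big_distrl -big_split /=; apply: eq_bigr => j _.
rewrite !big_distrr -big_split /=; apply: eq_bigr => k _.
by rewrite mulrBl cosB.
Qed.

Lemma fejer_ge0 N (z : R) : 0 <= fejer N z.
Proof. by rewrite fejer_sqr addr_ge0 ?sqr_ge0. Qed.

Lemma sin_half_sum_cos N (z : R) : 2 * sin (z / 2) * \sum_(j < N) cos (j%:R * z) =
  sin (N%:R * z - z / 2) + sin (z / 2).
Proof.
elim: N => [|N IH].
  by rewrite big_ord0 mulr0 mul0r add0r sinN addNr.
rewrite big_ord_recr /= mulrDr IH.
have -> : N.+1%:R * z - z / 2 = N%:R * z + z / 2 by rewrite -natr1; field.
rewrite sinB sinD; ring.
Qed.

Lemma sin_half_sum_sin N (z : R) : 2 * sin (z / 2) * \sum_(j < N) sin (j%:R * z) =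
  cos (z / 2) - cos (N%:R * z - z / 2).
Proof.
elim: N => [|N IH].
  by rewrite big_ord0 mulr0 mul0r add0r cosN subrr.
rewrite big_ord_recr /= mulrDr IH.
have -> : N.+1%:R * z - z / 2 = N%:R * z + z / 2 by rewrite -natr1; field.
rewrite cosB cosD; ring.
Qed.

(** Multiplication by [2 sin (z / 2)] telescopes the cosine and sine sums into a sum and a
    difference of two numbers of [[-1, 1]], so each square is at most 4. *)
Lemma fejer_le N (z : R) : sin (z / 2) ^+ 2 * fejer N z <= 2.
Proof.
have h : 4 * (sin (z / 2) ^+ 2 * fejer N z) =
    (sin (N%:R * z - z / 2) + sin (z / 2)) ^+ 2 +
    (cos (z / 2) - cos (N%:R * z - z / 2)) ^+ 2.
  by rewrite -sin_half_sum_cos -sin_half_sum_sin fejer_sqr; ring.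
have b (x y : R) : `|x| <= 1 -> `|y| <= 1 -> (x + y) ^+ 2 <= 4.
  move=> x1 y1; rewrite -real_normK ?num_real//.
  have : `|x + y| <= 2 by rewrite (le_trans (ler_normD _ _))//; lra.
  move=> h2; rewrite (_ : 4 = 2 ^+ 2 :> R); last by ring.
  by apply: lerXn2r; rewrite ?nnegrE.
have b1 := b _ _ (sin_max (N%:R * z - z / 2)) (sin_max (z / 2)).
have b2 := b (cos (z / 2)) (- cos (N%:R * z - z / 2)) (cos_max _).
rewrite normrN in b2; have {}b2 := b2 (cos_max _).
lra.
Qed.

Lemma sin_natpi (n : nat) : sin (n%:R * pi : R) = 0.
Proof.
elim: n => [|n IH]; first by rewrite mul0r sin0.
by rewrite -natr1 mulrDl mul1r sinDpi IH oppr0.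
Qed.

Lemma continuous_fejer N : continuous (fejer N).
Proof.
apply: continuous_bigsum => j; apply: continuous_bigsum => k.
apply: continuous_compE; first exact: continuous_cos.
by apply: continuous_scale; exact: continuous_idE.
Qed.

(** The window is a full period: off-diagonal cosines integrate to 0 and each of the [N] diagonal
    terms contributes its length [2 h]. *)
Lemma fejer_int N x h : 0 < h ->
  \int[mu]_(y in `[x - h, x + h]) fejer N (pi / h * (x - y)) = 2 * h * N%:R.
Proof.
move=> h0.
have xh : x - h <= x + h by lra.
have cs (j k : nat) : continuous (fun y => cos ((j%:R - k%:R) * (pi / h * (x - y)))).
  apply: (continuous_compE _ _ (@continuous_cos R)).
  do 2 apply: continuous_scale.
  by apply: continuous_sub; [exact: cst_continuous|exact: continuous_idE].
have term (j k : nat) :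
  \int[mu]_(y in `[x - h, x + h]) cos ((j%:R - k%:R) * (pi / h * (x - y))) =
  if j == k then 2 * h else 0.
  case: eqP => [->|/eqP jk].
    have d (y : R) : is_derive y 1 (fun y => y) (cos ((k%:R - k%:R) * (pi / h * (x - y)))).
      by rewrite subrr mul0r cos0; exact: is_derive_idE.
    by rewrite (ftc _ _ _ _ xh (cs k k) d); ring.
  have d0 : j%:R - k%:R != 0 :> R by rewrite subr_eq0 eqr_nat.
  pose a : R := (j%:R - k%:R) * (pi / h).
  have a0 : a != 0 by rewrite !mulf_neq0// ?invr_eq0 gt_eqF// pi_gt0.
  have d (y : R) : is_derive y 1 (fun y => - a^-1 * sin (a * x + - a * y))
      (cos ((j%:R - k%:R) * (pi / h * (x - y)))).
    have := is_derive_scale (- a^-1) (is_derive_shift_scale (a * x) (- a) (is_derive_sin (a * x + - a * y))).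
    congr is_derive; rewrite mulrA mulrNN mulVf// mul1r; congr cos.
    by rewrite /a; ring.
  rewrite (ftc _ _ _ _ xh (cs j k) d).
  have e1 : a * x + - a * (x + h) = - (j%:R * pi - k%:R * pi).
    by rewrite /a; field; rewrite gt_eqF.
  have e2 : a * x + - a * (x - h) = j%:R * pi - k%:R * pi.
    by rewrite /a; field; rewrite gt_eqF.
  by rewrite e1 e2 sinN !sinB !sin_natpi !mul0r mulr0 subrr oppr0 mulr0 subrr.
have w1 : pos_functional `[x - h, x + h]
    (fun f => \int[mu]_(y in `[x - h, x + h]) (f y * 1)).
  by apply: pos_functional_segment => //; exact: cst_continuous.
have rm1 (f : R -> R) : \int[mu]_(y in `[x - h, x + h]) f y =
   \int[mu]_(y in `[x - h, x + h]) (f y * 1).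
  by apply: eq_Rintegral => y _; rewrite mulr1.
rewrite rm1 /fejer (pos_functional_sum _ _ w1); last first.
  by move=> j; apply: continuous_bigsum => k; exact: cs.
rewrite (eq_bigr (fun=> 2 * h)).
  by rewrite sumr_const card_ord mulr_natr.
move=> j _; rewrite (pos_functional_sum _ _ w1); last by move=> k; exact: cs.
rewrite (bigD1 j)//= -rm1 term eqxx big1 ?addr0// => k kj.
by rewrite -rm1 term; case: eqP => // /ord_inj e; rewrite e eqxx in kj.
Qed.

End fejer_kernel.

(** * Fejer means of [u], and the resulting approximation of [f] *)

Section fejer_approximation.
Context {R : realType}.
Notation mu := (@lebesgue_measure R).
Variables (u : R -> R) (r : R).
Hypotheses (r_gt0 : 0 < r) (u_cont : continuous u)
  (u_supp : forall x, r <= `|x| -> u x = 0).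
Hypotheses (u_ge0 : forall x, 0 <= u x) (u_even : forall x, u (- x) = u x)
  (u_int1 : (\int[mu]_x (u x)%:E = 1)%E).

Definition cos_transform (a : R) : R :=
  \int[mu]_(y in `[- r, r]) (cos (a * y) * u y).
Definition sin_transform (a : R) : R :=
  \int[mu]_(y in `[- r, r]) (sin (a * y) * u y).

Hypotheses (cos_transform_ge0 : forall a, 0 <= cos_transform a)
  (sin_transform0 : forall a, sin_transform a = 0).

Let c_lin (a b : R) : continuous (fun y => a * (b - y)).
Proof.
apply: continuous_scale; apply: continuous_sub; first exact: cst_continuous.
exact: continuous_idE.
Qed.

Let c_cos (a b : R) : continuous (fun y => cos (a * (b - y))).
Proof. exact: (continuous_compE _ _ (@continuous_cos R)). Qed.

Let c_cosl (a : R) : continuous (fun y => cos (a * y)).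
Proof.
by apply: (continuous_compE _ _ (@continuous_cos R)); apply: continuous_scale; exact: continuous_idE.
Qed.

Let c_sinl (a : R) : continuous (fun y => sin (a * y)).
Proof.
by apply: (continuous_compE _ _ (@continuous_sin R)); apply: continuous_scale; exact: continuous_idE.
Qed.

Let supp_pos : pos_functional `[- r, r] (fun g => \int[mu]_(y in `[- r, r]) (g y * u y)).
Proof. by apply: pos_functional_segment. Qed.

Let cos_convolution a x :
  \int[mu]_(y in `[- r, r]) (cos (a * (x - y)) * u y) = cos_transform a * cos (a * x).
Proof.
transitivity (\int[mu]_(y in `[- r, r])
   ((cos (a * x) * cos (a * y) + sin (a * x) * sin (a * y)) * u y)).
  by apply: eq_Rintegral => y _; rewrite mulrBr cosB.
rewrite (supp_pos.1 (cos (a * x)) _ _ (c_cosl a) (continuous_scale _ _ (c_sinl a))).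
rewrite (pos_functionalZ _ _ supp_pos _ _ (c_sinl a)).
by rewrite -/(sin_transform a) sin_transform0 mulr0 addr0 mulrC.
Qed.

(** For [h >= r], the Cesaro mean of the Fourier series of the [2h]-periodic extension of [u]; its
    coefficients are samples of the Fourier transform of [u], hence nonnegative. *)
Definition fejer_mean (h : R) (N : nat) (x : R) : R :=
  \sum_(j < N) \sum_(k < N) cos_transform ((j%:R - k%:R) * (pi / h)) / (2 * h * N%:R)
     * cos ((j%:R - k%:R) * (pi / h) * x).

(** The condition [|x| + r <= h] places the support of [u] inside the window around [x], so
    periodization does not change the convolution. *)
Let fejer_mean_int h N x : 0 < h -> `|x| + r <= h ->
  fejer_mean h N x = (2 * h * N%:R)^-1 *
    \int[mu]_(y in `[x - h, x + h]) (fejer N (pi / h * (x - y)) * u y).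
Proof.
move=> h0 xrh.
rewrite (Rintegral_supp u r u_supp (fun y => fejer N (pi / h * (x - y)))); last first.
  move=> y /=; rewrite !in_itv/=; have := ler_norm x; have := ler_norm (- x).
  rewrite normrN => h1 h2 /andP[h3 h4]; apply/andP; split; lra.
have cjk (j k : nat) : continuous (fun y => cos ((j%:R - k%:R) * (pi / h * (x - y)))).
  by under eq_fun do rewrite mulrA; exact: c_cos.
rewrite /fejer (pos_functional_sum _ _ supp_pos) /fejer_mean; last first.
  by move=> j; apply: continuous_bigsum => k; exact: cjk.
rewrite mulr_sumr; apply: eq_bigr => j _.
rewrite (pos_functional_sum _ _ supp_pos) ?mulr_sumr; last by move=> k; exact: cjk.
apply: eq_bigr => k _.
under eq_Rintegral do rewrite mulrA.
by rewrite cos_convolution; ring.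
Qed.

(** Split the window at distance [d] from [x]: nearby, uniform continuity bounds [|u x - u y|] by
    [e / 2]; farther away, the kernel is at most [2 / s^2] whatever [N], while its total integral
    grows like [N]. *)
Let fejer_mean_dist A e : 0 < A -> 0 < e ->
  exists N, forall x, `|x| <= A -> `|u x - fejer_mean (A + r) N x| <= e.
Proof.
move=> A0 e0; pose h := A + r; have h0 : 0 < h by rewrite addr_gt0.
have [B [B0 uB]] := supp_bounded u r r_gt0 u_cont u_supp u_ge0.
have e2 : 0 < e / 2 by rewrite divr_gt0.
have cadd : continuous (fun p : R * R => u (p.2 + p.1)).
  apply: (continuous_compE _ _ u_cont).
  by move=> p; apply: cvgD; [exact: cvg_snd|exact: cvg_fst].
have := near_uniform_compact `[- A, A]%classic (fun d x => u (x + d)) 0 (e / 2)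
  (@segment_compact R _ _) cadd e2.
move=> /nbhs_ballP[d' /= d'0 hd'].
(* Capping [d] by [h] keeps [pi d / (2 h)] at most [pi / 2], where the sine increases; so [s] bounds
   the sine from below on the far part. *)
pose d := Num.min (d' / 2) h.
have d0 : 0 < d by rewrite lt_min divr_gt0.
have dh : d <= h by rewrite ge_min lexx orbT.
have dd' : d < d' by rewrite gt_min; apply/orP; left; lra.
pose s := sin (pi / h * d / 2).
have pid x : 0 <= x -> x <= h -> pi / h * x / 2 <= pi / 2.
  move=> x0 xh; rewrite ler_pM2r// mulrAC -mulrA ler_piMr ?pi_ge0//.
  by rewrite ler_pdivrMr// mul1r.
have pid0 x : 0 <= x -> 0 <= pi / h * x / 2.
  by move=> x0; rewrite !mulr_ge0 ?pi_ge0 ?invr_ge0// ltW.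
have s0 : 0 < s.
  apply: sin_gt0_pi; rewrite !mulr_gt0 ?pi_gt0 ?invr_gt0//=.
  by rewrite (le_lt_trans (pid d (ltW d0) dh))// ltr_pdivrMr// ltr_pMr ?pi_gt0// ltr1n.
have sle z : d <= `|z| -> `|z| <= h -> s ^+ 2 <= sin (pi / h * z / 2) ^+ 2.
  move=> dz zh.
  have -> : sin (pi / h * z / 2) ^+ 2 = sin (pi / h * `|z| / 2) ^+ 2.
    have [z0|z0] := leP 0 z; first by rewrite ger0_norm.
    by rewrite ltr0_norm// !mulrN mulNr sinN sqrrN.
  have Nh : - (pi / 2) <= 0 :> R by rewrite oppr_le0 divr_ge0// pi_ge0.
  have mem x : 0 <= x -> x <= h -> pi / h * x / 2 \in `[- (pi / 2), pi / 2].
    by move=> x0 xh; rewrite in_itv/= (le_trans Nh (pid0 _ x0)) pid.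
  have mono : s <= sin (pi / h * `|z| / 2).
    rewrite /s leNgt ltr_sin ?mem ?(ltW d0)//.
    by rewrite -leNgt ler_pM2r// ler_pM2l// divr_gt0// pi_gt0.
  by rewrite lerXn2r// nnegrE ltW// (lt_le_trans s0).
(* With [M = 2 B / s^2], this is the condition [2 M / e <= N] under which the far part [2 h M] is at
   most [(e / 2) (2 h N)]. *)
have [N NB] : exists N, 4 * B / (s ^+ 2 * e) <= N.+1%:R.
  exists (Num.trunc (4 * B / (s ^+ 2 * e))); apply: ltW; exact: truncnS_gt.
exists N.+1 => x xA.
have hN0 : 0 < 2 * h * N.+1%:R by rewrite !mulr_gt0.
have xrh : `|x| + r <= h by rewrite lerD2r.
rewrite -/h (fejer_mean_int _ _ _ h0 xrh).
pose K y := fejer N.+1 (pi / h * (x - y)).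
have cK : continuous K by apply: (continuous_compE _ _ (continuous_fejer _)); exact: c_lin.
have W : pos_functional `[x - h, x + h]
    (fun g => \int[mu]_(y in `[x - h, x + h]) (g y * K y)).
  by apply: pos_functional_segment => // y _; exact: fejer_ge0.
have intK : \int[mu]_(y in `[x - h, x + h]) (1 * K y) = 2 * h * N.+1%:R.
  by rewrite -(fejer_int _ x h h0); apply: eq_Rintegral => y _; rewrite mul1r.
have -> : u x - (2 * h * N.+1%:R)^-1 * \int[mu]_(y in `[x - h, x + h]) (fejer N.+1 (pi / h * (x - y)) * u y)
   = (2 * h * N.+1%:R)^-1 * \int[mu]_(y in `[x - h, x + h]) ((u x - u y) * K y).
  rewrite (pos_functionalB _ _ W _ _ (@cst_continuous _ _ (u x)) u_cont).
  rewrite (pos_functional_cst _ _ W) intK mulrBr mulrCA mulVf ?gt_eqF// mulr1.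
  by congr (_ - _ * _); apply: eq_Rintegral => y _; rewrite mulrC.
rewrite normrM gtr0_norm ?invr_gt0// mulrC ler_pdivrMr//.
have cdiff : continuous (fun y => (u x - u y) * K y).
  by apply: continuous_mul => //; apply: continuous_sub => //; exact: cst_continuous.
apply: (@le_trans _ _ (\int[mu]_(y in `[x - h, x + h]) `|(u x - u y) * K y|)).
  by apply: le_normr_Rintegral => //; exact: integrable_segment.
pose M := B * 2 / s ^+ 2.
have M0 : 0 <= M by rewrite divr_ge0 ?sqr_ge0// mulr_ge0// ltW.
apply: (@le_trans _ _ (\int[mu]_(y in `[x - h, x + h]) ((e / 2) * K y + M))).
  apply: le_Rintegral => //.
  - by apply: integrable_segment; exact: continuous_norm.
  - apply: integrable_segment; apply: continuous_add; last exact: cst_continuous.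
    exact: continuous_scale.
  move=> y; rewrite /= in_itv/= => /andP[y1 y2].
  have K0 : 0 <= K y := fejer_ge0 _ _.
  rewrite normrM (ger0_norm K0).
  have [near|far] := ltP `|x - y| d.
    rewrite -[leLHS]addr0 lerD//.
    rewrite ler_wpM2r//.
    have := hd' (y - x) _ x _; rewrite /= addr0 subrKC; apply.
      by rewrite /ball /= sub0r normrN distrC (lt_trans near).
    by rewrite /= in_itv/= -ler_norml.
  rewrite -[leLHS]add0r lerD// ?(mulr_ge0 (ltW e2))//.
  have KM : K y <= 2 / s ^+ 2.
    rewrite ler_pdivlMr ?exprn_gt0// mulrC.
    apply: le_trans (fejer_le N.+1 (pi / h * (x - y))).
    by rewrite ler_wpM2r// sle// ler_norml; apply/andP; split; lra.
  rewrite /M -mulrA ler_pM//.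
  rewrite ler_norml; have := u_ge0 x; have := u_ge0 y; have := uB x; have := uB y.
  by move=> *; apply/andP; split; lra.
have -> : \int[mu]_(y in `[x - h, x + h]) ((e / 2) * K y + M) =
    e / 2 * (2 * h * N.+1%:R) + M * (2 * h).
  rewrite RintegralD//; last 2 first.
  - by apply: integrable_segment; exact: continuous_scale.
  - by apply: integrable_segment; exact: cst_continuous.
  congr (_ + _).
    rewrite RintegralZl//; last exact: integrable_segment.
    by rewrite -intK; under [in RHS]eq_Rintegral do rewrite mul1r.
  have d1 (y : R) : is_derive y 1 (fun y => M * y) M.
    by have := is_derive_scale M (is_derive_idE y); rewrite mulr1.
  rewrite (ftc _ _ _ _ _ (@cst_continuous _ _ M) d1); first by ring.
  by lra.
have hM : M * (2 * h) <= e / 2 * (2 * h * N.+1%:R).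
  rewrite [leRHS](_ : _ = e / 2 * N.+1%:R * (2 * h)); last by ring.
  rewrite ler_pM2r ?mulr_gt0//.
  apply: (@le_trans _ _ (e / 2 * (4 * B / (s ^+ 2 * e)))).
    by rewrite le_eqVlt; apply/orP; left; apply/eqP; rewrite /M; field; rewrite !gt_eqF.
  by rewrite ler_pM2l.
lra.
Qed.

(** The finite sum is built to match [f] in value and slope at 0, and its second derivative is [-2]
    times a Fejer mean while [f'' = - 2 u]. Integrating the error [e'] twice costs [2 A^2], whence
    [e' = e / (2 A^2)]. *)
Lemma neg_abs_conv_cos_kernel A e : 0 < A -> 0 < e ->
  exists (N : nat) (g a : nat -> nat -> R), (forall j k, 0 <= g j k) /\
    forall x, `|x| <= A -> `|neg_abs_conv u x -
      (neg_abs_conv u 0 + \sum_(j < N) \sum_(k < N) g j k * cos_kernel (a j k) x)| <= e.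
Proof.
move=> A0 e0.
pose e' := e / (2 * A ^+ 2).
have A20 : 0 < 2 * A ^+ 2 by rewrite mulr_gt0// exprn_gt0.
have e'0 : 0 < e' by rewrite divr_gt0.
have [N hN] := fejer_mean_dist A e' A0 e'0.
have h0 : 0 < A + r by rewrite addr_gt0.
pose a (j k : nat) : R := (j%:R - k%:R) * (pi / (A + r)).
pose g j k := cos_transform (a j k) / (2 * (A + r) * N%:R).
exists N, g, a; split.
  by move=> j k; rewrite divr_ge0// !mulr_ge0// ltW.
pose f := neg_abs_conv u.
have fd := neg_abs_conv_derive u r r_gt0 u_cont u_supp u_even u_int1.
have fd2 := neg_abs_conv_derive2 u r u_cont u_supp.
pose S x := \sum_(j < N) \sum_(k < N) g j k * cos_kernel (a j k) x.
pose dS x := \sum_(j < N) \sum_(k < N) g j k * cos_kernel_deriv (a j k) x.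
have Sd (x : R) : is_derive x 1 S (dS x).
  apply: is_derive_bigsum => j; apply: is_derive_bigsum => k.
  exact/is_derive_scale/cos_kernel_derive.
have dSd (x : R) : is_derive x 1 dS (- 2 * fejer_mean (A + r) N x).
  rewrite /fejer_mean mulr_sumr; apply: is_derive_bigsum => j.
  rewrite mulr_sumr; apply: is_derive_bigsum => k.
  have := is_derive_scale (g j k) (cos_kernel_derive2 (a j k) x).
  by congr is_derive; rewrite /g /a; ring.
pose fN x := f 0 + S x.
have fNd (x : R) : is_derive x 1 fN (dS x).
  by have := is_derive_add (is_derive_cstE (f 0) x) (Sd x); rewrite add0r.
have hd (y : R) : is_derive y 1 (fun y => f y - fN y) (neg_abs_conv_deriv u y - dS y).
  exact: is_derive_add (fd y) (is_derive_opp (fNd y)).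
have hd2 (y : R) : is_derive y 1 (fun y => neg_abs_conv_deriv u y - dS y)
    (- 2 * u y - - 2 * fejer_mean (A + r) N y).
  exact: is_derive_add (fd2 y) (is_derive_opp (dSd y)).
move=> x xA.
have := second_order_bound _ _ _ A (2 * e') x hd hd2 _ _ _ xA.
have -> : 2 * e' * A ^+ 2 = e.
  by rewrite /e'; field; rewrite gt_eqF.
apply.
- suff -> : fN 0 = f 0 by rewrite subrr.
  rewrite /fN /S big1 ?addr0// => j _; rewrite big1// => k _.
  by rewrite cos_kernel0 mulr0.
- rewrite (neg_abs_conv_deriv0 u r)// /dS big1 ?subrr// => j _.
  by rewrite big1// => k _; rewrite cos_kernel_deriv0 mulr0.
- move=> y yA; rewrite -mulrBr normrM normrN (ger0_norm (ler0n _ 2)) ler_pM2l//.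
  exact: hN.
Qed.

End fejer_approximation.

(** * Improper integrals as limits over increasing segments *)

Section exhaustion.
Context {R : realType}.
Notation mu := (@lebesgue_measure R).
Implicit Types (f g F : R -> R) (a b : nat -> R).

Lemma within_continuous_for f (D : set R) :
  (forall x, D x -> {for x, continuous f}) -> {within D, continuous f}.
Proof.
by move=> fD; apply: continuous_in_subspaceT => x /set_mem; exact: fD.
Qed.

Lemma integrable_segment_within f (p q : R) : {within `[p, q], continuous f} ->
  mu.-integrable `[p, q] (EFin \o f).
Proof. by apply: continuous_compact_integrable; exact: segment_compact. Qed.

Lemma ftc_within f F (p q : R) : p <= q ->
  (forall x, p <= x <= q -> {for x, continuous f}) ->
  (forall x : R, p <= x <= q -> is_derive x 1 F (f x)) ->
  \int[mu]_(x in `[p, q]) f x = F q - F p.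
Proof.
rewrite le_eqVlt => /predU1P[->|pq] cf Fd.
  by rewrite subrr set_itv1 Rintegral_set1.
have cF x : p <= x <= q -> {for x, continuous F}.
  move=> xpq; apply: differentiable_continuous; apply/derivable1_diffP.
  by have := Fd _ xpq; case.
rewrite /Rintegral (@continuous_FTC2 _ _ F _ _ pq)//.
- by apply: within_continuous_for => x /=; rewrite in_itv/=; exact: cf.
- split.
  + move=> x; rewrite in_itv/= => /andP[px xq].
    by have := Fd x; rewrite !ltW//= => /(_ isT); case.
  + by apply: cvg_at_right_filter; apply: cF; rewrite lexx ltW.
  + by apply: cvg_at_left_filter; apply: cF; rewrite lexx ltW.
- move=> x; rewrite in_itv/= => /andP[px xq]; rewrite derive1E.
  by have := Fd x; rewrite !ltW//= => /(_ isT); case.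
Qed.

(** Monotone convergence for a function that may blow up at the edge of [D]. The bound [M] makes the
    limit integral finite, as [Rintegral] sends an infinite one to the default value 0. *)
Lemma cvg_Rintegral_exhaust g a b (D : set R) (M : R) :
  (forall n m, (n <= m)%N -> a m <= a n) -> (forall n m, (n <= m)%N -> b n <= b m) ->
  \bigcup_n `[a n, b n]%classic = D ->
  (forall x, D x -> {for x, continuous g}) -> (forall x, D x -> 0 <= g x) ->
  (forall n, \int[mu]_(t in `[a n, b n]) g t <= M) ->
  (fun n => \int[mu]_(t in `[a n, b n]) g t) @ \oo --> \int[mu]_(t in D) g t.
Proof.
move=> da ib UD cg g0 gM.
have sD n : `[a n, b n]%classic `<=` D by rewrite -UD => x hx; exists n.
have ig n : mu.-integrable `[a n, b n] (EFin \o g).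
  apply: integrable_segment_within; apply: within_continuous_for => x /sD; exact: cg.
have cv : (\int[mu]_(t in `[a n, b n]) (g t)%:E)%E @[n --> \oo] -->
    (\int[mu]_(t in D) (g t)%:E)%E.
  rewrite -UD; apply: ge0_nondecreasing_set_cvg_integral => //.
  - move=> n m nm; apply/subsetPset => x /=; rewrite !in_itv/= => /andP[h1 h2].
    by rewrite (le_trans (da _ _ nm))//= (le_trans h2)// ib.
  - by move=> n; apply: measurable_int (ig n).
  - by move=> n x /sD /g0; rewrite lee_fin.
have e n : (\int[mu]_(t in `[a n, b n]) (g t)%:E)%E = (\int[mu]_(t in `[a n, b n]) g t)%:E.
  by rewrite /Rintegral fineK//; exact: integrable_fin_num.
have fin : (\int[mu]_(t in D) (g t)%:E)%E \is a fin_num.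
  rewrite ge0_fin_numE; last by apply: integral_ge0 => x /g0; rewrite lee_fin.
  apply: (@le_lt_trans _ _ M%:E); last by rewrite ltry.
  apply: cvge_to_le cv _; apply: nearW => n.
  by rewrite e lee_fin.
by rewrite /Rintegral; apply: fine_cvg; rewrite fineK.
Qed.

End exhaustion.

(** * The Gamma function by truncation *)

Section gamma.
Context {R : realType}.
Notation mu := (@lebesgue_measure R).
Implicit Types x y t : R.

Definition gamma_fun y t : R := t `^ (y - 1) * expR (- t).

(** Truncation stays away from 0, where the integrand is singular for [y < 1], and from infinity;
    integration by parts is then an instance of the fundamental theorem on a segment. *)
Definition gamma_trunc y (n : nat) : R :=
  \int[mu]_(t in `[n.+1%:R^-1, n.+1%:R]) gamma_fun y t.

Let lo_gt0 n : 0 < n.+1%:R^-1 :> R. Proof. by rewrite invr_gt0. Qed.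
Let lo_le1 n : n.+1%:R^-1 <= 1 :> R. Proof. by rewrite invf_le1// ler1n. Qed.
Let hi_ge1 n : 1 <= n.+1%:R :> R. Proof. by rewrite ler1n. Qed.
Let lo_hi n : n.+1%:R^-1 <= n.+1%:R :> R. Proof. exact: le_trans (hi_ge1 _). Qed.

Lemma gamma_fun_ge0 y t : 0 <= gamma_fun y t.
Proof. by rewrite mulr_ge0 ?powR_ge0 ?expR_ge0. Qed.

Let expN_derive t : is_derive t 1 (fun t => expR (- t)) (- expR (- t)).
Proof.
have := @is_derive_compE R expR (fun t => - t) t _ _ (is_derive_expR (- t))
  (is_derive_opp (is_derive_idE t)).
by rewrite mulrN1.
Qed.

Lemma gamma_fun_derive y t : 0 < t ->
  is_derive t 1 (gamma_fun (y + 1)) (y * gamma_fun y t - gamma_fun (y + 1) t).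
Proof.
move=> t0; have d := @is_derive1_powR R y t t0.
have := is_derive_mul d (expN_derive t).
by rewrite /gamma_fun addrK; congr is_derive; ring.
Qed.

Lemma gamma_fun_continuous y t : 0 < t -> {for t, continuous (gamma_fun y)}.
Proof.
move=> t0; apply: differentiable_continuous; apply/derivable1_diffP.
by have := @gamma_fun_derive (y - 1) t t0; rewrite subrK; case.
Qed.

Let cont_seg y n t : n.+1%:R^-1 <= t <= n.+1%:R -> {for t, continuous (gamma_fun y)}.
Proof. by move=> /andP[h _]; apply: gamma_fun_continuous; exact: lt_le_trans h. Qed.

Let int_seg y n : mu.-integrable `[n.+1%:R^-1, n.+1%:R] (EFin \o gamma_fun y).
Proof.
apply: integrable_segment_within; apply: within_continuous_for => t /=.
by rewrite in_itv/=; exact: cont_seg.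
Qed.

Lemma gamma_trunc_rec y n : gamma_trunc (y + 1) n =
  y * gamma_trunc y n - (gamma_fun (y + 1) n.+1%:R - gamma_fun (y + 1) n.+1%:R^-1).
Proof.
have c t : n.+1%:R^-1 <= t <= n.+1%:R ->
    {for t, continuous (fun t => y * gamma_fun y t - gamma_fun (y + 1) t)}.
  move=> ht; apply: cvgB; last exact: cont_seg ht.
  by apply: cvgM; [exact: cvg_cst|exact: cont_seg ht].
have d t : n.+1%:R^-1 <= t <= n.+1%:R ->
    is_derive t 1 (gamma_fun (y + 1)) (y * gamma_fun y t - gamma_fun (y + 1) t).
  by move=> /andP[h _]; apply: gamma_fun_derive; exact: lt_le_trans h.
have <- := ftc_within _ _ _ _ (lo_hi n) c d.
rewrite RintegralB//; last first.
  by rewrite (_ : _ \o _ = fun t => (y%:E * (EFin \o gamma_fun y) t)%E)//; exact: integrableZl.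
by rewrite RintegralZl// /gamma_trunc; ring.
Qed.

Lemma gamma_fun_lo y n : 0 <= y -> gamma_fun (y + 1) n.+1%:R^-1 <= n.+1%:R^-1 `^ y.
Proof.
by move=> y0; rewrite /gamma_fun addrK ler_piMr ?powR_ge0.
Qed.

(** The term of degree [K + 1 > y] of the exponential series beats [t^y] and still leaves a factor
    [1 / t]. *)
Lemma gamma_fun_hi y : exists2 C, 0 <= C & forall n, gamma_fun (y + 1) n.+1%:R <= C * n.+1%:R^-1.
Proof.
pose K := (Num.trunc y).+1.
have yK : y <= K%:R by apply: ltW; exact: truncnS_gt.
exists (K.+1)`!%:R; first by [].
move=> n; rewrite /gamma_fun addrK.
have b0 : 0 < n.+1%:R :> R by [].
apply: (@le_trans _ _ (n.+1%:R ^+ K * expR (- n.+1%:R))).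
  by rewrite ler_wpM2r ?expR_ge0// -powR_mulrn// ler_powR.
rewrite expRN ler_pdivrMr ?expR_gt0//.
have h : n.+1%:R ^+ K.+1 / K.+1`!%:R <= expR n.+1%:R :> R.
  by apply: le_trans (expR_ge1Dxn K (ltW b0)); rewrite lerDr.
have f0 : 0 < K.+1`!%:R :> R by rewrite ltr0n fact_gt0.
rewrite ler_pdivrMr// exprS in h.
rewrite -(ler_pM2l b0) (le_trans h)// mulrA mulrCA divff ?gt_eqF// mulr1 mulrC //.
Qed.

Let gamma_trunc_nat_bounded (k : nat) : exists M, forall n, gamma_trunc k.+1%:R n <= M.
Proof.
elim: k => [|k [M hM]].
  exists 1 => n.
  have d t : is_derive t 1 (fun t => - expR (- t)) (gamma_fun 1 t).
    have := is_derive_opp (expN_derive t).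
    by rewrite opprK /gamma_fun subrr powRr0 mul1r.
  rewrite /gamma_trunc (ftc_within _ _ _ _ (lo_hi n) (fun t => @cont_seg 1 n t) (fun t _ => d t)).
  rewrite opprK addrC; apply: le_trans (_ : expR (- n.+1%:R^-1) <= _).
    by rewrite gerDl oppr_le0 expR_ge0.
  by rewrite expR_le1 oppr_le0 ltW.
exists (k.+1%:R * M + 1) => n.
rewrite -natr1 gamma_trunc_rec opprB addrA lerBlDr -[leLHS]addr0 lerD ?gamma_fun_ge0//.
rewrite lerD//; first by rewrite ler_wpM2l.
apply: le_trans (gamma_fun_lo _ _ _) _ => //.
by rewrite -[leRHS](powRr0 n.+1%:R^-1) ger_powR// ?lo_gt0 lo_le1.
Qed.

(** The recursion trades [t^(y-1)], singular at 0, for [t^y], which is at most [1 + t^K]; the two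
    integer cases then bound it. *)
Lemma gamma_trunc_bounded y : 0 < y -> exists M, forall n, gamma_trunc y n <= M.
Proof.
move=> y0; pose K := (Num.trunc y).+1.
have yK : y <= K%:R by apply: ltW; exact: truncnS_gt.
have [M1 h1] := gamma_trunc_nat_bounded 0.
have [M2 h2] := gamma_trunc_nat_bounded K.
have [C C0 hC] := gamma_fun_hi y.
exists ((M1 + M2 + C) / y) => n.
rewrite ler_pdivlMr// mulrC.
have -> : y * gamma_trunc y n = gamma_trunc (y + 1) n +
    (gamma_fun (y + 1) n.+1%:R - gamma_fun (y + 1) n.+1%:R^-1).
  by rewrite gamma_trunc_rec; ring.
apply: lerD; last first.
  rewrite (le_trans (_ : _ <= gamma_fun (y + 1) n.+1%:R))//.
    by rewrite gerDl oppr_le0 gamma_fun_ge0.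
  by rewrite (le_trans (hC n))// ler_piMr.
apply: le_trans (lerD (h1 n) (h2 n)).
rewrite -RintegralD//; apply: le_Rintegral => //.
  by have := integrableD _ (int_seg 1 n) (int_seg K.+1%:R n); exact.
move=> t; rewrite /= in_itv/= => /andP[t1 t2].
have t0 : 0 < t := lt_le_trans (lo_gt0 n) t1.
rewrite /gamma_fun -mulrDl ler_wpM2r ?expR_ge0// addrK subrr powRr0 -natr1 addrK.
have [tl|tg] := leP t 1.
  rewrite -[leLHS]addr0 lerD ?powR_ge0//.
  by rewrite -[leRHS](powRr0 t) ger_powR ?t0// ltW.
by rewrite -[leLHS]add0r lerD// ler_powR// ltW.
Qed.

Lemma Gamma_cvg y : 0 < y -> gamma_trunc y @ \oo --> Gamma y.
Proof.
move=> y0; have [M hM] := gamma_trunc_bounded y y0.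
apply: (cvg_Rintegral_exhaust (gamma_fun y) (fun n => n.+1%:R^-1) (fun n => n.+1%:R) _ M) => //.
- by move=> n m nm; rewrite lef_pV2 ?posrE// ler_nat.
- by move=> n m nm; rewrite ler_nat.
- apply/seteqP; split => t /=.
    by move=> [n _] /=; rewrite !in_itv/= andbT => /andP[h _]; exact: lt_le_trans h.
  rewrite in_itv/= andbT => t0.
  pose n := maxn (Num.trunc t) (Num.trunc t^-1).
  exists n => //=; rewrite in_itv/=; apply/andP; split.
    rewrite invf_ple ?posrE//; apply: ltW; apply: lt_le_trans (truncnS_gt _) _.
    by rewrite ler_nat ltnS leq_maxr.
  apply: ltW; apply: lt_le_trans (truncnS_gt _) _.
  by rewrite ler_nat ltnS leq_maxl.
- by move=> t /=; rewrite in_itv/= andbT; exact: gamma_fun_continuous.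
- by move=> t _; exact: gamma_fun_ge0.
Qed.

Lemma GammaD1 y : 0 < y -> Gamma (y + 1) = y * Gamma y.
Proof.
move=> y0; have y1 : 0 < y + 1 by rewrite addr_gt0.
have c1 := Gamma_cvg _ y1.
have inv0 : (fun n => n.+1%:R^-1 : R) @ \oo --> (0 : R) by exact: cvg_harmonic.
have chi : (fun n => gamma_fun (y + 1) n.+1%:R) @ \oo --> (0 : R).
  have [C C0 hC] := gamma_fun_hi y.
  apply: (@squeeze_cvgr _ _ _ _ (fun=> 0) (fun n => C * n.+1%:R^-1)).
  - by apply: nearW => n; rewrite gamma_fun_ge0 hC.
  - exact: cvg_cst.
  - by rewrite -(mulr0 C); apply: cvgM; [exact: cvg_cst|exact: inv0].
have clo : (fun n => gamma_fun (y + 1) n.+1%:R^-1) @ \oo --> (0 : R).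
  apply: (@squeeze_cvgr _ _ _ _ (fun=> 0) (fun n => n.+1%:R^-1 `^ y)).
  - by apply: nearW => n; rewrite gamma_fun_ge0 gamma_fun_lo// ltW.
  - exact: cvg_cst.
  - exact: ((cvg_at_rightP _ _ _).1 (@powR_cvg0 R y y0) _ (conj lo_gt0 inv0)).
have c2 : gamma_trunc (y + 1) @ \oo --> y * Gamma y - (0 - 0).
  rewrite (_ : gamma_trunc _ = fun n => y * gamma_trunc y n -
      (gamma_fun (y + 1) n.+1%:R - gamma_fun (y + 1) n.+1%:R^-1)); last first.
    by apply/funext => n; exact: gamma_trunc_rec.
  apply: cvgB; last exact: cvgB.
  by apply: cvgM; [exact: cvg_cst|exact: Gamma_cvg].
by rewrite !subr0 in c2; exact: (cvg_unique _ c1 c2).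
Qed.

Lemma Gamma_gt0 y : 0 < y -> 0 < Gamma y.
Proof.
move=> y0.
have l1 : 2%:R^-1 <= 2%:R :> R := lo_hi 1.
have ct : {within `[2%:R^-1, 2%:R], continuous (gamma_fun y)}.
  apply: within_continuous_for => t /=; rewrite in_itv/=; exact: (@cont_seg y 1 t).
have [c] := EVT_min l1 ct; rewrite in_itv/= => /andP[c1 _] hc.
have c0 : 0 < c := lt_le_trans (lo_gt0 1) c1.
have g0 : 0 < gamma_fun y c by rewrite mulr_gt0 ?powR_gt0 ?expR_gt0.
(* Index 1 is the segment [[1/2, 2]]; index 0 would be the single point 1. *)
have pos : 0 < gamma_trunc y 1.
  apply: (@lt_le_trans _ _ (\int[mu]_(t in `[2%:R^-1, 2%:R]) gamma_fun y c)).
    have d t : is_derive t 1 (fun t => gamma_fun y c * t) (gamma_fun y c).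
      by have := is_derive_scale (gamma_fun y c) (is_derive_idE t); rewrite mulr1.
    rewrite (ftc _ _ _ _ l1 (@cst_continuous _ _ _) d).
    by rewrite -mulrBr mulr_gt0//; lra.
  apply: le_Rintegral => //.
  by apply: integrable_segment; exact: cst_continuous.
apply: lt_le_trans pos _; apply: cvgr_to_ge (Gamma_cvg _ y0) _.
near=> n; have n1 : (1 <= n)%N by near: n; exact: nbhs_infty_ge.
rewrite /gamma_trunc /Rintegral fine_le//.
- by have i1 := int_seg y 1; exact: integrable_fin_num.
- by have i1 := int_seg y n; exact: integrable_fin_num.
- apply: ge0_subset_integral => //=.
  + by apply: measurable_int (int_seg y n).
  + by move=> t _; rewrite lee_fin gamma_fun_ge0.
  + move=> t /=; rewrite !in_itv/= => /andP[h1 h2]; apply/andP; split.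
      by rewrite (le_trans _ h1)// lef_pV2 ?posrE// ler_nat.
    by rewrite (le_trans h2)// ler_nat.
Unshelve. all: by end_near. Qed.

Lemma Gamma_midpoint y : 1 / 2 < y -> Gamma y <= (Gamma (y + 1 / 2) + Gamma (y - 1 / 2)) / 2.
Proof.
move=> y2.
have [y0 yp ym] : [/\ 0 < y, 0 < y + 1 / 2 & 0 < y - 1 / 2] by split; lra.
have c : (fun n => (gamma_trunc (y + 1 / 2) n + gamma_trunc (y - 1 / 2) n) / 2) @ \oo
    --> (Gamma (y + 1 / 2) + Gamma (y - 1 / 2)) / 2.
  by apply: cvgM; [apply: cvgD; exact: Gamma_cvg|exact: cvg_cst].
apply: (ler_cvg_to (Gamma_cvg _ y0) c); apply: nearW => n /=.
rewrite ler_pdivlMr// -RintegralD// /gamma_trunc -RintegralZr//.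
apply: le_Rintegral => //.
- rewrite (_ : _ \o _ = fun t => ((EFin \o gamma_fun y) t * 2%:E)%E)//; exact: integrableZr.
- by have := integrableD _ (int_seg (y + 1 / 2) n) (int_seg (y - 1 / 2) n); exact.
move=> t; rewrite /= in_itv/= => /andP[t1 t2].
have t0 : 0 < t := lt_le_trans (lo_gt0 n) t1.
rewrite /gamma_fun -mulrDl mulrAC ler_wpM2r ?expR_ge0//.
have p (z : R) : t `^ (y - 1 / 2 - 1 + z) = t `^ (y - 1 / 2 - 1) * t `^ z.
  by rewrite powRD//; apply/implyP => _; rewrite gt_eqF.
have -> : y - 1 = y - 1 / 2 - 1 + 2^-1 by field.
have -> : y + 1 / 2 - 1 = y - 1 / 2 - 1 + 1 by field.
rewrite !p powR12_sqrt ?(ltW t0)// powRr1 ?(ltW t0)//.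
rewrite -mulrA -[X in _ <= _ + X]mulr1 -mulrDr ler_wpM2l ?powR_ge0//.
(* Once [t^(y - 3/2)] is factored out, the claim is [2 sqrt t <= t + 1]. *)
have : 0 <= (Num.sqrt t - 1) ^+ 2 by rewrite sqr_ge0.
rewrite sqrrB1 sqr_sqrtr ?(ltW t0)//; lra.
Qed.

End gamma.

(** * The constants [c_d] and [C_d] *)

Section constants.
Context {R : realType}.

Lemma c_constE d : (2 <= d)%N -> c_const d =
  2 / Num.sqrt pi * (Gamma (d%:R / 2) / Gamma ((d%:R - 1) / 2)) :> R.
Proof.
move=> d2; rewrite /c_const /sphere_meas.
have d1E : d.-1%:R = d%:R - 1 :> R by rewrite -subn1 natrB// ltnW.
have d2R : 2 <= d%:R :> R by rewrite (ler_nat _ 2).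
have g1 : 0 < Gamma (d%:R / 2) :> R by apply: Gamma_gt0; lra.
have g2 : 0 < Gamma ((d%:R - 1) / 2) :> R by apply: Gamma_gt0; lra.
have s0 : 0 < Num.sqrt pi :> R by rewrite sqrtr_gt0 pi_gt0.
rewrite d1E.
have -> : pi `^ (d%:R / 2) = pi `^ ((d%:R - 1) / 2) * Num.sqrt pi :> R.
  rewrite -powR12_sqrt ?pi_ge0// -powRD; last by apply/implyP => _; rewrite gt_eqF// pi_gt0.
  by congr powR; field.
have p0 : 0 < pi `^ ((d%:R - 1) / 2) :> R by rewrite powR_gt0// pi_gt0.
move: g1 g2 s0 p0; move: (Gamma (d%:R / 2)) (Gamma ((d%:R - 1) / 2)) (Num.sqrt pi)
  (pi `^ ((d%:R - 1) / 2)) => a b s p a0 b0 s0 p0.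
by field; rewrite !gt_eqF.
Qed.

Lemma c_const_gt0 d : (2 <= d)%N -> 0 < c_const d :> R.
Proof.
move=> d2; have d2R : 2 <= d%:R :> R by rewrite (ler_nat _ 2).
rewrite c_constE// mulr_gt0 ?divr_gt0 ?sqrtr_gt0 ?pi_gt0//; apply: Gamma_gt0; lra.
Qed.

Lemma C_constE d : (2 <= d)%N -> C_const d = c_const d / (d%:R - 1) :> R.
Proof.
move=> d2; have d2R : 2 <= d%:R :> R by rewrite (ler_nat _ 2).
have y0 : 0 < (d%:R - 1) / 2 :> R by lra.
rewrite c_constE// /C_const.
have -> : (d%:R + 1) / 2 = (d%:R - 1) / 2 + 1 :> R by field.
rewrite GammaD1//.
have g2 := Gamma_gt0 _ y0.
have s0 : 0 < Num.sqrt pi :> R by rewrite sqrtr_gt0 pi_gt0.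
have d1 : 0 < d%:R - 1 :> R by lra.
move: g2 s0; move: (Gamma (d%:R / 2)) (Gamma ((d%:R - 1) / 2)) (Num.sqrt pi) => a b s b0 s0.
by field; rewrite !gt_eqF.
Qed.

(** Put [y = (d - 1) / 2]. The midpoint inequality bounds [Gamma (d / 2)] by [(y + 1) Gamma y / 2],
    which is at most [2 y Gamma y] as [y >= 1/2]; and [2 <= sqrt (d pi)]. *)
Lemma C_const_le_sqrt d : (2 <= d)%N -> C_const d <= Num.sqrt d%:R :> R.
Proof.
move=> d2; have d2R : 2 <= d%:R :> R by rewrite (ler_nat _ 2).
have y0 : 0 < (d%:R - 1) / 2 :> R by lra.
have y1 : 1 / 2 < d%:R / 2 :> R by lra.
have g := Gamma_midpoint _ y1.
have e1 : d%:R / 2 + 1 / 2 = (d%:R - 1) / 2 + 1 :> R by field.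
have e2 : d%:R / 2 - 1 / 2 = (d%:R - 1) / 2 :> R by field.
rewrite e1 e2 GammaD1// in g.
rewrite /C_const.
have -> : (d%:R + 1) / 2 = (d%:R - 1) / 2 + 1 :> R by field.
rewrite GammaD1//.
have g2 := Gamma_gt0 _ y0.
have s0 : 0 < Num.sqrt pi :> R by rewrite sqrtr_gt0 pi_gt0.
have s2 : 2 <= Num.sqrt d%:R * Num.sqrt pi :> R.
  rewrite -sqrtrM ?ler0n// -[leLHS]ger0_norm// -sqrtr_sqr ler_sqrt.
    have := @pi_ge2 R; nra.
  by rewrite mulr_ge0 ?pi_ge0.
set y := (d%:R - 1) / 2 in y0 e1 e2 g g2 *.
have y2 : 1 / 2 <= y by rewrite /y; lra.
have yg : 0 < y * Gamma y by rewrite mulr_gt0.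
have den : 0 < Num.sqrt pi * (y * Gamma y) by rewrite mulr_gt0.
rewrite ler_pdivrMr//; apply: (le_trans g).
rewrite mulrA (le_trans _ (ler_wpM2r (ltW yg) s2))//.
move: (Gamma y) g2 => a a0; have : a <= 2 * (y * a) by nra.
lra.
Qed.

End constants.

(** * The substitution [t = sin theta] in the dimension walk *)

Section latitude_substitution.
Context {R : realType}.
Notation mu := (@lebesgue_measure R).

Let pih_gt0 : 0 < pi / 2 :> R. Proof. by rewrite divr_gt0 ?pi_gt0. Qed.

(** Latitudes increasing to the pole, nonnegative because [pi / 2 >= 1]. *)
Let th (n : nat) : R := pi / 2 - n.+1%:R^-1.

Let th_bound n : 0 <= th n < pi / 2.
Proof.
rewrite /th; apply/andP; split; last by rewrite gtrDl oppr_lt0 invr_gt0.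
by rewrite subr_ge0 (le_trans _ (pihalf_ge1 R))// invf_le1// ler1n.
Qed.

Let th_mono n m : (n <= m)%N -> th n <= th m.
Proof. by move=> nm; rewrite lerD2l lerN2 lef_pV2 ?posrE// ler_nat. Qed.

Let sin_mono (x y : R) : 0 <= x -> x <= y -> y <= pi / 2 -> sin x <= sin y.
Proof.
move=> x0 xy yp; rewrite leNgt ltr_sin -?leNgt//; rewrite in_itv/=; lra.
Qed.

Let cos_th n (t : R) : 0 <= t <= th n -> 0 < cos t.
Proof.
by have := th_bound n => /andP[h1 h2] /andP[t0 tn]; apply: cos_gt0_pihalf; lra.
Qed.

Variables (d : nat) (h : R -> R).
Hypotheses (d_ge2 : (2 <= d)%N) (h_cont : continuous h) (h_ge0 : forall t, 0 <= h t).

Let G t : R := h t * (1 - t ^+ 2) `^ ((d%:R - 3) / 2).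
Let H t : R := h (sin t) * cos t ^+ (d - 2).

Let H_cont : continuous H.
Proof.
apply: continuous_mul; last exact: continuous_cosX.
exact: continuous_compE _ _ h_cont (@continuous_sin R).
Qed.

Let G_cont t : `|t| < 1 -> {for t, continuous G}.
Proof.
move=> t1; have t2 : 0 < 1 - t ^+ 2.
  by rewrite subr_gt0 -real_normK ?num_real// exprn_ilt1.
apply: cvgM; first exact: h_cont.
have d1 := @is_derive1_powR R ((d%:R - 3) / 2) (1 - t ^+ 2) t2.
have c1 : {for (1 - t ^+ 2), continuous (fun s : R => s `^ ((d%:R - 3) / 2))}.
  by apply: differentiable_continuous; apply/derivable1_diffP; case: d1.
apply: (@continuous_comp _ _ _ (fun t : R => 1 - t ^+ 2) _ t _ c1).
apply: (continuous_sub _ _ (@cst_continuous _ _ (1 : R)) (continuous_pow 2 _ continuous_idE)).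
Qed.

Let GH n t : 0 <= t <= th n -> G (sin t) * cos t = H t.
Proof.
move=> tn; have c0 := cos_th n t tn.
rewrite /G /H -mulrA -cos2sin2; congr (_ * _).
rewrite -(powR_mulrn 2) ?(ltW c0)// -powRrM.
rewrite -[X in _ * X]powRr1 ?(ltW c0)// -powRD; last by apply/implyP => _; rewrite gt_eqF.
rewrite -powR_mulrn ?(ltW c0)//; congr powR.
by rewrite natrB//; field.
Qed.

Let GH_int n : \int[mu]_(t in `[0, sin (th n)]) G t = \int[mu]_(t in `[0, th n]) H t.
Proof.
have /andP[t0 tp] := th_bound n.
have dsin : derive1 (@sin R) = @cos R.
  by apply/funext => t; rewrite derive1E; have := is_derive_sin t; case.
rewrite /Rintegral; congr fine.
have := @integration_by_substitution_increasing R sin G 0 (th n) t0.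
rewrite sin0 => ->.
- apply: eq_integral => t /set_mem; rewrite /= in_itv/= => tn.
  by rewrite fctE /= dsin (GH n).
- move=> x y; rewrite !in_itv/= => /andP[x0 xt] /andP[y0 yt].
  by rewrite ltr_sin// in_itv/=; lra.
- by move=> t _; rewrite dsin; exact: continuous_cos.
- by apply/cvg_ex; exists (cos 0); rewrite dsin; apply: cvg_at_right_filter; exact: continuous_cos.
- by apply/cvg_ex; exists (cos (th n)); rewrite dsin; apply: cvg_at_left_filter; exact: continuous_cos.
- split.
  + by move=> t _; have := is_derive_sin t; case.
  + by apply: cvg_at_right_filter; exact: continuous_sin.
  + by apply: cvg_at_left_filter; exact: continuous_sin.
- apply: within_continuous_for => t /=; rewrite in_itv/= => /andP[a0 at1].
  apply: G_cont; rewrite ger0_norm// (le_lt_trans at1)// -[ltRHS]sin_pihalf.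
  by rewrite ltr_sin// in_itv/=; lra.
Qed.

Let H_ge0 t : 0 <= t <= pi / 2 -> 0 <= H t.
Proof. by move=> /andP[t0 tp]; rewrite mulr_ge0// exprn_ge0// cos_ge0_pihalf//; lra. Qed.

Let H_bound n : \int[mu]_(t in `[0, th n]) H t <= \int[mu]_(t in `[0, pi / 2]) H t.
Proof.
have /andP[t0 tp] := th_bound n.
have i1 := integrable_segment H 0 (th n) H_cont.
have i2 := integrable_segment H 0 (pi / 2) H_cont.
rewrite /Rintegral fine_le//; [exact: integrable_fin_num..|].
apply: ge0_subset_integral => //=.
- by apply: measurable_int i2.
- by move=> t /=; rewrite !in_itv/= => /andP[-> h2]; rewrite (le_trans h2)// ltW.
Qed.

(** Up to latitude [th n] the weight is continuous and the change of variables is classical. Both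
    sides then converge by exhaustion, the bounded integral of [H] supplying the finiteness needed
    for [G]. *)
Lemma latitude_substitution :
  \int[mu]_(t in `[0, 1]) (h t * (1 - t ^+ 2) `^ ((d%:R - 3) / 2)) =
  \int[mu]_(t in `[0, pi / 2]) (h (sin t) * cos t ^+ (d - 2)).
Proof.
have th0 n : 0 <= th n by have /andP[] := th_bound n.
have thp n : th n <= pi / 2 by have /andP[_ /ltW] := th_bound n.
have near_top t : t < pi / 2 -> exists n, t <= th n.
  move=> tp; have e0 : 0 < pi / 2 - t by rewrite subr_gt0.
  exists (Num.trunc (pi / 2 - t)^-1).
  rewrite /th lerBrDr -lerBrDl invf_ple ?posrE//; apply: ltW; exact: truncnS_gt.
have cG : (fun n => \int[mu]_(t in `[0, sin (th n)]) G t) @ \oo --> \int[mu]_(t in `[0, 1[) G t.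
  apply: (cvg_Rintegral_exhaust G (fun=> 0) (fun n => sin (th n)) _
    (\int[mu]_(t in `[0, pi / 2]) H t)) => //.
  - by move=> n m nm; apply: sin_mono => //; exact: th_mono.
  - apply/seteqP; split => t /=.
      move=> [n _] /=; rewrite !in_itv/= => /andP[-> t1] /=.
      rewrite (le_lt_trans t1)// -sin_pihalf; have /andP[h1 h2] := th_bound n.
      by rewrite ltr_sin// in_itv/=; lra.
    rewrite in_itv/= => /andP[t0 t1].
    have t11 : -1 <= t <= 1 by lra.
    have t12 : -1 <= t < 1 by lra.
    have [n hn] := near_top _ (asin_ltpi2 t12).
    exists n => //=; rewrite in_itv/= t0 /=.
    rewrite -(@asinK _ t) ?in_itv//=.
    rewrite leNgt ltr_sin -?leNgt// in_itv/=; have := asin_geNpi2 t11; have := thp n; have := th0 n; lra.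
  - by move=> t /=; rewrite in_itv/= => /andP[t0 t1]; apply: G_cont; rewrite ger0_norm.
  - by move=> t _; rewrite mulr_ge0 ?powR_ge0.
  - by move=> n; rewrite GH_int.
have cH : (fun n => \int[mu]_(t in `[0, th n]) H t) @ \oo --> \int[mu]_(t in `[0, pi / 2[) H t.
  apply: (cvg_Rintegral_exhaust H (fun=> 0) th _ (\int[mu]_(t in `[0, pi / 2]) H t)) => //.
  - apply/seteqP; split => t /=.
      move=> [n _] /=; rewrite !in_itv/= => /andP[-> t1] /=.
      by rewrite (le_lt_trans t1)//; have /andP[] := th_bound n.
    rewrite in_itv/= => /andP[t0 t1]; have [n hn] := near_top _ t1.
    by exists n => //=; rewrite in_itv/= t0.
  - by move=> t _; exact: H_cont.
  - by move=> t /=; rewrite in_itv/= => /andP[t0 t1]; apply: H_ge0; rewrite t0 ltW.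
have e : \int[mu]_(t in `[0, 1[) G t = \int[mu]_(t in `[0, pi / 2[) H t.
  have GHn : (fun n => \int[mu]_(t in `[0, sin (th n)]) G t) =
      (fun n => \int[mu]_(t in `[0, th n]) H t) by apply/funext => n; exact: GH_int.
  by rewrite GHn in cG; exact: (cvg_unique _ cG cH).
have mG : measurable_fun (`]0, 1[%classic : set R) G.
  apply: subspace_continuous_measurable_fun; first exact: measurable_itv.
  apply: within_continuous_for => t; rewrite /= in_itv/= => /andP[t0 t1]; apply: G_cont.
  by rewrite ger0_norm// ltW.
have mH : measurable_fun (`]0, (pi / 2)[%classic : set R) H.
  apply: subspace_continuous_measurable_fun; first exact: measurable_itv.
  exact: continuous_subspaceT.
(* End points are negligible: both half-open integrals pass through the open interval to the closed
   one. *)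
move: e; rewrite /Rintegral => e.
have eG b := @integral_itv_bndoo R 0 1 (EFin \o G) true b ((measurable_EFinP _ _).2 mG).
have eH b := @integral_itv_bndoo R 0 (pi / 2) (EFin \o H) true b ((measurable_EFinP _ _).2 mH).
by move: e; rewrite (eG true) (eH true) -(eG false) -(eH false).
Qed.

End latitude_substitution.

(** * From real to complex conditional positivity *)

Section complex_sums.
Context {R : realType}.

Lemma sum_Complex (I : Type) (s : seq I) (a b : I -> R) :
  \sum_(i <- s) Complex (a i) (b i) = Complex (\sum_(i <- s) a i) (\sum_(i <- s) b i).
Proof.
elim: s => [|i s IH]; first by rewrite !big_nil.
by rewrite !big_cons IH.
Qed.

Lemma mul_conj_real (x y : R[i]) (g : R) :
  x * y^* * (Complex g 0 : R[i]) =
  Complex ((complex.Re x * complex.Re y + complex.Im x * complex.Im y) * g)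
    ((complex.Im x * complex.Re y - complex.Re x * complex.Im y) * g).
Proof.
case: x => [p q]; case: y => [p' q'].
by apply/eqP; rewrite eq_complex /=; apply/andP; split; apply/eqP; ring.
Qed.

(* A symmetric real kernel is positive on complex vectors as soon as it is
   on the real and imaginary parts. *)
Lemma CP1_real d (g : 'rV[R]_d -> R) : continuous g -> (forall x, g (- x) = g x) ->
  (forall (N : nat) (x : 'I_N -> 'rV[R]_d) (p : 'I_N -> R), \sum_j p j = 0 ->
    0 <= \sum_j \sum_k p j * p k * g (x j - x k)) -> CP1 g.
Proof.
move=> cg geven gpos; split => // N x a _ a0.
pose p j := complex.Re (a j); pose q j := complex.Im (a j).
have : \sum_j Complex (p j) (q j) = 0.
  by rewrite -[RHS]a0; apply: eq_bigr => j _; rewrite /p /q; case: (a j).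
rewrite sum_Complex => -[p0 q0].
under eq_bigr do under eq_bigr do rewrite mul_conj_real.
under eq_bigr do rewrite sum_Complex.
rewrite sum_Complex lecE /=; apply/andP; split; last first.
  have -> : \sum_j \sum_k (complex.Re (a j) * complex.Re (a k) + complex.Im (a j) * complex.Im (a k)) * g (x j - x k) =
     \sum_j \sum_k p j * p k * g (x j - x k) + \sum_j \sum_k q j * q k * g (x j - x k).
    rewrite -big_split /=; apply: eq_bigr => j _; rewrite -big_split /=.
    by apply: eq_bigr => k _; rewrite mulrDl.
  by rewrite addr_ge0 ?gpos.
(* The imaginary part is antisymmetric under exchange of [j] and [k], because [g] is even; so it
   vanishes. *)
apply/eqP; rewrite (eq_bigr (fun j => \sum_k q j * p k * g (x j - x k) -
    \sum_k p j * q k * g (x j - x k))); last first.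
  by move=> j _; rewrite -sumrB; apply: eq_bigr => k _; rewrite -mulrBl.
rewrite sumrB; apply/eqP; rewrite subr_eq0; apply/eqP.
rewrite exchange_big /=; apply: eq_bigr => j _; apply: eq_bigr => k _.
by rewrite -(geven (x j - x k)) opprB (mulrC (p j)).
Qed.

End complex_sums.

Section dot_product.
Context {R : realType} {d : nat}.
Implicit Types x y xi : 'rV[R]_d.

Lemma dotvD xi x y : dotv xi (x + y) = dotv xi x + dotv xi y.
Proof. by rewrite /dotv -big_split; apply: eq_bigr => i _; rewrite mxE mulrDr. Qed.

Lemma dotvZ xi (k : R) x : dotv xi (k *: x) = k * dotv xi x.
Proof. by rewrite /dotv mulr_sumr; apply: eq_bigr => i _; rewrite mxE mulrCA. Qed.

Lemma dotvC xi x : dotv xi x = dotv x xi.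
Proof. by apply: eq_bigr => i _; rewrite mulrC. Qed.

Lemma dotvN xi x : dotv xi (- x) = - dotv xi x.
Proof. by rewrite -scaleN1r dotvZ mulN1r. Qed.

Lemma dotv_basis xi i : dotv xi (basis_vec i) = xi 0 i.
Proof.
rewrite /dotv (bigD1 i)//= big1 ?addr0.
  by rewrite mxE !eqxx mulr1.
by move=> j ji; rewrite mxE (negbTE ji) andbF mulr0.
Qed.

Lemma continuous_dotv2 : continuous (fun p : 'rV[R]_d * 'rV[R]_d => dotv p.1 p.2).
Proof.
apply: continuous_bigsum => i; apply: continuous_mul.
  apply: continuous_compE (continuous_coord i) _ => p; exact: cvg_fst.
apply: continuous_compE (continuous_coord i) _ => p; exact: cvg_snd.
Qed.

End dot_product.

(** * Differentiation under the spherical functional *)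

Section regularity.
Context {R : realType}.

Lemma Cn_continuous k (g : R -> R) : Cn_real k g -> continuous g.
Proof.
case: k => [//|k [dg _]] x; apply: differentiable_continuous.
by apply/derivable1_diffP; exact: dg.
Qed.

Lemma Cn_scale k (c : R) (g : R -> R) : Cn_real k g -> Cn_real k (fun x => c * g x).
Proof.
elim: k g => [g cg|k IH g [dg Cg]]; first exact: continuous_scale.
have dE (x : R) : is_derive x 1 (fun x => c * g x) (c * derive1 g x).
  by apply: is_derive_scale; apply: DeriveDef => //; rewrite derive1E.
split; first by move=> x; case: (dE x).
have -> : derive1 (fun x => c * g x) = fun x => c * derive1 g x.
  by apply/funext => x; rewrite derive1E; case: (dE x).
exact: IH.
Qed.

Lemma Cn_of_derive k (g dg : R -> R) : (forall x : R, is_derive x 1 g (dg x)) ->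
  Cn_real k dg -> Cn_real k.+1 g.
Proof.
move=> d Cd; split; first by move=> x; case: (d x).
by have -> : derive1 g = dg by apply/funext => x; rewrite derive1E; case: (d x).
Qed.

Lemma is_derive_line (V : normedModType R) (G : V -> R) (x v : V) (l : R) :
  is_derive (0 : R) 1 (fun t => G (x + t *: v)) l -> is_derive x v G l.
Proof.
case=> [dG eG].
have e : (fun h : R => h^-1 *: ((G \o shift x) (h *: v) - G x)) =
   (fun h : R => h^-1 *: (((fun t => G (x + t *: v)) \o shift 0) (h *: (1 : R))
      - (fun t => G (x + t *: v)) 0)).
  apply/funext => h /=; rewrite scale0r !addr0.
  have -> : h *: (1 : R) = h by rewrite /GRing.scale /= mulr1.
  by rewrite (addrC x).
apply: DeriveDef; first by rewrite /derivable e.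
by rewrite -eG /derive e.
Qed.

Variables (d : nat) (E : ('rV[R]_d -> R) -> R).
Hypothesis E_pos : pos_functional (unit_box d) E.

(** The weight [P] makes the class closed under partial derivatives: each one multiplies [P] by a
    coordinate of [xi] and replaces [g] by its derivative. *)
Definition zonal (P : 'rV[R]_d -> R) (g : R -> R) (x : 'rV[R]_d) : R :=
  E (fun xi => P xi * g (dotv xi x)).

Lemma continuous_zonal P g : continuous P -> continuous g -> continuous (zonal P g).
Proof.
move=> cP cg.
apply: (pos_functional_continuous _ _ E_pos 'rV[R]_d (fun x xi => P xi * g (dotv xi x))).
  exact: unit_box_compact.
apply: continuous_mul.
  by apply: continuous_compE cP _ => p; exact: cvg_snd.
apply: (continuous_compE _ _ cg).
by under eq_fun do rewrite dotvC; exact: continuous_dotv2.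
Qed.

Lemma zonal_derive P g dg x v : continuous P -> continuous dg ->
  (forall t : R, is_derive t 1 g (dg t)) ->
  is_derive x v (zonal P g) (zonal (fun xi => P xi * dotv xi v) dg x).
Proof.
move=> cP cdg gd; have cg := is_derive_continuous _ _ gd.
apply: is_derive_line.
have e : (fun t => zonal P g (x + t *: v)) =
    fun t => E (fun xi => P xi * g (dotv xi x + dotv xi v * t)).
  apply/funext => t; congr E; apply/funext => xi.
  by rewrite dotvD dotvZ (mulrC t).
rewrite e.
have -> : zonal (fun xi => P xi * dotv xi v) dg x =
    E (fun xi => P xi * (dotv xi v * dg (dotv xi x + dotv xi v * 0))).
  by congr E; apply/funext => xi; rewrite mulr0 addr0 mulrA.
apply: (pos_functional_derive _ _ E_pos (fun t xi => P xi * g (dotv xi x + dotv xi v * t))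
  (fun t xi => P xi * (dotv xi v * dg (dotv xi x + dotv xi v * t)))).
- exact: unit_box_compact.
- move=> t; apply: continuous_mul => //; apply: (continuous_compE _ _ cg).
  apply: continuous_add; first exact: continuous_dotv.
  by apply: continuous_mul; [exact: continuous_dotv|exact: cst_continuous].
- have c2 (w : 'rV[R]_d -> R) : continuous w -> continuous (fun p : R * 'rV[R]_d => w p.2).
    by move=> cw; apply: continuous_compE cw _ => p; exact: cvg_snd.
  apply: continuous_mul; first exact: c2.
  apply: continuous_mul; first exact: c2 (continuous_dotv v).
  apply: (continuous_compE _ _ cdg); apply: continuous_add; first exact: c2 (continuous_dotv x).
  apply: continuous_mul; first exact: c2 (continuous_dotv v).
  by move=> p; exact: cvg_fst.
- move=> t xi; apply: is_derive_scale; exact: is_derive_shift_scale.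
Qed.

Lemma partial_zonal P g dg i : continuous P -> continuous dg ->
  (forall t : R, is_derive t 1 g (dg t)) ->
  partial i (zonal P g) = zonal (fun xi => P xi * xi 0 i) dg.
Proof.
move=> cP cdg gd; apply/funext => x.
have := zonal_derive P g dg x (basis_vec i) cP cdg gd.
by rewrite /partial => -[_ ->]; congr E; apply/funext => xi; rewrite dotv_basis.
Qed.

Lemma Ck_zonal k P g : continuous P -> Cn_real k g -> Ck_vec k (zonal P g).
Proof.
elim: k P g => [|k IH] P g cP Cg; first exact: continuous_zonal.
case: Cg => dg Cg.
have gd (t : R) : is_derive t 1 g (derive1 g t).
  by apply: DeriveDef => //; rewrite derive1E.
have cdg := Cn_continuous _ _ Cg.
split => i.
  by move=> x; case: (zonal_derive P g (derive1 g) x (basis_vec i) cP cdg gd).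
rewrite (partial_zonal _ _ _ i cP cdg gd); apply: IH => //.
by apply: continuous_mul => //; exact: continuous_coord.
Qed.

End regularity.

(** * The normalized spherical average and its second moment *)

Section latitude_integrals.
Context {R : realType}.
Notation mu := (@lebesgue_measure R).

Lemma Rintegral_even (g : R -> R) (a : R) : 0 <= a -> continuous g ->
  (forall t, g (- t) = g t) ->
  \int[mu]_(t in `[- a, a]) g t = 2 * \int[mu]_(t in `[0, a]) g t.
Proof.
move=> a0 cg geven.
have Na0 : - a <= 0 by rewrite oppr_le0.
have ig := integrable_segment g (- a) a cg.
have := @Rintegral_itvB R g (BLeft (- a)) (BRight a) 0 ig.
rewrite !bnd_simp => /(_ Na0 a0).
rewrite Rintegral_itv_obnd_cbnd; last first.
  apply: integrableS (integrable_segment g 0 a cg) => //.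
  by apply: subset_itvr; rewrite bnd_simp.
have -> : \int[mu]_(t in `[- a, 0]) g t = \int[mu]_(t in `[0, a]) g t.
  rewrite /Rintegral; congr fine.
  have := @integration_by_substitution_oppr R g 0 a a0.
  rewrite oppr0 => ->; last exact: continuous_subspaceT.
  by apply: eq_integral => t _; rewrite /= geven.
by move=> h; rewrite mulr2n mulrDl mul1r -[X in _ = _ + X]h; ring.
Qed.

Lemma cos_int_even m (g : R -> R) : continuous g -> (forall t, g (- t) = g t) ->
  cos_int m g = 2 * \int[mu]_(t in `[0, pi / 2]) (g t * cos t ^+ m).
Proof.
move=> cg geven; apply: (Rintegral_even (fun t => g t * cos t ^+ m)).
- by rewrite divr_ge0 ?pi_ge0.
- by apply: continuous_mul => //; exact: continuous_cosX.
- by move=> t; rewrite cosN geven.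
Qed.

Lemma I_op_cos_int d (g : R -> R) (s : R) : (2 <= d)%N -> continuous g ->
  (forall t, g (- t) = g t) -> (forall t, g t <= 0) ->
  I_op d g s = c_const d / 2 * cos_int (d - 2) (fun t => g (s * sin t)).
Proof.
move=> d2 cg geven g0.
have cgs : continuous (fun t => g (s * t)).
  by apply: (continuous_compE _ _ cg); apply: continuous_scale; exact: continuous_idE.
have cgN : continuous (fun t => - g (s * t)) by exact: continuous_opp.
have gN0 t : 0 <= - g (s * t) by rewrite oppr_ge0.
have := latitude_substitution d (fun t => - g (s * t)) d2 cgN gN0.
(* [latitude_substitution] wants a nonnegative function, so it is applied to [- g]; the sign is then
   pulled out of both integrals by the rule for nonnegative integrands. *)
have neg (D : set R) (h w : R -> R) : (forall t, D t -> 0 <= w t) -> (forall t, h t <= 0) ->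
    \int[mu]_(t in D) (- h t * w t) = - \int[mu]_(t in D) (h t * w t).
  move=> w0 h0; have hw t : D t -> (0 <= (- h t * w t)%:E)%E.
    by move=> Dt; rewrite lee_fin mulr_ge0 ?oppr_ge0 ?w0.
  have e := integral_ge0N mu hw.
  have e3 : (\int[mu]_(t in D) - (- h t * w t)%R%:E = \int[mu]_(t in D) (h t * w t)%R%:E)%E.
    by apply: eq_integral => t _; rewrite -EFinN mulNr opprK.
  by rewrite e3 in e; rewrite /Rintegral e fineN opprK.
rewrite !neg//; last 2 first.
- move=> t; rewrite /= in_itv/= => /andP[t0 t1]; rewrite exprn_ge0// cos_ge0_pihalf//.
  by rewrite t1 andbT (le_trans _ t0)// oppr_le0 divr_ge0 ?pi_ge0.
- by move=> t _; exact: powR_ge0.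
move=> /oppr_inj e.
rewrite cos_int_even; last 2 first.
- by apply: (continuous_compE _ (fun t => sin t) cgs); exact: continuous_sin.
- by move=> t; rewrite sinN mulrN geven.
rewrite mulrA divfK// -e /I_op; congr (_ * _).
by apply: eq_Rintegral => t _; rewrite (mulrC t).
Qed.

(** Multiplied by [c_d / 2] this is [c_d / (d - 1) = C_d], the coefficient of the norm in the
    decomposition of [Phi]. *)
Lemma cos_int_abs_sin m : cos_int m (fun t => `|sin t|) = 2 / m.+1%:R :> R.
Proof.
have cs : continuous (fun t : R => `|sin t|) by apply: continuous_norm; exact: continuous_sin.
rewrite cos_int_even//; last by move=> t; rewrite sinN normrN.
congr (_ * _).
have p0 : 0 <= pi / 2 :> R by rewrite divr_ge0 ?pi_ge0.
have d (t : R) : is_derive t 1 (fun t : R => - m.+1%:R^-1 * cos t ^+ m.+1) (sin t ^+ 1 * cos t ^+ m).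
  have := is_derive_scale (- m.+1%:R^-1) (is_derive_pow m (is_derive_cos t)).
  congr (is_derive _ _ _ _); rewrite expr1.
  by field; rewrite nat1r pnatr_eq0.
transitivity (\int[mu]_(t in `[0, pi / 2]) (sin t ^+ 1 * cos t ^+ m)).
  apply: eq_Rintegral => t /set_mem; rewrite /= in_itv/= => /andP[t0 t1].
  rewrite ger0_norm ?expr1// sin_ge0_pi// t0 (le_trans t1)//.
  by rewrite ler_pdivrMr// ler_peMr ?pi_ge0// ler1n.
rewrite (ftc _ _ _ _ p0 (continuous_sincosX 1 m) d) cos_pihalf cos0 expr1n expr0n.
by rewrite mulr0 mulr1 sub0r opprK.
Qed.

Lemma wallis0_gt0 m : 0 < wallis 0 m :> R.
Proof.
suff : 0 < wallis 0 m :> R /\ 0 < wallis 0 m.+1 :> R by case.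
elim: m => [|m [IH0 IH1]]; last first.
  by split => //; rewrite wallis_cos2 mulr_gt0// divr_gt0.
split.
  have d (t : R) : is_derive t 1 (fun t => t) (sin t ^+ 0 * cos t ^+ 0).
    by rewrite !expr0 mulr1; exact: is_derive_idE.
  rewrite /wallis (ftc _ _ _ _ half_pi_le (continuous_sincosX 0 0) d).
  have := @pi_gt0 R; lra.
have d (t : R) : is_derive t 1 (fun t : R => sin t) (sin t ^+ 0 * cos t ^+ 1).
  by rewrite expr0 mul1r expr1; exact: is_derive_sin.
rewrite /wallis (ftc _ _ _ _ half_pi_le (continuous_sincosX 0 1) d) sinN sin_pihalf.
lra.
Qed.

Lemma sphere_int1_gt0 m : 0 < sphere_int m (fun=> 1) :> R.
Proof.
elim: m => [|m IH]; first by rewrite /=; lra.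
rewrite /= (pos_functional_cst _ _ (cos_int_pos m)) mulr_gt0//.
have -> : cos_int m (fun=> 1) = wallis 0 m :> R.
  by apply: eq_Rintegral => t _; rewrite expr0.
exact: wallis0_gt0.
Qed.

(* The multiple of the spherical integral on [R^(m+2)] that turns [f] into
   the dimension walk [I_op m.+2 f]. *)
Definition sphere_avg m (h : 'rV[R]_m.+2 -> R) : R :=
  c_const m.+2 / 2 / sphere_int m (fun=> 1) * sphere_int m.+1 h.

Lemma sphere_avg_pos m : pos_functional (unit_box m.+2) (@sphere_avg m).
Proof.
have c0 : 0 <= c_const m.+2 / 2 / sphere_int m (fun=> 1) :> R.
  have c1 : 0 < c_const m.+2 :> R by exact: c_const_gt0.
  by apply: divr_ge0 (ltW (sphere_int1_gt0 m)); apply: divr_ge0 => //; exact: ltW.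
apply: (pos_functional_comp _ _ _ (fun x => x) _ (sphere_int_pos m.+1)) => //.
by move=> x; exact: cvg_id.
Qed.

Lemma sphere_avg_zonal m (h : R -> R) (x : 'rV[R]_m.+2) :
  continuous h -> (forall A, poly_approx A h) ->
  sphere_avg m (fun xi => h (dotv xi x)) =
  c_const m.+2 / 2 * cos_int m (fun t => h (enorm x * sin t)).
Proof.
move=> ch ah; rewrite /sphere_avg sphere_int_zonal// mulrA divfK//.
by rewrite gt_eqF// sphere_int1_gt0.
Qed.

(** Equal to [c_d int_0^1 t^2 (1 - t^2)^((d-3)/2) dt] after [t = sin theta], with [d = m + 2]. *)
Definition second_moment m : R := c_const m.+2 / 2 * wallis 2 m.

Lemma sphere_avg_sqr m (x : 'rV[R]_m.+2) :
  sphere_avg m (fun xi => dotv xi x ^+ 2) = second_moment m * enorm x ^+ 2.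
Proof.
have c2 : continuous (fun t : R => t ^+ 2) by apply: continuous_pow; exact: continuous_idE.
rewrite (sphere_avg_zonal m (fun t => t ^+ 2)) //.
  rewrite /second_moment -[RHS]mulrA; congr (_ * _).
  transitivity (enorm x ^+ 2 * cos_int m (fun t : R => sin t ^+ 2)); last exact: mulrC.
  rewrite -(pos_functionalZ _ _ (cos_int_pos m)); last exact: continuous_sinX.
  by congr cos_int; apply/funext => t; rewrite exprMn.
move=> A; have -> : (fun t : R => t ^+ 2) = horner 'X^2.
  by apply/funext => t; rewrite hornerXn.
exact: poly_approx_poly.
Qed.

Lemma second_moment_le m : second_moment m <= Num.sqrt m.+2%:R.
Proof.
apply: le_trans (C_const_le_sqrt m.+2 isT); rewrite C_constE// /second_moment -mulrA.
rewrite ler_pM2l ?c_const_gt0//.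
have -> : m.+2%:R - 1 = m.+1%:R :> R by rewrite -natr1 addrK.
have e : 2^-1 * (2 / m.+1%:R) = m.+1%:R^-1 :> R by rewrite mulrA mulVf// mul1r.
rewrite -e ler_pM2l ?invr_gt0// -cos_int_abs_sin.
apply: (le_pos_functional _ _ (cos_int_pos m)).
- exact: continuous_sinX.
- by apply: continuous_norm; exact: continuous_sin.
move=> t _; rewrite -real_normK ?num_real// expr2 ler_piMr//; exact: sin_max.
Qed.

End latitude_integrals.

Section euclidean.
Context {R : realType} {d : nat}.
Implicit Types x y : 'rV[R]_d.

Lemma enormN x : enorm (- x) = enorm x.
Proof. by rewrite /enorm; congr Num.sqrt; apply: eq_bigr => i _; rewrite mxE sqrrN. Qed.

End euclidean.

(** * The claims on [Phi], integrated from dimension one *)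

Section walk.
Context {R : realType}.
Notation mu := (@lebesgue_measure R).
Variables (u : R -> R) (r : R).
Hypotheses (r_gt0 : 0 < r) (u_cont : continuous u)
  (u_supp : forall x, r <= `|x| -> u x = 0).
Hypotheses (u_ge0 : forall x, 0 <= u x) (u_even : forall x, u (- x) = u x)
  (u_int1 : (\int[mu]_x (u x)%:E = 1)%E).
Hypotheses (cos_ge0 : forall a, 0 <= cos_transform u r a)
  (sin0 : forall a, sin_transform u r a = 0).

Let f := neg_abs_conv u.
Let df := neg_abs_conv_deriv u.
Let B := supnorm u.

Let f_derive (x : R) : is_derive x 1 f (df x).
Proof. exact: (neg_abs_conv_derive u r). Qed.

Let df_derive (x : R) : is_derive x 1 df (- 2 * u x).
Proof. exact: (neg_abs_conv_derive2 u r). Qed.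

Let f_cont : continuous f. Proof. exact: is_derive_continuous f_derive. Qed.
Let df_cont : continuous df. Proof. exact: is_derive_continuous df_derive. Qed.

Let f_even x : f (- x) = f x. Proof. exact: (neg_abs_conv_even u r). Qed.

Let f_le x : f x <= f 0. Proof. exact: (neg_abs_conv_le0 u r). Qed.
Let f0_lt0 : f 0 < 0. Proof. exact: (neg_abs_conv_lt0 u r). Qed.
Let f_le0 x : f x <= 0. Proof. by rewrite (le_trans (f_le x))// ltW. Qed.

Let u_le x : u x <= B. Proof. exact: (le_supnorm u r). Qed.
Let B_ge0 : 0 <= B. Proof. exact: le_trans (u_ge0 0) (u_le 0). Qed.

Lemma poly_approx_neg_abs_conv A : poly_approx A f.
Proof.
apply: poly_approx_uniform => e e0.
have A0 : 0 < `|A| + 1 by rewrite ltr_wpDl.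
have [N [g [a [_ hg]]]] := neg_abs_conv_cos_kernel u r r_gt0 u_cont u_supp u_ge0
  u_even u_int1 cos_ge0 sin0 (`|A| + 1) e A0 e0.
exists (fun x => f 0 + \sum_(j < N) \sum_(k < N) g j k * cos_kernel (a j k) x).
  apply: poly_approxD.
    have -> : (fun _ : R => f 0) = horner (f 0)%:P by apply/funext => z; rewrite hornerC.
    exact: poly_approx_poly.
  apply: poly_approx_sum => j; apply: poly_approx_sum => k.
  exact/poly_approxZ/poly_approx_cos_kernel.
by move=> z zA; apply: hg; rewrite (le_trans zA)// (le_trans (ler_norm A))// lerDl.
Qed.

(** The constant [f 0] drops out as the weights sum to 0, and each cosine kernel contributes a
    nonnegative amount. Replacing [f] by its approximation costs at most [P] times the uniform
    error, hence less than any [e]. *)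
Lemma neg_abs_conv_conditionally_positive N (p z : 'I_N -> R) : \sum_j p j = 0 ->
  0 <= \sum_j \sum_k p j * p k * f (z j - z k).
Proof.
move=> p0.
pose P := \sum_j \sum_k `|p j * p k|.
have P0 : 0 <= P by apply: sumr_ge0 => j _; apply: sumr_ge0.
rewrite -oppr_le0; apply/ler_addgt0Pl => e e0; rewrite addr0.
(* The sum is taken twice so that [A] bounds every difference [z j - z k]. *)
pose A := 1 + \sum_j `|z j| + \sum_j `|z j|.
have S0 : 0 <= \sum_j `|z j| by apply: sumr_ge0.
have A0 : 0 < A by rewrite /A; lra.
have P1 : 0 < P + 1 by lra.
have [M [g [a [g0 hg]]]] := neg_abs_conv_cos_kernel u r r_gt0 u_cont u_supp u_ge0
  u_even u_int1 cos_ge0 sin0 A (e / (P + 1)) A0 (divr_gt0 e0 P1).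
pose K x := f 0 + \sum_(j < M) \sum_(k < M) g j k * cos_kernel (a j k) x.
have zA j k : `|z j - z k| <= A.
  have zj i : `|z i| <= \sum_j `|z j|.
    by rewrite (bigD1 i)//= lerDl; apply: sumr_ge0.
  by rewrite (le_trans (ler_normB _ _))// /A; have := zj j; have := zj k; lra.
have KS : 0 <= \sum_j \sum_k p j * p k * K (z j - z k).
  have -> : \sum_j \sum_k p j * p k * K (z j - z k) =
      f 0 * ((\sum_j p j) * (\sum_j p j)) + \sum_(i < M) \sum_(l < M)
        g i l * \sum_j \sum_k p j * p k * cos_kernel (a i l) (z j - z k).
    have sw : \sum_(i < M) \sum_(l < M) g i l * (\sum_j \sum_k p j * p k * cos_kernel (a i l) (z j - z k)) =
        \sum_j \sum_k p j * p k * \sum_(i < M) \sum_(l < M) g i l * cos_kernel (a i l) (z j - z k).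
      transitivity (\sum_(i < M) \sum_j \sum_k \sum_(l < M)
          p j * p k * (g i l * cos_kernel (a i l) (z j - z k))).
        apply: eq_bigr => i _.
        transitivity (\sum_(l < M) \sum_j \sum_k p j * p k * (g i l * cos_kernel (a i l) (z j - z k))).
          apply: eq_bigr => l _; rewrite mulr_sumr; apply: eq_bigr => j _.
          by rewrite mulr_sumr; apply: eq_bigr => k _; rewrite mulrCA.
        by rewrite exchange_big /=; apply: eq_bigr => j _; exact: exchange_big.
      rewrite exchange_big /=; apply: eq_bigr => j _.
      rewrite exchange_big /=; apply: eq_bigr => k _.
      by rewrite mulr_sumr; apply: eq_bigr => i _; rewrite mulr_sumr.
    rewrite sw big_distrl mulr_sumr -big_split /=; apply: eq_bigr => j _.
    rewrite big_distrr /= mulr_sumr -big_split /=; apply: eq_bigr => k _.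
    by rewrite /K; ring.
  rewrite p0 mul0r mulr0 add0r; apply: sumr_ge0 => i _; apply: sumr_ge0 => l _.
  by rewrite mulr_ge0// sum_cos_kernel_ge0.
have : \sum_j \sum_k p j * p k * K (z j - z k) - \sum_j \sum_k p j * p k * f (z j - z k)
    <= P * (e / (P + 1)).
  rewrite /P mulr_suml -sumrB; apply: ler_sum => j _.
  rewrite mulr_suml -sumrB; apply: ler_sum => k _.
  rewrite -mulrBr (le_trans (ler_norm _))// normrM ler_wpM2l//.
  by rewrite distrC; exact: hg.
have : P * (e / (P + 1)) <= e.
  by rewrite mulrCA ler_piMr ?(ltW e0)// ler_pdivrMr// mul1r lerDl.
lra.
Qed.

Lemma neg_abs_conv_concave (l a b : R) : 0 <= l <= 1 ->
  l * f a + (1 - l) * f b <= f (l * a + (1 - l) * b).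
Proof.
move=> l01.
have d1 (x : R) : is_derive x 1 (fun x => - f x) (- df x) := is_derive_opp (f_derive x).
have d2 (x : R) : is_derive x 1 (fun x => - df x) (2 * u x).
  by have := is_derive_opp (df_derive x); rewrite mulNr opprK.
have := convex_ge0_derive2 _ _ _ l a b d1 d2 (fun x => mulr_ge0 (ler0n _ 2) (u_ge0 x)) l01.
lra.
Qed.

(** The function [f + B z^2] is convex because [f'' = - 2 u >= - 2 B]; the defect of [z^2] is
    exactly [l (1 - l) (a - b)^2]. *)
Lemma neg_abs_conv_semiconvex (l a b : R) : 0 <= l <= 1 ->
  f (l * a + (1 - l) * b) <=
  l * f a + (1 - l) * f b + B * l * (1 - l) * (a - b) ^+ 2.
Proof.
move=> l01.
have d1 (x : R) : is_derive x 1 (fun x => f x + B * x ^+ 2) (df x + 2 * B * x).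
  have := is_derive_add (f_derive x) (is_derive_scale B (is_derive_pow 1 (is_derive_idE x))).
  by congr is_derive; rewrite expr1; ring.
have d2 (x : R) : is_derive x 1 (fun x => df x + 2 * B * x) (2 * (B - u x)).
  have := is_derive_add (df_derive x) (is_derive_scale (2 * B) (is_derive_idE x)).
  by congr is_derive; ring.
have h x : 0 <= 2 * (B - u x) by rewrite mulr_ge0// subr_ge0.
have := convex_ge0_derive2 _ _ _ l a b d1 d2 h l01.
set c := l * a + (1 - l) * b => H.
have -> : f c = f c + B * c ^+ 2 - B * c ^+ 2 by ring.
rewrite lerBlDr (le_trans H)// le_eqVlt; apply/orP; left; apply/eqP.
by rewrite /c; ring.
Qed.

Lemma neg_abs_conv_deriv_lipschitz (a b : R) : `|df a - df b| <= 2 * B * `|a - b|.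
Proof.
wlog ab : a b / b <= a.
  move=> H; case: (leP b a) => [/H//|/ltW /H].
  by rewrite distrC (distrC b).
have [c _ ->] := mvt_all _ _ _ _ df_derive ab.
by rewrite normrM mulNr normrN normrM (ger0_norm (ler0n _ 2)) (ger0_norm (u_ge0 c)) ler_wpM2r// ler_pM2l.
Qed.

Variable m : nat.
Let d := m.+2.
Let E : ('rV[R]_d -> R) -> R := @sphere_avg R m.
Let Phi := fun x : 'rV[R]_d => I_op d f (enorm x).
Let E_pos : pos_functional (unit_box d) E := sphere_avg_pos m.

Let Phi_cos_int s : I_op d f s = c_const d / 2 * cos_int m (fun t => f (s * sin t)).
Proof. by rewrite I_op_cos_int//; congr (_ * cos_int _ _); rewrite subSS subSS subn0. Qed.

Lemma Phi_zonal : Phi = zonal d E (fun=> 1) f.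
Proof.
apply/funext => x; rewrite /Phi Phi_cos_int -sphere_avg_zonal//.
  by congr (sphere_avg m _); apply/funext => xi; rewrite mul1r.
exact: poly_approx_neg_abs_conv.
Qed.

Let PhiE x : Phi x = E (fun xi => f (dotv xi x)).
Proof. by rewrite Phi_zonal; congr E; apply/funext => xi; rewrite mul1r. Qed.

Let c_dot (g : R -> R) (x : 'rV[R]_d) : continuous g -> continuous (fun xi => g (dotv xi x)).
Proof. by move=> cg; apply: (continuous_compE _ _ cg); exact: continuous_dotv. Qed.

Lemma Phi_CP1 : CP1 Phi.
Proof.
apply: CP1_real.
- by rewrite Phi_zonal; apply: (continuous_zonal _ _ E_pos) => //; exact: cst_continuous.
- by move=> x; rewrite /Phi enormN.
move=> N x p p0.
have cS (j k : 'I_N) : continuous (fun xi => p j * p k * f (dotv xi (x j - x k))).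
  by apply: continuous_scale; exact: c_dot.
have -> : \sum_j \sum_k p j * p k * Phi (x j - x k) =
    E (fun xi => \sum_j \sum_k p j * p k * f (dotv xi (x j - x k))).
  rewrite (pos_functional_sum _ _ E_pos); last first.
    by move=> j; apply: continuous_bigsum => k; exact: cS.
  apply: eq_bigr => j _; rewrite (pos_functional_sum _ _ E_pos); last by move=> k; exact: cS.
  by apply: eq_bigr => k _; rewrite PhiE -(pos_functionalZ _ _ E_pos)//; exact: c_dot.
apply: E_pos.2.
  by apply: continuous_bigsum => j; apply: continuous_bigsum => k; exact: cS.
move=> xi _.
under eq_bigr do under eq_bigr do rewrite dotvD dotvN.
exact: (neg_abs_conv_conditionally_positive N p (fun j => dotv xi (x j))).
Qed.

Let c_gt0 : 0 < c_const d / 2 :> R.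
Proof. by apply: divr_gt0 => //; exact: c_const_gt0. Qed.

Let c_fs s : continuous (fun t => f (s * sin t)).
Proof.
by apply: (continuous_compE _ _ f_cont); apply: continuous_scale; exact: continuous_sin.
Qed.

Lemma Phi_lt0 x : Phi x < 0.
Proof.
rewrite /Phi Phi_cos_int pmulr_rlt0//.
apply: (@le_lt_trans _ _ (cos_int m (fun=> f 0))).
  apply: (le_pos_functional _ _ (cos_int_pos m)) => //.
  exact: cst_continuous.
rewrite (pos_functional_cst _ _ (cos_int_pos m)) pmulr_llt0//.
have -> : cos_int m (fun=> 1) = wallis 0 m :> R.
  by apply: eq_Rintegral => t _; rewrite expr0.
exact: wallis0_gt0.
Qed.

Lemma Phi_Ck n : Cn_real n u -> Ck_vec (n + 2) Phi.
Proof.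
move=> Cu; rewrite Phi_zonal addn2; apply: (Ck_zonal _ _ E_pos).
  exact: cst_continuous.
apply: Cn_of_derive f_derive _; apply: Cn_of_derive df_derive _.
exact: Cn_scale.
Qed.

Lemma Phi_concave : concave_fun Phi.
Proof.
move=> l x y l01; rewrite !PhiE.
rewrite -!(pos_functionalZ _ _ E_pos); [|exact: c_dot..].
rewrite -(pos_functionalD _ _ E_pos); last 2 first.
- by apply: continuous_scale; exact: c_dot.
- by apply: continuous_scale; exact: c_dot.
apply: (le_pos_functional _ _ E_pos).
- by apply: continuous_add; apply: continuous_scale; exact: c_dot.
- exact: c_dot.
by move=> xi _; rewrite dotvD !dotvZ; exact: neg_abs_conv_concave.
Qed.

Let L := 2 * Num.sqrt d%:R * B.

Let second_moment_L : 2 * B * second_moment m <= L.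
Proof.
rewrite /L -!mulrA ler_pM2l// mulrC ler_wpM2r//; exact: second_moment_le.
Qed.

Lemma Phi_semiconvex (l : R) x y : 0 <= l <= 1 ->
  Phi (l *: x + (1 - l) *: y) <=
  l * Phi x + (1 - l) * Phi y + L / 2 * l * (1 - l) * enorm (x - y) ^+ 2.
Proof.
move=> l01; have /andP[l0 l1] := l01.
have csq : continuous (fun xi : 'rV[R]_d => dotv xi (x - y) ^+ 2).
  by apply: continuous_pow; exact: continuous_dotv.
apply: (@le_trans _ _ (l * Phi x + (1 - l) * Phi y +
    B * l * (1 - l) * E (fun xi => dotv xi (x - y) ^+ 2))).
  rewrite !PhiE -!(pos_functionalZ _ _ E_pos) //; [|exact: c_dot..].
  have cx : continuous (fun xi => l * f (dotv xi x)) by apply: continuous_scale; exact: c_dot.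
  have cy : continuous (fun xi => (1 - l) * f (dotv xi y)) by apply: continuous_scale; exact: c_dot.
  have cz : continuous (fun xi : 'rV[R]_d => B * l * (1 - l) * dotv xi (x - y) ^+ 2).
    exact: continuous_scale.
  rewrite -(pos_functionalD _ _ E_pos)// -(pos_functionalD _ _ E_pos)//; last exact: continuous_add.
  apply: (le_pos_functional _ _ E_pos).
  - exact: c_dot.
  - by apply: continuous_add => //; exact: continuous_add.
  by move=> xi _; rewrite !dotvD dotvN !dotvZ; exact: neg_abs_conv_semiconvex.
rewrite lerD2l /E sphere_avg_sqr mulrA ler_wpM2r ?sqr_ge0//.
have -> : B * l * (1 - l) * second_moment m = (2 * B * second_moment m) / 2 * (l * (1 - l)) by field.
rewrite -(mulrA (L / 2)) ler_wpM2r ?mulr_ge0 ?subr_ge0//.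
by rewrite ler_pM2r ?invr_gt0.
Qed.

Lemma Phi_grad x i : grad Phi x 0 i = E (fun xi => xi 0 i * df (dotv xi x)).
Proof.
rewrite mxE Phi_zonal (partial_zonal _ _ E_pos _ f df i (@cst_continuous _ _ (1 : R)) df_cont f_derive).
by congr E; apply/funext => xi; rewrite mul1r.
Qed.

(** Testing the gradient difference [D] against itself gives [|D|^2] as an average of [<xi, D>]
    times a difference of [f'], hence at most [2 B] times the average of [|<xi, D>| |<xi, x - y>|].
    A Cauchy-Schwarz step reduces this to second moments, and one factor [|D|] is divided out. *)
Lemma Phi_grad_lipschitz x y :
  enorm (grad Phi x - grad Phi y) <= L * enorm (x - y).
Proof.
set D := grad Phi x - grad Phi y.
have cdiff : continuous (fun xi => df (dotv xi x) - df (dotv xi y)).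
  by apply: continuous_sub; exact: c_dot.
have key : enorm D ^+ 2 = E (fun xi => dotv xi D * (df (dotv xi x) - df (dotv xi y))).
  have -> : (fun xi => dotv xi D * (df (dotv xi x) - df (dotv xi y))) =
     (fun xi => \sum_i D 0 i * (xi 0 i * df (dotv xi x) - xi 0 i * df (dotv xi y))).
    by apply/funext => xi; rewrite /dotv mulr_suml; apply: eq_bigr => i _; ring.
  have c1 i z : continuous (fun xi : 'rV[R]_d => xi 0 i * df (dotv xi z)).
    by apply: continuous_mul; [exact: continuous_coord|exact: c_dot].
  rewrite (pos_functional_sum _ _ E_pos); last first.
    by move=> i; apply: continuous_scale; exact: continuous_sub.
  rewrite enorm_sqr; apply: eq_bigr => i _.
  rewrite (pos_functionalZ _ _ E_pos); last exact: continuous_sub.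
  rewrite (pos_functionalB _ _ E_pos)// -!Phi_grad expr2; congr (_ * _).
  by rewrite /D [LHS]mxE [X in _ + X]mxE.
have [z0|z0] := eqVneq (enorm (x - y)) 0.
  have xy : x = y.
    apply/eqP; rewrite -subr_eq0; apply/eqP/rowP => i; rewrite [RHS]mxE.
    have : sqnorm (x - y) = 0 by rewrite -enorm_sqr z0 expr0n.
    move/eqP; rewrite psumr_eq0; last by move=> j _; exact: sqr_ge0.
    by move=> /allP/(_ i (mem_index_enum _)); rewrite sqrf_eq0 => /eqP.
  rewrite z0 mulr0 /D xy subrr /enorm big1 ?sqrtr0// => i _.
  by rewrite mxE expr0n.
have zp : 0 < enorm (x - y) by rewrite lt0r z0 enorm_ge0.
have [D0|D0] := eqVneq (enorm D) 0.
  by rewrite D0 mulr_ge0 ?enorm_ge0// /L !mulr_ge0// sqrtr_ge0.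
have Dp : 0 < enorm D by rewrite lt0r D0 enorm_ge0.
(* This weight balances the two terms of [2 |s| |w| <= q s^2 + w^2 / q] once averaged, so nothing is
   lost against Cauchy-Schwarz. *)
pose q := enorm (x - y) / enorm D; have q0 : 0 < q by rewrite divr_gt0.
have cD (z : 'rV[R]_d) : continuous (fun xi : 'rV[R]_d => dotv xi z ^+ 2).
  by apply: continuous_pow; exact: continuous_dotv.
have bound : enorm D ^+ 2 <= B * q * E (fun xi => dotv xi D ^+ 2) +
    B / q * E (fun xi => dotv xi (x - y) ^+ 2).
  rewrite key -!(pos_functionalZ _ _ E_pos)//.
  rewrite -(pos_functionalD _ _ E_pos); [|exact: continuous_scale..].
  apply: (le_pos_functional _ _ E_pos).
  - by apply: continuous_mul => //; exact: continuous_dotv.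
  - by apply: continuous_add; exact: continuous_scale.
  move=> xi _; set s := dotv xi D; set w := dotv xi (x - y).
  apply: (le_trans (ler_norm _)); rewrite normrM.
  apply: (le_trans (ler_wpM2l (normr_ge0 _) (neg_abs_conv_deriv_lipschitz _ _))).
  have -> : dotv xi x - dotv xi y = w by rewrite /w dotvD dotvN.
  rewrite -(real_normK (num_real s)) -(real_normK (num_real w)).
  set s' := `|s|; set w' := `|w|.
  rewrite -subr_ge0.
  have -> : B * q * s' ^+ 2 + B / q * w' ^+ 2 - s' * (2 * B * w') = B / q * (q * s' - w') ^+ 2.
    by field; rewrite gt_eqF.
  by rewrite mulr_ge0 ?sqr_ge0// divr_ge0// ltW.
rewrite /E !sphere_avg_sqr in bound.
have e : B * q * (second_moment m * enorm D ^+ 2) + B / q * (second_moment m * enorm (x - y) ^+ 2)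
    = 2 * B * second_moment m * enorm (x - y) * enorm D.
  by rewrite /q; field; rewrite !gt_eqF.
rewrite e expr2 ler_pM2r// in bound.
by rewrite (le_trans bound)// ler_pM2r.
Qed.

Let psi z := f z + `|z|.

Let psi_cont : continuous psi.
Proof. by apply: continuous_add => //; apply: continuous_norm; exact: continuous_idE. Qed.

Let psi_supp z : r <= `|z| -> psi z = 0.
Proof.
have fr z' : r <= z' -> f z' = - z' by exact: neg_abs_conv_ge.
rewrite /psi; have [z0|z0] := leP 0 z.
  by rewrite ger0_norm// => /fr ->; rewrite addNr.
by rewrite ltr0_norm// => /fr; rewrite f_even => ->; rewrite opprK subrr.
Qed.

Definition walk_remainder (s : R) : R :=
  c_const d / 2 * cos_int m (fun t => psi (s * sin t)).

Let c_psi s : continuous (fun t => psi (s * sin t)).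
Proof.
by apply: (continuous_compE _ _ psi_cont); apply: continuous_scale; exact: continuous_sin.
Qed.

Lemma Phi_decomposition x :
  Phi x = - C_const d * enorm x + walk_remainder (enorm x).
Proof.
have c_abs s : continuous (fun t : R => `|s * sin t|).
  by apply: continuous_norm; apply: continuous_scale; exact: continuous_sin.
rewrite /Phi Phi_cos_int /walk_remainder /psi (pos_functionalD _ _ (cos_int_pos m))//.
have -> : cos_int m (fun t => `|enorm x * sin t|) = enorm x * (2 / m.+1%:R).
  rewrite -cos_int_abs_sin -(pos_functionalZ _ _ (cos_int_pos m)).
    by congr cos_int; apply/funext => t; rewrite normrM ger0_norm ?enorm_ge0.
  by apply: continuous_norm; exact: continuous_sin.
rewrite C_constE//.
have -> : d%:R - 1 = m.+1%:R :> R by rewrite /d -natr1 addrK.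
by field; rewrite nat1r pnatr_eq0.
Qed.

Lemma walk_remainder_even s : walk_remainder (- s) = walk_remainder s.
Proof.
rewrite /walk_remainder; congr (_ * cos_int _ _); apply/funext => t.
by rewrite mulNr /psi normrN f_even.
Qed.

Lemma continuous_walk_remainder : continuous walk_remainder.
Proof.
apply: continuous_scale.
apply: (pos_functional_continuous _ _ (cos_int_pos m) R (fun s t => psi (s * sin t))).
  exact: segment_compact.
apply: (continuous_compE _ _ psi_cont); apply: continuous_mul.
  by move=> p; exact: cvg_fst.
by apply: (continuous_compE _ _ (@continuous_sin R)) => p; exact: cvg_snd.
Qed.

(** As [psi] vanishes beyond [r], only latitudes with [|sin t| < r / s] count. There the integrand
    is dominated by a multiple of [cos t / (1 + (s sin t)^2)], whose primitive [atan (s sin t) / s]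
    varies by at most [pi / s]. *)
Lemma walk_remainder_bound : exists2 K, 0 <= K &
  forall s, 2 * r < s -> `|walk_remainder s| <= K / s.
Proof.
have rr : - r <= r by rewrite (@le_trans _ _ 0)// ?oppr_le0 ltW.
have [z0 _ hz] := EVT_max rr (continuous_subspaceT (continuous_norm _ psi_cont)).
pose M := `|psi z0|; have M0 : 0 <= M by exact: normr_ge0.
(* The factor 2 compensates [cos t >= 1/2] and [1 + r^2] the denominator, both on the set where
   [psi] may be nonzero. *)
pose K0 := 2 * M * (1 + r ^+ 2).
have K00 : 0 <= K0 by rewrite !mulr_ge0// addr_ge0 ?sqr_ge0.
exists (c_const d / 2 * (K0 * pi)).
  exact: mulr_ge0 (ltW c_gt0) (mulr_ge0 K00 (pi_ge0 R)).
move=> s rs.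
have s0 : 0 < s by rewrite (le_lt_trans _ rs)// mulr_ge0// ltW.
have q0 (t : R) : 0 < 1 + (s * sin t) ^+ 2 by rewrite ltr_wpDr ?sqr_ge0.
pose w t := cos t / (1 + (s * sin t) ^+ 2).
have dw (t : R) : is_derive t 1 (fun t => s^-1 * atan (s * sin t)) (w t).
  have := is_derive_scale s^-1 (@is_derive_compE R atan (fun t => s * sin t) t _ _
    (is_derive1_atan (s * sin t)) (is_derive_scale s (is_derive_sin t))).
  by congr is_derive; rewrite /w; field; rewrite !gt_eqF.
have cq : continuous (fun t => 1 + (s * sin t) ^+ 2).
  apply: continuous_add; first exact: cst_continuous.
  by apply: continuous_pow; apply: continuous_scale; exact: continuous_sin.
have cw : continuous w.
  apply: continuous_mul; first exact: continuous_cos.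
  by move=> t; apply: cvgV; [rewrite gt_eqF|exact: cq].
rewrite /walk_remainder normrM (gtr0_norm c_gt0) -[leRHS]mulrA (ler_pM2l c_gt0).
have ipsi : mu.-integrable `[- (pi / 2), pi / 2] (EFin \o (fun t => psi (s * sin t) * cos t ^+ m)).
  by apply: integrable_segment; apply: continuous_mul => //; exact: continuous_cosX.
rewrite /cos_int; apply: (@le_trans _ _ (\int[mu]_(t in `[- (pi / 2), pi / 2]) `|psi (s * sin t) * cos t ^+ m|)).
  exact: le_normr_Rintegral.
apply: (@le_trans _ _ (\int[mu]_(t in `[- (pi / 2), pi / 2]) (K0 * w t))).
  apply: le_Rintegral => //.
  - apply: integrable_segment; apply: continuous_norm; apply: continuous_mul => //.
    exact: continuous_cosX.
  - by apply: integrable_segment; exact: continuous_scale.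
  move=> t; rewrite /= in_itv/= => tI.
  have ct0 := cos_ge0_pihalf tI.
  have w0 : 0 <= w t by rewrite divr_ge0// ltW.
  have [far|near] := leP r `|s * sin t|.
    by rewrite psi_supp// mul0r normr0 mulr_ge0.
  (* This is where [s > 2 r] is used: the contributing latitudes stay far from the poles. *)
  have sin2 : sin t ^+ 2 <= 1 / 4.
    have h : `|sin t| <= 1 / 2.
      move: near; rewrite normrM (gtr0_norm s0) => near.
      have : s * `|sin t| <= s * (1 / 2) by lra.
      by rewrite ler_pM2l.
    rewrite -real_normK ?num_real//.
    have -> : 1 / 4 = (1 / 2) ^+ 2 :> R by field.
    by rewrite !expr2 ler_pM.
  have c12 : 1 / 2 <= cos t.
    rewrite leNgt; apply/negP => c2; move: (cos2Dsin2 t) sin2.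
    move: (cos t) ct0 c2 => c c0 c2; have : c ^+ 2 < 1 / 4 by nra.
    lra.
  have cm : cos t ^+ m <= 1 by rewrite exprn_ile1// cos_le1.
  have pM : `|psi (s * sin t)| <= M.
    by apply: hz; rewrite in_itv/= -ler_norml ltW.
  rewrite normrM (ger0_norm (exprn_ge0 _ ct0)).
  apply: (@le_trans _ _ (M * 1)); first by rewrite ler_pM// exprn_ge0.
  have sq : (s * sin t) ^+ 2 <= r ^+ 2.
    by rewrite -real_normK ?num_real// !expr2 ler_pM// ltW.
  rewrite /w mulrA ler_pdivlMr// mulr1.
  have -> : K0 * cos t = M * ((1 + r ^+ 2) * (2 * cos t)) by rewrite /K0; ring.
  rewrite ler_wpM2l// (@le_trans _ _ (1 + r ^+ 2))// ?lerD2l//.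
  by rewrite ler_peMr ?addr_ge0 ?sqr_ge0//; lra.
rewrite RintegralZl//; last exact: integrable_segment.
rewrite (ftc _ _ _ _ half_pi_le cw dw) sinN sin_pihalf mulrN1 atanN mulr1.
rewrite -[leRHS]mulrA ler_wpM2l//.
have := @atan_ltpi2 R s => h.
rewrite mulrN opprK -mulrDr mulrC ler_pM2r ?invr_gt0//; lra.
Qed.

End walk.

(** * From the hypotheses on [u] to the theorem *)

Lemma compact_support_bounded {R : realType} (u : R -> R) : compact_support u ->
  exists2 r, 0 < r & forall x, r <= `|x| -> u x = 0.
Proof.
move=> /compact_bounded[M [_ hM]].
have M1 : M < `|M| + 1 by rewrite (le_lt_trans (ler_norm M))// ltrDl.
exists (`|M| + 2); first by rewrite ltr_wpDl.
move=> x xM; apply/eqP; apply: contraT => ux.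
have := hM _ M1 x (@subset_closure _ [set x | u x != 0] x ux).
by rewrite /=; lra.
Qed.

(** In the order of [R[i]], nonnegativity also says that the imaginary part is 0; so one hypothesis
    yields both the sign of the cosine transform and the vanishing of the sine transform, at
    frequency [a / (2 pi)]. *)
Lemma fourier_ge0_transforms {R : realType} (u : R -> R) (r a : R) :
  (forall x, r <= `|x| -> u x = 0) -> (forall w, 0 <= fourier u w) ->
  0 <= cos_transform u r a /\ sin_transform u r a = 0.
Proof.
move=> us uf; have := uf (a / (2 * pi)); rewrite lecE /= => /andP[/eqP h1 h2].
have e x : 2 * pi * x * (a / (2 * pi)) = a * x.
  have p0 : pi != 0 :> R by rewrite gt_eqF ?pi_gt0.
  by move: pi p0 => p p0; field.
have rw (g : R -> R) :
    \int[lebesgue_measure]_x (g (2 * pi * x * (a / (2 * pi))) * u x) =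
    \int[lebesgue_measure]_(x in `[- r, r]) (g (a * x) * u x).
  rewrite -(Rintegral_supp u r us (fun x => g (a * x)) setT)//.
  by apply: eq_Rintegral => x _; rewrite e.
rewrite !rw in h1 h2; split=> //.
by apply/eqP; rewrite -oppr_eq0; apply/eqP.
Qed.

Theorem mainTheorem10 (R : realType) (n d : nat) (u : R -> R) :
  (2 <= d)%N -> Uspace n u ->
  let f := neg_abs_conv u in
  let F := I_op d f in
  let Phi := fun x : 'rV[R]_d => F (enorm x) in
  let L := 2 * Num.sqrt (d%:R) * supnorm u in
  [/\ CP1 Phi /\ (forall x, Phi x < 0),
      (exists phi : R -> R, [/\ C0_real phi, bigO_inv_at_infty phi &
          forall x, Phi x = - C_const d * enorm x + phi (enorm x)]),
      Ck_vec (n + 2) Phi,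
      (forall x y, enorm (grad Phi x - grad Phi y) <= L * enorm (x - y)) &
      concave_fun Phi /\
      (forall (lam : R) (x y : 'rV[R]_d), 0 <= lam <= 1 ->
         Phi (lam *: x + (1 - lam) *: y)
           <= lam * Phi x + (1 - lam) * Phi y
              + L / 2 * lam * (1 - lam) * enorm (x - y) ^+ 2)].
Proof.
case: d => [//|[//|m]] _ [Cu supp [u0 uf] ueven uint] f F Phi L.
have cu := Cn_continuous _ _ Cu.
have [r r0 us] := compact_support_bounded u supp.
have cos0 a := (fourier_ge0_transforms u r a us uf).1.
have sin0 a := (fourier_ge0_transforms u r a us uf).2.
have [K K0 hK] := walk_remainder_bound u r r0 cu us ueven uint m.
split.
- split; first exact (Phi_CP1 u r r0 cu us u0 ueven uint cos0 sin0 m).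
  exact (Phi_lt0 u r r0 cu us u0 ueven uint m).
- exists (walk_remainder u m); split.
  + have cv : walk_remainder u m x @[x --> +oo] --> (0 : R).
      apply/cvgrPdist_le => e e0.
      near=> s; rewrite sub0r normrN.
      have s1 : 2 * r < s by near: s; apply: nbhs_pinfty_gt; exact: num_real.
      have s2 : K / e < s by near: s; apply: nbhs_pinfty_gt; exact: num_real.
      have s0 : 0 < s by rewrite (le_lt_trans _ s1)// mulr_ge0// ltW.
      apply: (le_trans (hK _ s1)); rewrite ler_pdivrMr//.
      by rewrite -ler_pdivrMl// mulrC ltW.
    split; first exact (continuous_walk_remainder u r r0 cu us ueven uint m).
    (* The remainder is even, so its limit at [-oo] is the one at [+oo]. *)
    split=> //; apply/cvgNy_compNP => /=.
    have -> : (fun x => walk_remainder u m (- x)) = walk_remainder u m.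
      by apply/funext => x; exact: (walk_remainder_even u r r0 cu us ueven uint).
    exact: cv.
  + by exists K, (2 * r).
  + exact (Phi_decomposition u r r0 cu us u0 ueven uint m).
- exact (Phi_Ck u r r0 cu us u0 ueven uint cos0 sin0 m n Cu).
- exact (Phi_grad_lipschitz u r r0 cu us u0 ueven uint cos0 sin0 m).
- split; first exact (Phi_concave u r r0 cu us u0 ueven uint cos0 sin0 m).
  exact (Phi_semiconvex u r r0 cu us u0 ueven uint cos0 sin0 m).
Unshelve. all: by end_near. Qed.
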